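(* Let $(M,\tau)$ be a tracial $W^*$-probability space and let $(X_1,\dots,X_n)$, $n\ge 2$, be an $n$-tuple of self-adjoint elements of $M$ whose non-microstates free Fisher information satisfies $\Phi^*(X_1,\dots,X_n)<\infty$. Then $W^*(X_1,\dots,X_n)$ is a factor.
   Context: A tracial $W^*$-probability space $(M,\tau)$ is a von Neumann algebra $M$ with a faithful normal tracial state $\tau$; $\|x\|_2=\tau(x^*x)^{1/2}$. $W^*(X_1,\dots,X_n)\subset M$ is the (unital) von Neumann subalgebra generated by $X_1,\dots,X_n$. $\partial_i:\mathbb{C}\langle t_1,\dots,t_n\rangle\to\mathbb{C}\langle t_1,\dots,t_n\rangle^{\otimes 2}$ is the derivation with $\partial_i(t_j)=\delta_{ij}\,1\otimes 1$ (values in the bimodule with actions $a\cdot(b\otimes c)\cdot d=ab\otimes cd$). An element $\xi_i\in L^2(W^*(X_1,\dots,X_n),\tau)$ is the $i$-th conjugate variable if $\tau(\xi_i P(X_1,\dots,X_n))=(\tau\otimes\tau)\big((\partial_iP)(X_1,\dots,X_n)\big)$ for all $P\in\mathbb{C}\langle t_1,\dots,t_n\rangle$; it is unique when it exists. The non-microstates free Fisher information is $\Phi^*(X_1,\dots,X_n)=\sum_{i=1}^n\|\xi_i\|_2^2$ if all $\xi_i$ exist, and $\infty$ otherwise. *)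

(* Defs.v *)
From HB Require Import structures.
From mathcomp Require Import all_boot all_order all_algebra.
From mathcomp Require Import finmap.
From mathcomp Require Import all_classical all_reals all_analysis.
From mathcomp Require Import complex.
(* The notations of monalg conflict with those of MathComp-Analysis. *)
From mathcomp.multinomials Require Import -(notations) monalg.

Set Implicit Arguments.
Unset Strict Implicit.
Unset Printing Implicit Defensive.

Import Order.TTheory GRing.Theory Num.Theory.
Import numFieldNormedType.Exports.

Local Open Scope classical_set_scope.
Local Open Scope ring_scope.
Local Open Scope complex_scope.

(* The inner product is linear in its first argument and conjugate-linear in
   the second one. *)
HB.mixin Record CompleteNormedModule_isHilbert (R : realType) H
    of CompleteNormedModule R[i] H := {
  inner : {dot H for Num.conj};
  inner_norm : forall x : H, `|x| ^+ 2 = inner x x }.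

#[short(type="hilbertType")]
HB.structure Definition Hilbert (R : realType) :=
  { H of CompleteNormedModule R[i] H & CompleteNormedModule_isHilbert R H }.

Section VonNeumannAlgebras.
Context {R : realType} {H : hilbertType R}.
Implicit Types (S T : H -> H) (M : set (H -> H)).

(* Operators are bare functions H -> H: linear combinations are those of the
   function space, the product is \o, and B(H) is the set bounded_operator. *)
Definition bounded_operator : set (H -> H) :=
  [set T | linear T /\ continuous T].

Definition is_adjoint T S := forall x y, inner (T x) y = inner x (S y).

(* The adjoint is unique when it exists, and exists for all T in B(H). *)
Definition adjoint T : H -> H := xget 0 [set S | is_adjoint T S].

(* Weak operator topology: the coarsest one making all the maps
   T |-> <T x, y> continuous. *)
Definition wot : topologicalType :=
  initial_topology (fun T : H -> H =>
    (fun p => inner (T p.1) p.2) : {ptws H * H -> R[i]^o}).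

Definition l2_family : Type :=
  {x : nat -> H | cvgn (series (fun k => `|x k| ^+ 2 : R[i]^o))}.

(* Ultraweak topology: the coarsest one making all the maps
   T |-> \sum_k <T x_k, y_k> continuous, for x, y square-summable. *)
Definition uwt : topologicalType :=
  initial_topology (fun T : H -> H =>
    (fun p => limn (series (fun k =>
       inner (T (sval p.1 k)) (sval p.2 k) : R[i]^o)))
    : {ptws l2_family * l2_family -> R[i]^o}).

(* B(H) is not WOT-closed in the space of all functions, so that M is only
   required to be closed relatively to B(H). *)
Record von_neumann_algebra M : Prop := {
  vna_bounded : M `<=` bounded_operator;
  vna_id : M idfun;
  vna_linear : forall (a : R[i]) S T, M S -> M T -> M (a *: S + T);
  vna_comp : forall S T, M S -> M T -> M (S \o T);
  vna_adjoint : forall T, M T -> exists2 S, M S & is_adjoint T S;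
  vna_wot_closed : closure (M : set wot) `&` bounded_operator `<=` M }.

Definition vn_center M : set (H -> H) :=
  [set z | M z /\ forall T, M T -> z \o T = T \o z].

Definition is_factor M :=
  von_neumann_algebra M /\ vn_center M = [set c *: idfun | c in [set: R[i]]].

(* Only the values of tau on M are relevant. *)
Record tracial_Wstar_space M (tau : (H -> H) -> R[i]) : Prop := {
  tws_vna : von_neumann_algebra M;
  tws_linear : forall (a : R[i]) S T, M S -> M T ->
    tau (a *: S + T) = a * tau S + tau T;
  tws_unit : tau idfun = 1;
  tws_positive : forall T, M T -> 0 <= tau (adjoint T \o T);
  tws_faithful : forall T, M T -> tau (adjoint T \o T) = 0 -> T = 0;
  tws_tracial : forall S T, M S -> M T -> tau (S \o T) = tau (T \o S);
  tws_normal :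
    {within (M : set uwt), continuous (tau : uwt -> R[i]^o)} }.

Definition Wstar n (X : 'I_n -> H -> H) : set (H -> H) :=
  \bigcap_(N in [set N | von_neumann_algebra N /\ forall i, N (X i)]) N.

Definition norm2 (tau : (H -> H) -> R[i]) T : R :=
  Num.sqrt (complex.Re (tau (adjoint T \o T))).

(* L^2(N, tau) is the completion of N for norm2; an element of it is given by
   a Cauchy sequence in N. Sequences with norm2 (x k - y k) --> 0 represent
   the same element; L2_norm and L2_pair do not distinguish them. *)
Record L2 (N : set (H -> H)) (tau : (H -> H) -> R[i]) := {
  L2_seq :> nat -> H -> H;
  L2_mem : forall k, N (L2_seq k);
  L2_cauchy : forall e : R, 0 < e -> exists K : nat, forall k l : nat,
    (K <= k)%N -> (K <= l)%N -> norm2 tau (L2_seq k - L2_seq l) < e }.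

Definition L2_norm N tau (xi : L2 N tau) : R :=
  limn (fun k => norm2 tau (xi k)).

(* tau (xi T), for xi in L^2(N, tau) and T in N. *)
Definition L2_pair N tau (xi : L2 N tau) T : R[i] :=
  limn (fun k => tau (xi k \o T) : R[i]^o).

End VonNeumannAlgebras.

Arguments wot {R} H.
Arguments uwt {R} H.

Section NCPolynomials.
Variables (A : comNzRingType) (n : nat).

Local Notation word := (fmonom 'I_n).

(* A<t_1, ..., t_n> is the algebra of the free monoid; its tensor square is
   the free module on the pairs of words, (u, v) standing for u (x) v. *)
Local Notation ncpoly := (malg word A).
Local Notation ncpoly2 := (malg (word * word)%type A).

Definition ncvar (i : 'I_n) : ncpoly := mkmalgU (fmu i) 1.

Definition tensor_word (u v : word) : ncpoly2 :=
  mkmalgU ((u, v) : word * word) 1.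

Definition lin_ext (K : choiceType) (V : lmodType A) (f : K -> V)
  (P : malg K A) : V := \sum_(k <- msupp P) mcoeff k P *: f k.

(* a . Q and Q . d, where a . (b (x) c) . d = ab (x) cd. *)
Definition ncpoly2_lact (a : ncpoly) (Q : ncpoly2) : ncpoly2 :=
  lin_ext (fun u => lin_ext (fun p => tensor_word (fmmul u p.1) p.2) Q) a.

Definition ncpoly2_ract (Q : ncpoly2) (d : ncpoly) : ncpoly2 :=
  lin_ext (fun v => lin_ext (fun p => tensor_word p.1 (fmmul p.2 v)) Q) d.

(* The Leibniz rule on a word w: the sum of u (x) v over all the
   decompositions w = u t_i v. The unique derivation
   with t_j |-> delta_ij 1 (x) 1, see free_diffM and free_diff_var. *)
Definition word_diff (i : 'I_n) (w : word) : ncpoly2 :=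
  \sum_(k < size w | nth i w k == i)
    tensor_word (FMonom (take k w)) (FMonom (drop k.+1 w)).

Definition free_diff (i : 'I_n) : ncpoly -> ncpoly2 := lin_ext (word_diff i).

Lemma lin_extE (K : choiceType) (V : lmodType A) (f : K -> V)
    (D : {fset K}) (P : malg K A) : (msupp P `<=` D)%fset ->
  lin_ext f P = \sum_(k <- D) mcoeff k P *: f k.
Proof.
move=> sPD; rewrite /lin_ext (big_fset_incl _ sPD)// => k _ kP.
by rewrite mcoeff_outdom// scale0r.
Qed.

Lemma lin_ext_is_linear (K : choiceType) (V : lmodType A) (f : K -> V) :
  linear (lin_ext f).
Proof.
move=> a P Q.
pose D := (msupp P `|` (msupp Q `|` msupp (a *: P + Q)))%fset.
have sP : (msupp P `<=` D)%fset by exact: fsubsetUl.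
have sQ : (msupp Q `<=` D)%fset.
  by apply: fsubset_trans (fsubsetUr _ _); exact: fsubsetUl.
have sPQ : (msupp (a *: P + Q) `<=` D)%fset.
  by apply: fsubset_trans (fsubsetUr _ _); exact: fsubsetUr.
rewrite (lin_extE f sP) (lin_extE f sQ) (lin_extE f sPQ).
rewrite scaler_sumr -big_split/=; apply: eq_bigr => k _.
by rewrite mcoeffD mcoeffZ scalerDl scalerA.
Qed.

HB.instance Definition _ (K : choiceType) (V : lmodType A) (f : K -> V) :=
  GRing.isLinear.Build A (malg K A) V _ (lin_ext f) (lin_ext_is_linear f).

Lemma lin_extU (K : choiceType) (V : lmodType A) (f : K -> V) k :
  lin_ext f (mkmalgU k 1) = f k.
Proof.
rewrite (@lin_extE K V f [fset k]%fset) ?msuppU_le// big_seq_fset1.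
by rewrite mcoeffU eqxx scale1r.
Qed.

Lemma lin_ext_sum (K : choiceType) (V : lmodType A) (f : K -> V) (I : Type)
    (r : seq I) (P : pred I) (F : I -> malg K A) :
  lin_ext f (\sum_(k <- r | P k) F k) = \sum_(k <- r | P k) lin_ext f (F k).
Proof. exact: raddf_sum. Qed.

Lemma lin_ext_tensor (V : lmodType A) (f : word * word -> V) u v :
  lin_ext f (tensor_word u v) = f (u, v).
Proof. exact: lin_extU. Qed.

Lemma lact_word (u : word) (Q : ncpoly2) : ncpoly2_lact (mkmalgU u 1) Q =
  lin_ext (fun p => tensor_word (fmmul u p.1) p.2) Q.
Proof.
exact: (lin_extU (fun u => lin_ext (fun p => tensor_word (fmmul u p.1) p.2) Q)).
Qed.

Lemma ract_word (Q : ncpoly2) (v : word) : ncpoly2_ract Q (mkmalgU v 1) =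
  lin_ext (fun p => tensor_word p.1 (fmmul p.2 v)) Q.
Proof.
exact: (lin_extU (fun v => lin_ext (fun p => tensor_word p.1 (fmmul p.2 v)) Q)).
Qed.

Lemma word_diffM i (u v : word) :
  word_diff i (fmmul u v) =
  ncpoly2_ract (word_diff i u) (mkmalgU v 1) +
  ncpoly2_lact (mkmalgU u 1) (word_diff i v).
Proof.
rewrite lact_word ract_word.
pose t : word -> word -> ncpoly2 := tensor_word.
transitivity (\sum_(k < size u | nth i u k == i)
      t (FMonom (take k u)) (fmmul (FMonom (drop k.+1 u)) v) +
    \sum_(k < size v | nth i v k == i)
      t (fmmul u (FMonom (take k v))) (FMonom (drop k.+1 v))); last first.
  congr (_ + _); rewrite /word_diff lin_ext_sum; apply: eq_bigr => k _;
    by rewrite lin_ext_tensor.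
rewrite /word_diff -/t.
have -> : fmmul u v = FMonom (u ++ v) by rewrite fmmulE.
move: t => t; rewrite [fmonom_val _]/(u ++ v) size_cat big_split_ord.
congr (_ + _).
  apply: eq_big => k; first by rewrite nth_cat /= ltn_ord.
  move=> _; have -> : lshift (size v) k = k :> nat by [].
  rewrite fmmulE.
  rewrite takel_cat ?(ltnW (ltn_ord k))//; congr (t _ (FMonom _)).
  rewrite drop_cat; case: ltnP => // kl.
  have /eqP -> : k.+1 == size u by rewrite eqn_leq kl ltn_ord.
  by rewrite subnn drop0 drop_size.
apply: eq_big => k; have -> : rshift (size u) k = (size u + k)%N :> nat by [].
  by rewrite nth_cat ltnNge leq_addr addKn.
move=> _; rewrite fmmulE take_cat ltnNge leq_addr addKn; congr (t _ (FMonom _)).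
by rewrite drop_cat ltnNge -addnS leq_addr addKn.
Qed.

Lemma mkmalgUZ (K : choiceType) (c : A) (k : K) :
  mkmalgU k c = c *: (mkmalgU k 1 : malg K A).
Proof.
apply/malgP => v.
by rewrite mcoeffZ (mcoeffU k c) (mcoeffU k 1) mulrnAr mulr1.
Qed.

Lemma linear_words (V : lmodType A) (F : ncpoly -> V) : linear F ->
  forall P, F P = lin_ext (fun w => F (mkmalgU w 1)) P.
Proof.
move=> linF P; pose a := GRing.isLinear.Build A ncpoly V _ F linF.
pose G : {linear ncpoly -> V} := HB.pack F a.
rewrite {1}[P]monalgE -[F]/(G : _ -> _) linear_sum; apply: eq_bigr => w _.
by rewrite mkmalgUZ linearZ.
Qed.

Lemma lin_ext_pointwise (K : choiceType) (V : lmodType A) c (f g h : K -> V) P :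
  (forall k, h k = c *: f k + g k) ->
  lin_ext h P = c *: lin_ext f P + lin_ext g P.
Proof.
move=> hE; rewrite /lin_ext scaler_sumr -big_split; apply: eq_bigr => k _.
by rewrite hE scalerDr !scalerA mulrC.
Qed.

Lemma lact_linear P : linear (ncpoly2_lact P).
Proof.
by move=> c Q Q'; apply: lin_ext_pointwise => u; apply: lin_ext_is_linear.
Qed.

Lemma ract_linear Q : linear (ncpoly2_ract^~ Q).
Proof.
by move=> c Q1 Q2; apply: lin_ext_pointwise => u; apply: lin_ext_is_linear.
Qed.

Lemma mul_word (u : word) (Q : ncpoly) : (mkmalgU u 1 : ncpoly) * Q =
  lin_ext (fun v => mkmalgU (fmmul u v) 1 : ncpoly) Q.
Proof.
rewrite [LHS]fgmulUg; apply: eq_bigr => v _.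
by rewrite mul1r; exact: mkmalgUZ.
Qed.

Lemma free_diffM i (P Q : ncpoly) :
  free_diff i (P * Q) =
  ncpoly2_ract (free_diff i P) Q + ncpoly2_lact P (free_diff i Q).
Proof.
have L0 : linear (free_diff i) by exact: lin_ext_is_linear.
have L1 : linear (fun P => free_diff i (P * Q)).
  by move=> c P1 P2; rewrite mulrDl -scalerAl L0.
have L2 : linear (fun P => ncpoly2_ract (free_diff i P) Q +
                           ncpoly2_lact P (free_diff i Q)).
  move=> c P1 P2; rewrite L0 ract_linear.
  by rewrite {1}/ncpoly2_lact linearP scalerDr addrACA.
rewrite (linear_words L1) (linear_words L2).
apply: eq_bigr => u _; congr (_ *: _); rewrite mul_word.
have L3 : linear (fun Q => free_diff i
    (lin_ext (fun v => mkmalgU (fmmul u v) 1 : ncpoly) Q)).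
  by move=> c Q1 Q2; rewrite linearP L0.
have L4 : linear (fun Q : ncpoly =>
    ncpoly2_ract (free_diff i (mkmalgU u 1 : ncpoly)) Q +
    ncpoly2_lact (mkmalgU u 1 : ncpoly) (free_diff i Q)).
  move=> c Q1 Q2; rewrite L0 lact_linear {1}/ncpoly2_ract linearP.
  by rewrite scalerDr addrACA.
rewrite (linear_words L3) (linear_words L4).
apply: eq_bigr => v _; congr (_ *: _).
have fdw w : free_diff i (mkmalgU w 1) = word_diff i w.
  exact: (lin_extU (word_diff i)).
by rewrite (lin_extU _ v) 3!fdw word_diffM.
Qed.

Lemma free_diff_var i j : free_diff i (ncvar j) =
  if i == j then tensor_word (fmone 'I_n) (fmone 'I_n) else 0.
Proof.
transitivity (word_diff i (fmu j : word)).
  exact: (lin_extU (word_diff i)).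
by rewrite /word_diff fmuE fmoneE big_mkcond big_ord1 eq_sym.
Qed.

End NCPolynomials.

Section FreeFisherInformation.
Context {R : realType} {H : hilbertType R} {n : nat}.
Variables (tau : (H -> H) -> R[i]) (X : 'I_n -> H -> H).

Definition op_word (w : fmonom 'I_n) : H -> H :=
  foldr (fun j T => X j \o T) idfun w.

Definition op_eval : malg (fmonom 'I_n) R[i] -> H -> H := lin_ext op_word.

(* Q |-> (tau (x) tau) (Q(X)). *)
Definition tau_tensor :
    malg (fmonom 'I_n * fmonom 'I_n)%type R[i] -> R[i] :=
  @lin_ext R[i] _ R[i]^o (fun p => tau (op_word p.1) * tau (op_word p.2)).

Definition is_conjugate_variable (i : 'I_n) (xi : L2 (Wstar X) tau) : Prop :=
  forall P : malg (fmonom 'I_n) R[i],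
    L2_pair xi (op_eval P) = tau_tensor (free_diff i P).

(* The choice of the conjugate variables is immaterial, as they are unique in
   L^2(W^*(X), tau). *)
Definition free_fisher : \bar R :=
  if pselect (forall i, exists xi, is_conjugate_variable i xi) is left ex_xi
  then (\sum_(i < n) (L2_norm (sval (cid (ex_xi i))) ^+ 2)%:E)%E
  else +oo%E.

End FreeFisherInformation.

(* Main.v *)
Require Import Defs.
From HB Require Import structures.
From mathcomp Require Import all_boot all_order all_algebra.
From mathcomp Require Import finmap.
From mathcomp Require Import all_classical all_reals all_analysis.
From mathcomp Require Import complex.
From mathcomp Require Import ring lra zify.
From mathcomp.multinomials Require Import -(notations) monalg.

Set Implicit Arguments.
Unset Strict Implicit.
Unset Printing Implicit Defensive.

Import Order.TTheory GRing.Theory Num.Theory.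
Import numFieldNormedType.Exports.

Local Open Scope classical_set_scope.
Local Open Scope ring_scope.

(** Write [phi w] for the trace of the word [w] in the [X i], and consider on
    noncommutative polynomials the form <P, Q> = tau (Q(X)^* P(X)). Let z be in
    the center of W^*(X). The functional l(P) = tau (z^* P(X)) is bounded for
    the 2-norm and kills every commutator [X_i, P]. The heart of the proof
    ([central_functional]) is that such an l is a multiple of phi:
    l(P) = l(1) tau(P(X)). Then z - tau(z) is orthogonal to all polynomials in
    X; as these approximate it ([polynomials_dense]) and tau is normal
    ([tau_spatial_bound]), it is orthogonal to itself, so that z = tau(z) by
    faithfulness ([center_scalar]).

    Finiteness of the Fisher information enters only as a bound
    |(tau (x) tau)(d_i P)| <= K ||P(X)||_2 for the difference quotients d_i with
    respect to two of the variables, X_0 and X_1 ([fisher_bound]).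

    Here is why l is a multiple of phi. Minimize
    ||p||^2 + ||d_0 p||^2 - 2 Re l(p) approximately over the polynomials p.
    Testing the resulting p against [X_1, [X_1, p]], on which l vanishes, shows
    that [X_1, p] and [X_1, d_0 p] = d_0 [X_1, p] are small: the derivation d_0
    kills X_1, hence commutes with ad X_1. Now ad X_1 has dense range on
    L^2 (x) L^2, because finite Fisher information of X_1 makes its
    distribution diffuse, so the diagonal is a null set and x - y is a
    multiplier of dense range ([diffuse_ideal_dense], [ad2_dense]). By symmetry
    of ad X_1, the elements d_0 p then tend weakly to 0, and therefore p tends
    weakly to the functional l itself. It follows that [X_0, p] tends to 0 in
    norm ([central_approximation]). Finally
    d_0 [X_0, p] = [X_0, d_0 p] + 1 (x) p - p (x) 1 is paired with a fixed
    element 1 (x) w^*. The Fisher bound for [X_0, p] w makes the left hand side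
    vanish in the limit, weak convergence makes the first term on the right
    vanish, and what remains is l(v) = l(1) phi(v) for v = w^*.

    The polynomials are not completed: minimizers are replaced by near-minimizers
    ([near_riesz]), and limits by explicit error bounds. The
    diffuseness statement is also purely algebraic: with S = 1 - k (x - y)^2,
    the powers S^n tend to the indicator of the diagonal, and the conjugate
    relation applied to (x - y) S^n bounds the growth of
    \sum_(j <= n) (mu-average of the products of the y-averages of S^j and
    S^(n-j)) by o(n), while a diagonal of positive mass forces linear growth
    ([bump_vanishes]).

    Density of the polynomials in W^*(X) is the bicommutant theorem, in the
    amplified space of square-summable families that the ultraweak topology
    requires: the projection onto the closure of the orbit of a family under
    the polynomials has matrix entries which commute with the X_i, hence with
    W^*(X) ([bicommutant_adherent]). *)

(** * Moduli of complex numbers *)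

Section Modulus.
Variable R : realType.
Local Notation C := R[i]%C.
Implicit Types (x y z : C) (a : R).

(** The modulus as a real number: the norm of [R[i]] is complex-valued. *)
Definition cabs z : R := complex.Re `|z|.

Lemma cabsE z : `|z| = (cabs z)%:C%C.
Proof. by rewrite /cabs normc_def. Qed.

Lemma cabs_ge0 z : 0 <= cabs z.
Proof. by rewrite -ler0c -cabsE. Qed.

Lemma cabsM x y : cabs (x * y) = cabs x * cabs y.
Proof. by apply: complexI; rewrite rmorphM/= -!cabsE normrM. Qed.

Lemma cabsD x y : cabs (x + y) <= cabs x + cabs y.
Proof. by rewrite -lecR rmorphD/= -!cabsE ler_normD. Qed.

Lemma cabsN x : cabs (- x) = cabs x.
Proof. by rewrite /cabs normrN. Qed.

Lemma cabsB x y : cabs (x - y) = cabs (y - x).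
Proof. by rewrite -cabsN opprB. Qed.

Lemma cabs0 : cabs 0 = 0. Proof. by rewrite /cabs normr0. Qed.

Lemma cabs1 : cabs 1 = 1. Proof. by rewrite /cabs normr1. Qed.

Lemma cabs_conj x : cabs x^* = cabs x.
Proof. by rewrite /cabs norm_conjC. Qed.

Lemma cabs_eq0 x : cabs x = 0 -> x = 0.
Proof. by move=> x0; apply/eqP; rewrite -normr_eq0 cabsE x0. Qed.

Lemma sqr_cabs z : z * z^* = (cabs z ^+ 2)%:C%C.
Proof. by rewrite -normCK cabsE -rmorphXn. Qed.

Lemma cabs_real a : cabs a%:C%C = `|a|.
Proof. by rewrite /cabs normc_def/= expr0n/= addr0 sqrtr_sqr. Qed.

Lemma ReD x y : complex.Re (x + y) = complex.Re x + complex.Re y.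
Proof. by case: x y => ? ? []. Qed.

Lemma ReN x : complex.Re (- x) = - complex.Re x.
Proof. by case: x. Qed.

Lemma Re_conj z : complex.Re z^* = complex.Re z.
Proof. by case: z. Qed.

Lemma ReZ a z : complex.Re (a%:C%C * z) = a * complex.Re z.
Proof. by case: z => b c /=; rewrite mul0r subr0. Qed.

Lemma Re_le_cabs z : `|complex.Re z| <= cabs z.
Proof. by rewrite -lecR -cabsE; exact: normc_ge_Re. Qed.

Lemma ge0_Re z : 0 <= z -> z = (complex.Re z)%:C%C.
Proof. by move=> /ger0_Im; case: z => a b /= ->. Qed.

Lemma ge0_ReP z : 0 <= z -> 0 <= complex.Re z.
Proof. by move=> z0; rewrite -ler0c -ge0_Re. Qed.

Lemma cabs_sum I (r : seq I) (F : I -> C) :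
  cabs (\sum_(i <- r) F i) <= \sum_(i <- r) cabs (F i).
Proof.
elim/big_ind2 : _ => //; first by rewrite cabs0.
by move=> x a y b xa yb; apply: le_trans (cabsD _ _) (lerD xa yb).
Qed.

Lemma cabs_le_eps z : (forall e : R, 0 < e -> cabs z <= e) -> z = 0.
Proof.
move=> h; apply: cabs_eq0; apply/eqP; rewrite eq_le cabs_ge0 andbT.
by apply/ler_addgt0Pr => e e0; rewrite add0r h.
Qed.

End Modulus.

(** * Positive semidefinite forms *)

Section SemiInnerProducts.
Variables (R : realType) (V : lmodType R[i]%C).
Local Notation C := R[i]%C.
Implicit Types (D : set V) (B : V -> V -> C).

(** A semi-inner product on a subspace [D], given by a set so that it applies to
    the operators of an algebra inside the space of all functions. *)
Record psd D B : Prop := {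
  psd_0 : D 0;
  psd_closed : forall a x y, D x -> D y -> D (a *: x + y);
  psd_linl : forall a x y z, D x -> D y -> D z ->
    B (a *: x + y) z = a * B x z + B y z;
  psd_herm : forall x y, D x -> D y -> B y x = (B x y)^*;
  psd_ge0 : forall x, D x -> 0 <= B x x }.

Definition nrm B (x : V) : R := Num.sqrt (complex.Re (B x x)).

Lemma nrm_ge0 B x : 0 <= nrm B x. Proof. exact: sqrtr_ge0. Qed.

Section Theory.
Variables (D : set V) (B : V -> V -> C).
Hypothesis BP : psd D B.
Local Notation nrm := (nrm B).

Lemma psdE x : D x -> B x x = (nrm x ^+ 2)%:C%C.
Proof.
move=> Dx; have B0 := psd_ge0 BP Dx.
by rewrite [LHS]ge0_Re// sqr_sqrtr// ge0_ReP.
Qed.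

Lemma sqr_nrm x : D x -> nrm x ^+ 2 = complex.Re (B x x).
Proof. by move=> Dx; rewrite psdE. Qed.

Lemma psdD x y : D x -> D y -> D (x + y).
Proof. by move=> Dx Dy; rewrite -[x]scale1r; apply: (psd_closed BP). Qed.

Lemma psdZ a x : D x -> D (a *: x).
Proof.
by move=> Dx; rewrite -[_ *: _]addr0; apply: (psd_closed BP) => //; exact: psd_0 BP.
Qed.

Lemma psdB x y : D x -> D y -> D (x - y).
Proof. by move=> Dx Dy; rewrite -scaleN1r addrC; apply: (psd_closed BP). Qed.

Lemma psd_0l z : D z -> B 0 z = 0.
Proof.
move=> Dz; have D0 := psd_0 BP; have := psd_linl BP 1 D0 D0 Dz.
by rewrite scale1r addr0 mul1r => /eqP; rewrite -subr_eq subrr => /eqP.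
Qed.

Lemma psdDl x y z : D x -> D y -> D z -> B (x + y) z = B x z + B y z.
Proof. by move=> ? ? ?; rewrite -{1}[x]scale1r (psd_linl BP)// mul1r. Qed.

Lemma psdZl a x z : D x -> D z -> B (a *: x) z = a * B x z.
Proof.
move=> Dx Dz; rewrite -[_ *: _]addr0 (psd_linl BP)//; last exact: psd_0 BP.
by rewrite psd_0l// addr0.
Qed.

Lemma psdBl x y z : D x -> D y -> D z -> B (x - y) z = B x z - B y z.
Proof.
by move=> ? ? ?; rewrite -scaleN1r addrC (psd_linl BP)// mulN1r addrC.
Qed.

Lemma psdDr x y z : D x -> D y -> D z -> B z (x + y) = B z x + B z y.
Proof.
move=> Dx Dy Dz; rewrite (psd_herm BP (psdD Dx Dy) Dz) psdDl// rmorphD/=.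
by rewrite -!(psd_herm BP).
Qed.

Lemma psdZr a x z : D x -> D z -> B z (a *: x) = a^* * B z x.
Proof.
move=> Dx Dz; rewrite (psd_herm BP (psdZ a Dx) Dz) psdZl// rmorphM/=.
by rewrite -!(psd_herm BP).
Qed.

Lemma psdBr x y z : D x -> D y -> D z -> B z (x - y) = B z x - B z y.
Proof.
move=> Dx Dy Dz; rewrite (psd_herm BP (psdB Dx Dy) Dz) psdBl// rmorphB/=.
by rewrite -!(psd_herm BP).
Qed.

Lemma sqr_nrmD x y t : D x -> D y ->
  nrm (x + t *: y) ^+ 2 =
  nrm x ^+ 2 + 2 * complex.Re (t^* * B x y) + cabs t ^+ 2 * nrm y ^+ 2.
Proof.
move=> Dx Dy; have Dty := psdZ t Dy.
rewrite !sqr_nrm//; last exact: psdD.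
rewrite psdDl ?psdDr ?psdZl ?psdZr//; try exact: psdD.
rewrite (psd_herm BP Dx Dy) !ReD mulrA sqr_cabs ReZ.
have -> : t * (B x y)^* = (t^* * B x y)^* by rewrite rmorphM/= conjCK.
by rewrite Re_conj; ring.
Qed.

(** The discriminant argument behind the Cauchy-Schwarz inequality: the witness
    is s = 1/n, or a large s when n = 0. *)
Lemma quadratic_bound (a e n : R) : 0 <= a -> 0 <= e -> 0 <= n ->
  (forall s : R, 0 < s -> 2 * s * a <= e + s ^+ 2 * a * n) -> a <= e * n.
Proof.
move=> a0 e0; rewrite le_eqVlt => /predU1P[<-|n0] h.
  rewrite mulr0 leNgt; apply/negP => ap.
  have s0 : 0 < (e + 1) / (2 * a) by apply: divr_gt0; lra.
  have := h _ s0; rewrite mulr0 addr0.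
  have -> : 2 * ((e + 1) / (2 * a)) * a = e + 1 by field; rewrite gt_eqF.
  by lra.
have := h n^-1; rewrite invr_gt0 => /(_ n0).
have -> : n^-1 ^+ 2 * a * n = n^-1 * a by field; rewrite gt_eqF.
by rewrite -ler_pdivrMr// [a / n]mulrC; lra.
Qed.

Lemma cauchy_schwarz x y : D x -> D y -> cabs (B x y) <= nrm x * nrm y.
Proof.
move=> Dx Dy; set b := B x y.
rewrite -(@ler_pXn2r _ 2)// ?nnegrE ?cabs_ge0 ?mulr_ge0 ?nrm_ge0//.
rewrite exprMn; apply: quadratic_bound; rewrite ?sqr_ge0// => s s0.
have := sqr_ge0 (nrm (x + (- s%:C%C * b) *: y)).
rewrite sqr_nrmD//; have -> : (- s%:C%C * b)^* * B x y
    = (- (s * cabs b ^+ 2))%:C%C.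
  have cs : (s%:C%C)^* = s%:C%C :> C by exact: conjc_real.
  rewrite rmorphM/= rmorphN/= cs -mulrA [_^* * _]mulrC sqr_cabs mulNr.
  by rewrite -rmorphM/= -rmorphN.
rewrite cabsM cabsN cabs_real (gtr0_norm s0) exprMn /=.
by set u := cabs b ^+ 2; set v := nrm x ^+ 2; set w := nrm y ^+ 2; nra.
Qed.

Lemma nrmD x y : D x -> D y -> nrm (x + y) <= nrm x + nrm y.
Proof.
move=> Dx Dy; rewrite -(@ler_pXn2r _ 2)// ?nnegrE ?addr_ge0 ?nrm_ge0//.
have := sqr_nrmD 1 Dx Dy; rewrite scale1r rmorph1 mul1r cabs1 => ->.
have := cauchy_schwarz Dx Dy.
move: (Re_le_cabs (B x y)); rewrite ler_norml => /andP[_].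
set u := complex.Re _; set c := cabs _; nra.
Qed.

Lemma nrmZ a x : D x -> nrm (a *: x) = cabs a * nrm x.
Proof.
move=> Dx; have Dax := psdZ a Dx.
apply/eqP; rewrite -(@eqrXn2 _ 2)// ?mulr_ge0 ?nrm_ge0 ?cabs_ge0//.
by rewrite (sqr_nrm Dax) psdZl// psdZr// mulrA sqr_cabs ReZ exprMn sqr_nrm.
Qed.

Lemma nrmB x y : D x -> D y -> nrm (x - y) <= nrm x + nrm y.
Proof.
move=> Dx Dy; rewrite -scaleN1r (le_trans (nrmD Dx (psdZ _ Dy)))//.
by rewrite nrmZ// cabsN cabs1 mul1r.
Qed.

Lemma nrm_le_eps x K : (forall y, D y -> cabs (B y x) <= K * nrm y) ->
  D x -> 0 <= K -> nrm x <= K.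
Proof.
move=> h Dx K0; have := h x Dx; rewrite psdE// cabs_real ger0_norm ?sqr_ge0//.
have := nrm_ge0 B x; rewrite le_eqVlt => /predU1P[<-//|x0].
by rewrite expr2 ler_pM2r.
Qed.

(** Riesz representation without completeness: a near-minimizer of
    p |-> |p|^2 - 2 Re l(p) represents [l] up to [e], because the variation of
    this functional in the direction of [q] is controlled by its distance to
    the infimum. *)
Lemma near_riesz (l : V -> C) (M : R) : 0 <= M ->
    (forall a x y, D x -> D y -> l (a *: x + y) = a * l x + l y) ->
    (forall x, D x -> cabs (l x) <= M * nrm x) ->
  forall e : R, 0 < e -> exists p, D p /\
    forall q, D q -> cabs (l q - B q p) <= e * nrm q.
Proof.
move=> M0 ll lM e e0.
pose J p := nrm p ^+ 2 - 2 * complex.Re (l p).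
pose S := [set J p | p in D].
have infS : has_inf S.
  split; first by exists (J 0); exists 0 => //; exact: psd_0 BP.
  exists (- M ^+ 2) => _ [p Dp <-]; rewrite /J.
  have := le_trans (Re_le_cabs _) (lM _ Dp); rewrite ler_norml => /andP[_].
  by have := sqr_ge0 (nrm p - M); nra.
have e20 : 0 < e ^+ 2 by rewrite exprn_gt0.
have [_ [p Dp <-] Jp] := inf_adherent e20 infS.
exists p; split=> // q Dq; set d := l q - B q p.
rewrite -(@ler_pXn2r _ 2)// ?nnegrE ?cabs_ge0 ?mulr_ge0 ?nrm_ge0 ?(ltW e0)//.
rewrite exprMn; apply: quadratic_bound; rewrite ?sqr_ge0// => s s0.
have Dt : D ((s%:C%C * d^*) *: q + p) by apply: (psd_closed BP).
have : inf S <= J ((s%:C%C * d^*) *: q + p).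
  by apply: ge_inf; [exact: infS.2|exists ((s%:C%C * d^*) *: q + p)].
rewrite -(lerD2r (e ^+ 2)) => /(lt_le_trans Jp).
rewrite /J ll// [_ *: _ + _]addrC sqr_nrmD//.
set t := s%:C%C * d^*.
have ct : cabs t = s * cabs d by rewrite cabsM cabs_real (gtr0_norm s0) cabs_conj.
have -> : complex.Re (t^* * B p q) = complex.Re (t * B q p).
  by rewrite (psd_herm BP Dq Dp) -rmorphM/= Re_conj.
have : complex.Re (t * l q) - complex.Re (t * B q p) = s * cabs d ^+ 2.
  rewrite -ReN -ReD -mulrBr -/d /t -mulrA [_^* * _]mulrC sqr_cabs.
  by rewrite ReZ.
rewrite ReD ct exprMn.
set u := cabs d ^+ 2; set v := nrm p ^+ 2; set w := nrm q ^+ 2.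
set x1 := complex.Re _; set x2 := complex.Re _; set x3 := complex.Re _.
by move=> h1 h2; nra.
Qed.

Lemma geometric_unbounded (r K : R) : 1 < r -> exists k, K < r ^+ k.
Proof.
move=> r1; have b k : 1 + (r - 1) *+ k <= r ^+ k.
  elim: k => [|k ih]; first by rewrite mulr0n addr0.
  rewrite exprS mulrSr; have : 0 <= (r - 1) *+ k by rewrite mulrn_wge0; lra.
  by nra.
have r0 : 0 < r - 1 by lra.
exists (Num.bound `|K / (r - 1)|); apply: lt_le_trans (b _).
have := le_lt_trans (ler_norm _) (archi_boundP (normr_ge0 (K / (r - 1)))).
rewrite -mulr_natr ltr_pdivrMr//; lra.
Qed.

(** The spectral radius bounds a symmetric operator: the sequence
    s_k = |A^k x|^2 is log-convex, so that s_1 > c s_0 would make it grow at a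
    geometric rate larger than c. *)
Lemma symmetric_growth_bound (A : V -> V) (c : R) : 0 < c ->
    (forall x, D x -> D (A x)) ->
    (forall x y, D x -> D y -> B (A x) y = B x (A y)) ->
    (forall x, D x -> exists K, forall k, nrm (iter k A x) ^+ 2 <= K * c ^+ k) ->
  forall x, D x -> nrm (A x) ^+ 2 <= c * nrm x ^+ 2.
Proof.
move=> c0 DA sA gA x Dx; have [K hK] := gA x Dx.
have Dk k : D (iter k A x) by elim: k => //= k; exact: DA.
pose s k := nrm (iter k A x) ^+ 2.
have s_ge0 k : 0 <= s k by exact: sqr_ge0.
have logc k : s k.+1 ^+ 2 <= s k * s k.+2.
  have le : s k.+1 <= nrm (iter k A x) * nrm (iter k.+2 A x).
    rewrite {1}/s (sqr_nrm (Dk k.+1)) [iter k.+1 A x]/= (sA _ _ (Dk k) (Dk k.+1)).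
    have := cauchy_schwarz (Dk k) (Dk k.+2); apply: le_trans.
    by apply: le_trans (Re_le_cabs _); exact: ler_norm.
  by rewrite /s -exprMn ler_pXn2r ?nnegrE ?mulr_ge0 ?nrm_ge0.
rewrite leNgt; apply/negP => hx.
have s01 : c * s 0 < s 1 by [].
have s1 : 0 < s 1 by apply: le_lt_trans s01; rewrite mulr_ge0// ltW.
have s0 : 0 < s 0.
  rewrite lt_neqAle s_ge0 andbT eq_sym; apply/eqP => s0.
  have := logc 0; rewrite s0 mul0r => h.
  by have := exprn_gt0 2 s1; lra.
pose rho := s 1 / s 0.
have rho0 : 0 < rho by rewrite divr_gt0.
have step k : 0 < s k /\ rho * s k <= s k.+1.
  elim: k => [|k [ih1 ih2]]; first by rewrite /rho divfK ?gt_eqF.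
  have sk : 0 < s k.+1 by apply: lt_le_trans ih2; rewrite mulr_gt0.
  split=> //; rewrite -(ler_pM2r ih1).
  by have := logc k; nra.
have lower k : rho ^+ k * s 0 <= s k.
  elim: k => [|k ih]; first by rewrite mul1r.
  by rewrite exprS -mulrA (le_trans _ (step k).2)// ler_pM2l.
have r1 : 1 < rho / c by rewrite ltr_pdivlMr// mul1r ltr_pdivlMr.
have [k] := geometric_unbounded (K / s 0) r1.
rewrite ltr_pdivrMr// expr_div_n mulrAC ltr_pdivlMr ?exprn_gt0//.
by move=> /(lt_le_trans)/(_ (lower k)); rewrite ltNge hK.
Qed.

End Theory.

(** Hermitian symmetry follows from positivity by polarization, with the
    coefficients 1 and i. *)
Lemma psd_intro D B : D 0 ->
    (forall a x y, D x -> D y -> D (a *: x + y)) ->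
    (forall a x y z, D x -> D y -> D z ->
       B (a *: x + y) z = a * B x z + B y z) ->
    (forall a x y z, D x -> D y -> D z ->
       B z (a *: x + y) = a^* * B z x + B z y) ->
    (forall x, D x -> 0 <= B x x) -> psd D B.
Proof.
move=> D0 cl ll lr ge0; split=> // x y Dx Dy.
have h t : complex.Im (B (t *: x + y) (t *: x + y)) = 0.
  by apply: ger0_Im; apply: ge0; exact: cl.
have Bx := ger0_Im (ge0 _ Dx); have By := ger0_Im (ge0 _ Dy).
have := h 1; have := h 'i%C.
rewrite !ll ?lr ?ll//; try exact: cl.
rewrite rmorph1 !mul1r.
case: (B x x) (B y y) (B x y) (B y x) Bx By => [a b] [c d] [e f] [g k]/= -> ->.
move=> h1 h2; apply/eqP; rewrite eq_complex/=.
by apply/andP; split; apply/eqP; lra.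
Qed.

End SemiInnerProducts.

Lemma psd_pullback (R : realType) (V W : lmodType R[i]%C) (D : set W) B
    (f : V -> W) : linear f -> psd D B -> (forall x, D (f x)) ->
  psd setT (fun x y => B (f x) (f y)).
Proof.
move=> lf BP Df; split=> //.
- by move=> a x y z _ _ _; rewrite lf (psd_linl BP).
- by move=> x y _ _; rewrite (psd_herm BP).
- by move=> x _; rewrite (psd_ge0 BP).
Qed.

(** * Forms given by kernels *)

Section Sums.
Variables (R : realType) (V : lmodType R[i]%C).
Local Notation C := R[i]%C.
Variables (D : set V) (B : V -> V -> C).
Hypothesis BP : psd D B.

Lemma psd_sum_mem (I : Type) (r : seq I) (a : I -> C) (v : I -> V) :
  (forall i, D (v i)) -> D (\sum_(i <- r) a i *: v i).
Proof.
move=> Dv; elim/big_rec: _ => [|i x _ Dx]; first exact: psd_0 BP.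
exact: (psd_closed BP).
Qed.

Lemma psd_suml (I : Type) (r : seq I) (a : I -> C) (v : I -> V) z :
  (forall i, D (v i)) -> D z ->
  B (\sum_(i <- r) a i *: v i) z = \sum_(i <- r) a i * B (v i) z.
Proof.
move=> Dv Dz; elim: r => [|i r ih]; first by rewrite !big_nil (psd_0l BP).
by rewrite !big_cons (psd_linl BP)// ?ih//; exact: psd_sum_mem.
Qed.

Lemma psd_sumr (I : Type) (r : seq I) (a : I -> C) (v : I -> V) z :
  (forall i, D (v i)) -> D z ->
  B z (\sum_(i <- r) a i *: v i) = \sum_(i <- r) (a i)^* * B z (v i).
Proof.
move=> Dv Dz; rewrite (psd_herm BP _ Dz) ?psd_suml//; last exact: psd_sum_mem.
rewrite rmorph_sum; apply: eq_bigr => i _.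
by rewrite rmorphM/= -(psd_herm BP).
Qed.

End Sums.

Section Schur.
Variables (R : realType) (V W : lmodType R[i]%C).
Local Notation C := R[i]%C.
Variables (D : set V) (B : V -> V -> C) (E : set W) (G : W -> W -> C).
Hypotheses (BP : psd D B) (GP : psd E G).

(** The Schur product theorem: one step of Gram-Schmidt on the first factor
    replaces [v i] by its component orthogonal to [v 0]; the error is a rank one
    term, whose product with [G] is a value of [G] on the diagonal. *)
Lemma schur_product m (v : nat -> V) (w : nat -> W) :
  (forall i, D (v i)) -> (forall i, E (w i)) ->
  0 <= \sum_(i < m) \sum_(j < m) B (v i) (v j) * G (w i) (w j).
Proof.
elim: m v w => [|m ih] v w Dv Ew; first by rewrite big_ord0.
pose b := B (v 0%N) (v 0%N); have b0 : 0 <= b by exact: (psd_ge0 BP (Dv 0%N)).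
have rest F : (forall i, F 0%N i = 0) -> (forall i, F i 0%N = 0) ->
    \sum_(i < m.+1) \sum_(j < m.+1) F i j =
    \sum_(i < m) \sum_(j < m) F i.+1 j.+1 :> C.
  move=> F0 F1; rewrite big_ord_recl/= big1 ?add0r//.
  by apply: eq_bigr => i _; rewrite big_ord_recl/= F1 add0r.
have [bz|bnz] := eqVneq b 0.
  have v0 i : B (v 0%N) (v i) = 0.
    apply: cabs_eq0; apply/eqP; rewrite eq_le cabs_ge0 andbT.
    have := cauchy_schwarz BP (Dv 0%N) (Dv i).
    by rewrite {1}/nrm -/b bz sqrtr0 mul0r.
  rewrite (rest (fun i j => B (v i) (v j) * G (w i) (w j))).
  - exact: (ih (fun i => v i.+1) (fun i => w i.+1)).
  - by move=> i; rewrite v0 mul0r.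
  - by move=> i; rewrite (psd_herm BP (Dv 0%N) (Dv i)) v0 rmorph0 mul0r.
pose v' i := (- (B (v i) (v 0%N) / b)) *: v 0%N + v i.
have Dv' i : D (v' i) by exact: (psd_closed BP).
have v'0 i : B (v' i) (v 0%N) = 0.
  by rewrite (psd_linl BP)// -/b mulNr divfK// addNr.
have v'00 : v' 0%N = 0 by rewrite /v' divff// scaleN1r addNr.
have v'B i j : B (v i) (v j) =
    B (v' i) (v' j) + b^-1 * (B (v i) (v 0%N) * (B (v j) (v 0%N))^*).
  have -> : B (v' i) (v' j) = B (v' i) (v j).
    rewrite [v' j in LHS]/v' (psdDr BP)//; last exact: (psdZ BP).
    by rewrite (psdZr BP)// v'0 mulr0 add0r.
  rewrite /v' (psd_linl BP)// (psd_herm BP (Dv j) (Dv 0%N)).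
  by rewrite -[LHS]addr0; field.
under eq_bigr => i _ do under eq_bigr => j _ do rewrite v'B mulrDl.
under eq_bigr => i _ do rewrite big_split/=.
rewrite big_split/= addr_ge0//.
  rewrite (rest (fun i j => B (v' i) (v' j) * G (w i) (w j))).
  - exact: (ih (fun i => v' i.+1) (fun i => w i.+1)).
  - by move=> i; rewrite v'00 (psd_0l BP) ?mul0r.
  - by move=> i; rewrite v'00 (psd_herm BP (psd_0 BP)) ?(psd_0l BP) ?rmorph0 ?mul0r.
pose u := \sum_(i < m.+1) B (v i) (v 0%N) *: w i.
suff -> : \sum_(i < m.+1) \sum_(j < m.+1)
   b^-1 * (B (v i) (v 0%N) * (B (v j) (v 0%N))^*) * G (w i) (w j) = b^-1 * G u u.
  by rewrite mulr_ge0 ?invr_ge0// (psd_ge0 GP)//; exact: (psd_sum_mem GP).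
have Eu : E u by exact: (psd_sum_mem GP).
rewrite {1}/u (psd_suml GP)// mulr_sumr; apply: eq_bigr => i _.
rewrite /u (psd_sumr GP)// !mulr_sumr; apply: eq_bigr => j _.
by rewrite !mulrA.
Qed.

End Schur.

Section LinExt.
Variable A : comNzRingType.

Lemma linear_lin_ext (K : choiceType) (V W : lmodType A) (F : V -> W)
    (u : K -> V) (P : malg K A) :
  linear F -> F (lin_ext u P) = lin_ext (fun k => F (u k)) P.
Proof.
move=> lF; pose a := GRing.isLinear.Build A V W _ F lF.
pose L : {linear V -> W} := HB.pack F a.
rewrite -[F]/(L : V -> W) /lin_ext linear_sum; apply: eq_bigr => k _.
by rewrite linearZ.
Qed.

Fact basis_map_key : unit. Proof. by []. Qed.

(** Locked, because unification would otherwise try to compute with finitely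
    supported functions. *)
Definition basis_map (K L : choiceType) (f : K -> L) : malg K A -> malg L A :=
  locked_with basis_map_key (lin_ext (fun k => mkmalgU (f k) 1)).

Lemma basis_mapE (K L : choiceType) (f : K -> L) :
  basis_map f = lin_ext (fun k => mkmalgU (f k) 1).
Proof. by rewrite /basis_map; case: basis_map_key. Qed.

Lemma basis_map_linear (K L : choiceType) (f : K -> L) : linear (basis_map f).
Proof. by rewrite basis_mapE; exact: lin_ext_is_linear. Qed.

HB.instance Definition _ (K L : choiceType) (f : K -> L) :=
  GRing.isLinear.Build A (malg K A) (malg L A) _ (basis_map f)
    (basis_map_linear f).

Lemma basis_mapU (K L : choiceType) (f : K -> L) k :
  basis_map f (mkmalgU k 1) = mkmalgU (f k) 1.
Proof. by rewrite basis_mapE lin_extU. Qed.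

Lemma lin_ext_id (K : choiceType) (P : malg K A) :
  lin_ext (fun k => mkmalgU k 1) P = P.
Proof. by rewrite {2}[P]monalgE; apply: eq_bigr => k _; rewrite -mkmalgUZ. Qed.

Lemma basis_map_id (K : choiceType) (f : K -> K) (P : malg K A) :
  f =1 id -> basis_map f P = P.
Proof. by move=> /funext ->; rewrite basis_mapE; exact: lin_ext_id. Qed.

Lemma linear_ext (K : choiceType) (V : lmodType A) (F G : malg K A -> V) :
  linear F -> linear G -> (forall k, F (mkmalgU k 1) = G (mkmalgU k 1)) ->
  F =1 G.
Proof.
move=> lF lG FG P; rewrite -[P]lin_ext_id !linear_lin_ext//.
by congr lin_ext; apply/funext.
Qed.

Lemma lin_ext_basis_map (K L : choiceType) (V : lmodType A) (f : K -> L)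
    (u : L -> V) P : lin_ext u (basis_map f P) = lin_ext (fun k => u (f k)) P.
Proof.
rewrite basis_mapE linear_lin_ext; last exact: lin_ext_is_linear.
by congr lin_ext; apply/funext => k; rewrite lin_extU.
Qed.

Lemma basis_map_comp (K L N : choiceType) (f : K -> L) (g : L -> N) P :
  basis_map g (basis_map f P) = basis_map (g \o f) P.
Proof. by rewrite (basis_mapE g) lin_ext_basis_map basis_mapE. Qed.

Lemma basis_mapB (K L : choiceType) (f : K -> L) P Q :
  basis_map f (P - Q) = basis_map f P - basis_map f Q.
Proof. exact: linearB. Qed.

Lemma basis_map_comm (K : choiceType) (f g : K -> K) (P : malg K A) :
  (forall k, f (g k) = g (f k)) ->
  basis_map f (basis_map g P) = basis_map g (basis_map f P).
Proof.
move=> fg; rewrite !basis_map_comp; congr (basis_map _ P).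
by apply/funext => k; exact: fg.
Qed.

End LinExt.

Section KernelForms.
Variables (R : realType) (K : choiceType).
Local Notation C := R[i]%C.
Implicit Types (k : K -> K -> C) (P Q : malg K C).

Fact kform_key : unit. Proof. by []. Qed.

(** The sesquilinear extension of a kernel to finite combinations of its
    points. The two linear extensions, the inner one conjugated, give linearity
    on both sides for free; locked for the same reason as [basis_map]. *)
Definition kform k : malg K C -> malg K C -> C :=
  locked_with kform_key (fun P Q =>
    lin_ext (fun x => ((lin_ext (fun y => (k x y)^* : C^o) Q) : C)^* : C^o) P).

Lemma kform_unlock k P Q : kform k P Q =
  lin_ext (fun x => ((lin_ext (fun y => (k x y)^* : C^o) Q) : C)^* : C^o) P.
Proof. by rewrite /kform; case: kform_key. Qed.

Lemma kformE k P Q : kform k P Q =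
  \sum_(x <- msupp P) \sum_(y <- msupp Q)
    mcoeff x P * (mcoeff y Q)^* * k x y.
Proof.
rewrite kform_unlock; apply: eq_bigr => x _; rewrite /lin_ext rmorph_sum /= scaler_sumr.
apply: eq_bigr => y _.
by rewrite -[LHS]/(mcoeff x P * (mcoeff y Q * (k x y)^*)^*) rmorphM/= conjCK mulrA.
Qed.

Lemma kform_linl k Q : linear (fun P => kform k P Q : C^o).
Proof. by move=> a x y; rewrite !kform_unlock; exact: lin_ext_is_linear. Qed.

Lemma kform_linr k P a Q Q' :
  kform k P (a *: Q + Q') = a^* * kform k P Q + kform k P Q'.
Proof.
rewrite !kform_unlock; set f := fun x => _; set g := fun x => _; set h := fun x => _.
apply: (@lin_ext_pointwise C _ C^o a^* g h f P) => x; rewrite /f/g/h.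
by rewrite lin_ext_is_linear rmorphD/= rmorphM.
Qed.

Lemma kformU k x y : kform k (mkmalgU x 1) (mkmalgU y 1) = k x y.
Proof. by rewrite kform_unlock !lin_extU conjCK. Qed.

Lemma kform_psd k : (forall P, 0 <= kform k P P) -> psd setT (kform k).
Proof.
move=> k0; apply: psd_intro => //.
  by move=> a x y z _ _ _; apply: kform_linl.
by move=> a x y z _ _ _; apply: kform_linr.
Qed.

Lemma kformB k k' c P Q :
  kform (fun x y => c * k x y - k' x y) P Q = c * kform k P Q - kform k' P Q.
Proof.
rewrite !kformE mulr_sumr -sumrB; apply: eq_bigr => x _.
rewrite mulr_sumr -sumrB; apply: eq_bigr => y _; ring.
Qed.

End KernelForms.

Lemma kform_basis_map (R : realType) (K L : choiceType) (k : L -> L -> R[i]%C)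
    (f g : K -> L) P Q :
  kform k (basis_map f P) (basis_map g Q) = kform (fun x y => k (f x) (g y)) P Q.
Proof.
rewrite !kform_unlock lin_ext_basis_map; congr lin_ext; apply/funext => x.
by rewrite lin_ext_basis_map.
Qed.

Lemma kform_adjoint (R : realType) (K : choiceType) (k : K -> K -> R[i]%C)
    (f g : K -> K) : (forall x y, k (f x) y = k x (g y)) ->
  forall P Q, kform k (basis_map f P) Q = kform k P (basis_map g Q).
Proof.
move=> fg P Q.
have e1 := kform_basis_map k f id P Q; have e2 := kform_basis_map k id g P Q.
rewrite (basis_map_id Q (fun=> erefl)) in e1.
rewrite (basis_map_id P (fun=> erefl)) in e2.
apply: (etrans e1); apply: (etrans _ (esym e2)); congr (kform _ P Q).
by apply/funext => x; apply/funext => y; exact: fg.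
Qed.

(** This gives L^2 (x) L^2 as the form of the product kernel on pairs. *)
Lemma tensor_psd (R : realType) (V W : lmodType R[i]%C) (D : set V) B
    (E : set W) G (K : choiceType) (f : K -> V) (g : K -> W) :
  psd D B -> psd E G -> (forall x, D (f x)) -> (forall x, E (g x)) ->
  psd setT (kform (fun x y => B (f x) (f y) * G (g x) (g y))).
Proof.
move=> BP GP Df Eg; apply: kform_psd => P; rewrite kformE.
have [->|[x0 _]] : msupp P = fset0 \/ exists x, x \in msupp P.
- by have [->|] := fset_0Vmem (msupp P); [left | case=> x xP; right; exists x].
- by rewrite big_seq_fset0.
rewrite (big_nth x0) big_mkord.
under eq_bigr => i _ do rewrite (big_nth x0) big_mkord.
pose v i := mcoeff (nth x0 (msupp P) i) P *: f (nth x0 (msupp P) i).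
have Dv i : D (v i) by exact: (psdZ BP).
have := schur_product BP GP (size (msupp P)) Dv (fun i => Eg (nth x0 (msupp P) i)).
rewrite (eq_bigr (fun i : 'I__ => \sum_(j < size (msupp P))
  mcoeff (nth x0 (msupp P) i) P * (mcoeff (nth x0 (msupp P) j) P)^* *
  (B (f (nth x0 (msupp P) i)) (f (nth x0 (msupp P) j)) *
   G (g (nth x0 (msupp P) i)) (g (nth x0 (msupp P) j)))))//.
move=> i _; apply: eq_bigr => j _; rewrite /v (psdZl BP) ?(psdZr BP)//.
  by rewrite !mulrA.
exact: (psdZ BP).
Qed.

(** * Moments and difference quotients in one variable *)

Section PolyFunctionals.
Variable A : comNzRingType.
Implicit Types (a : nat -> A) (p q : {poly A}).

(** Integration of [p] against a distribution with moments [a]. *)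
Definition moment a p : A := \sum_(k < size p) p`_k * a k.

Lemma momentE a p N : (size p <= N)%N -> moment a p = \sum_(k < N) p`_k * a k.
Proof.
move=> pN; rewrite /moment (big_ord_widen N (fun k => p`_k * a k) pN) big_mkcond/=.
apply: eq_bigr => k _; case: ltnP => // pk.
by rewrite nth_default// mul0r.
Qed.

Lemma moment_is_scalar a : scalar (moment a).
Proof.
move=> c p q; set N := maxn (size p) (size q).
have sN : (size (c *: p + q)%R <= N)%N.
  by rewrite (leq_trans (size_polyD _ _))// geq_max !leq_max leqnn orbT
    (leq_trans (size_scale_leq _ _)).
rewrite !(@momentE _ _ N)// ?leq_maxl ?leq_maxr// mulr_sumr -big_split/=.
by apply: eq_bigr => k _; rewrite coefD coefZ; ring.
Qed.

HB.instance Definition _ a := GRing.isLinear.Build A {poly A} A _ (moment a)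
  (moment_is_scalar a).

Lemma momentC a c : moment a c%:P = c * a 0%N.
Proof.
by rewrite (@momentE _ _ 1) ?size_polyC_leq1// big_ord1 coefC.
Qed.

Lemma momentCM a c p : moment a (c%:P * p) = c * moment a p.
Proof. by rewrite mul_polyC linearZ. Qed.

Lemma momentXn a n : moment a 'X^n = a n.
Proof.
rewrite (@momentE _ _ n.+1) ?size_polyXn// big_ord_recr/= coefXn eqxx mul1r.
rewrite big1 ?add0r// => i _; rewrite coefXn ltn_eqF ?mul0r//.
Qed.

End PolyFunctionals.

Section DifferenceQuotient.
Variable A : idomainType.
Implicit Types (a : nat -> A) (p q f : {poly A}).

(** The moments of a distribution composed with the difference quotient:
    (a (x) a) (\sum_(i < n) x^i y^(n-1-i)). *)
Definition autoconv a n : A := \sum_(i < n) a i * a (n.-1 - i)%N.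

(** [in1] uses the inner variable of {poly {poly A}}, [in2] the outer one. *)
Definition in1 f : {poly {poly A}} := f%:P.
Definition in2 f : {poly {poly A}} := map_poly polyC f.

Lemma in1X f n : in1 (f ^+ n) = in1 f ^+ n.
Proof. exact: rmorphXn. Qed.

Lemma in2X f n : in2 (f ^+ n) = in2 f ^+ n.
Proof. exact: rmorphXn. Qed.

Lemma in1M f g : in1 (f * g) = in1 f * in1 g. Proof. exact: rmorphM. Qed.
Lemma in2M f g : in2 (f * g) = in2 f * in2 g. Proof. exact: rmorphM. Qed.
Lemma in1B f g : in1 (f - g) = in1 f - in1 g. Proof. exact: rmorphB. Qed.
Lemma in2B f g : in2 (f - g) = in2 f - in2 g. Proof. exact: rmorphB. Qed.
Lemma in1_1 : in1 1 = 1. Proof. exact: rmorph1. Qed.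
Lemma in2_1 : in2 1 = 1. Proof. exact: rmorph1. Qed.
Lemma in2C c : in2 c%:P = c%:P%:P. Proof. exact: map_polyC. Qed.

Definition moment2 a (F : {poly {poly A}}) : A :=
  moment a (moment (polyC \o a) F).

Definition diffq f : {poly {poly A}} :=
  \sum_(k < size f) (f`_k)%:P%:P * \sum_(i < k) in1 'X ^+ (k.-1 - i) * in2 'X ^+ i.

Lemma moment_in2 a f : moment (polyC \o a) (in2 f) = (moment a f)%:P.
Proof.
rewrite /moment size_map_polyC rmorph_sum/=; apply: eq_bigr => k _.
by rewrite coef_map/= rmorphM.
Qed.

Lemma moment2M a f g : moment2 a (in1 f * in2 g) = moment a f * moment a g.
Proof.
rewrite /moment2 /in1 momentCM moment_in2 mulrC momentCM.
by rewrite mulrC.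
Qed.

Lemma moment2C a c F : moment2 a (c%:P%:P * F) = c * moment2 a F.
Proof. by rewrite /moment2 !momentCM. Qed.

Lemma moment2_sum a I (r : seq I) (F : I -> {poly {poly A}}) :
  moment2 a (\sum_(i <- r) F i) = \sum_(i <- r) moment2 a (F i).
Proof.
by rewrite /moment2 (raddf_sum (moment (polyC \o a))) (raddf_sum (moment a)).
Qed.

Lemma moment_autoconv a f : moment (autoconv a) f = moment2 a (diffq f).
Proof.
rewrite /diffq moment2_sum; apply: eq_bigr => k _.
rewrite moment2C moment2_sum; congr (_ * _); rewrite (reindex_inj rev_ord_inj)/=.
apply: eq_bigr => i _.
rewrite -in1X -in2X moment2M !momentXn; congr (a _ * a _);
  by case: k i => k /= kf [i /= ik]; lia.
Qed.

Lemma diffqP f : (in1 'X - in2 'X) * diffq f = in1 f - in2 f.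
Proof.
have ef : f = \sum_(k < size f) f`_k *: 'X^k by rewrite -poly_def coefK.
have -> : in1 f = \sum_(k < size f) (f`_k)%:P%:P * in1 'X ^+ k.
  rewrite {1}ef /in1 rmorph_sum/=; apply: eq_bigr => k _.
  by rewrite -mul_polyC rmorphM rmorphXn.
have -> : in2 f = \sum_(k < size f) (f`_k)%:P%:P * in2 'X ^+ k.
  rewrite {1}ef /in2 rmorph_sum/=; apply: eq_bigr => k _.
  by rewrite -mul_polyC rmorphM rmorphXn/= map_polyC.
rewrite /diffq mulr_sumr -sumrB; apply: eq_bigr => k _.
by rewrite -mulrBr mulrCA; congr (_ * _); rewrite subrXX.
Qed.

Lemma diffq_unique f F : (in1 'X - in2 'X) * F = in1 f - in2 f -> diffq f = F.
Proof.
rewrite -[RHS]diffqP => e; apply/esym; move: e; apply: mulfI.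
rewrite /in1 /in2 map_polyX -opprB oppr_eq0.
by rewrite -size_poly_eq0 size_XsubC.
Qed.

Section BumpFamily.
Variables (z kap : A) (a : nat -> A).
Hypothesis a0 : a 0%N = 1.
Let D : {poly A} := 'X - z%:P.
Let S : {poly A} := 1 - kap%:P * D ^+ 2.
Let s n : A := moment a (S ^+ n).
Let d n : A := moment a (D * S ^+ n).

(** The Leibniz rule, where the difference quotient of S = 1 - kap D^2 is
    - kap (D (x) 1 + 1 (x) D). *)
Lemma diffq_bump n : diffq (D * S ^+ n) = in1 (S ^+ n) -
  kap%:P%:P * \sum_(j < n) (in1 D + in2 D) * in2 D * (in1 S ^+ (n.-1 - j) * in2 S ^+ j).
Proof.
apply: diffq_unique.
have e1 : in1 (D * S ^+ n) = in1 D * in1 S ^+ n by rewrite in1M in1X.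
have e2 : in2 (D * S ^+ n) = in2 D * in2 S ^+ n by rewrite in2M in2X.
have e3 : in1 'X - in2 'X = in1 D - in2 D.
  by rewrite /D in1B in2B in2C /in1; ring.
have e4 : in1 S - in2 S = - kap%:P%:P * ((in1 D - in2 D) * (in1 D + in2 D)).
  by rewrite /S in1B in2B in1M in2M in1X in2X in2C in1_1 in2_1 {1}/in1; ring.
rewrite e1 e2 e3 [in1 (S ^+ n)](_ : _ = in1 S ^+ n); last exact: in1X.
rewrite -mulr_sumr.
have := subrXX (in1 S) (in2 S) n; rewrite e4.
set Sg := \sum_(i < n) _; set P1 := in1 S ^+ n; set P2 := in2 S ^+ n => h.
have -> : P2 = P1 - (P1 - P2) by ring.
by rewrite h; ring.
Qed.

(** In [diffq_bump], the part D (x) D of (D (x) 1 + 1 (x) D) (1 (x) D) gives the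
    last sum. Thanks to kap D^2 S^p = S^p - S^(p+1), the part 1 (x) D^2 and the
    first term combine into a difference of consecutive convolution sums, which
    will be telescoped. *)
Lemma moment_autoconv_bump n : moment (autoconv a) (D * S ^+ n.+1) =
  \sum_(j < n.+2) s j * s (n.+1 - j)%N - \sum_(j < n.+1) s j * s (n - j)%N
  - kap * \sum_(j < n.+1) d j * d (n - j)%N.
Proof.
have s0 : moment a 1 = 1 by rewrite -[1]/(1%:P) momentC a0 mul1r.
have dS (p : nat) : kap * moment a (D ^+ 2 * S ^+ p) = s p - s p.+1.
  rewrite -momentCM /s -raddfB/=; congr moment.
  by rewrite [S ^+ p.+1]exprS; move: (S ^+ p) => T; rewrite /S; ring.
rewrite moment_autoconv diffq_bump /moment2 !(raddfB, raddfN)/= -/(moment2 a _).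
rewrite -/(moment2 a (_%:P%:P * _)) moment2C moment2_sum.
rewrite -[in1 _]mulr1 -in2_1 moment2M s0 mulr1.
rewrite (eq_bigr (fun j : 'I_n.+1 => d (n - j)%N * d j +
    s (n - j)%N * moment a (D ^+ 2 * S ^+ j))); last first.
  move=> j _; rewrite -in1X -in2X.
  have -> : (in1 D + in2 D) * in2 D * (in1 (S ^+ (n - j)) * in2 (S ^+ j)) =
    in1 (D * S ^+ (n - j)) * in2 (D * S ^+ j) +
    in1 (S ^+ (n - j)) * in2 (D ^+ 2 * S ^+ j).
    by rewrite !in1M !in2M in2X; ring.
  by rewrite /moment2 !raddfD/= -!/(moment2 a _) !moment2M.
rewrite big_split/= mulrDr opprD addrA addrAC.
congr (_ + - (kap * _)); last by apply: eq_bigr => j _; rewrite mulrC.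
rewrite [in RHS]big_ord_recl/= /s s0 mul1r subn0 -!/(s _) -addrA; congr (_ + _).
rewrite mulr_sumr -sumrN -sumrB; apply: eq_bigr => j _.
rewrite mulrCA dS /bump/= add1n subSS; ring.
Qed.

End BumpFamily.
End DifferenceQuotient.

Section TwoVariables.
Variable A : comNzRingType.

Lemma moment_moment (a b : nat -> A) (f : {poly {poly A}}) N :
  (size f <= N)%N -> (sizeY f <= N)%N ->
  moment b (moment (polyC \o a) f) =
  \sum_(i < N) \sum_(j < N) f`_i`_j * a i * b j.
Proof.
move=> sf sY; rewrite (momentE (polyC \o a) sf) raddf_sum/=.
apply: eq_bigr => i _; rewrite mulrC momentCM (@momentE _ _ _ N).
  by rewrite mulr_sumr; apply: eq_bigr => j _; ring.
exact: leq_trans (max_size_coefXY _ _) sY.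
Qed.

Lemma moment_swap (a b : nat -> A) (f : {poly {poly A}}) :
  moment b (moment (polyC \o a) f) = moment a (moment (polyC \o b) (swapXY f)).
Proof.
set N := maxn (size f) (sizeY f).
rewrite (@moment_moment a b f N) ?leq_maxl ?leq_maxr//.
rewrite (@moment_moment b a _ N) ?sizeYE ?swapXYK -?sizeYE ?leq_maxl ?leq_maxr//.
rewrite exchange_big; apply: eq_bigr => i _; apply: eq_bigr => j _.
by rewrite coef_swapXY mulrAC.
Qed.

End TwoVariables.

Lemma midrange p q (i : 'I_q.+1) :
  (p <= (p + (q.+1 + p)).-1 - (p + i))%N.
Proof. by case: i => i /= iq; lia. Qed.

(** * A distribution with finite Fisher information is diffuse *)

Section Diffuse.
Variables (R : realType) (m : nat -> R) (kap K : R).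
Let mm (f : {poly {poly R}}) : R := moment m (moment (polyC \o m) f).
Let D : {poly {poly R}} := 'X - ('X)%:P.
Hypotheses (m0 : m 0%N = 1) (kap0 : 0 < kap) (K0 : 0 <= K).
Hypothesis mm_ge0 : forall f, 0 <= mm (f * f).
Hypothesis mm_bound : forall f, kap * mm (D ^+ 2 * (f * f)) <= mm (f * f).
Hypothesis fisher : forall p : {poly R},
  `|moment (autoconv m) p| <= K * Num.sqrt (moment m (p * p)).

Let L := moment (polyC \o m).
Let S : {poly {poly R}} := 1 - kap%:P%:P * D ^+ 2.
Let a n := mm (S ^+ n).
Let beta n := Num.sqrt (mm ((D * S ^+ n) * (D * S ^+ n))).

Let mmD f g : mm (f + g) = mm f + mm g.
Proof. by rewrite /mm !raddfD. Qed.

Let mmB f g : mm (f - g) = mm f - mm g.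
Proof. by rewrite /mm !raddfB. Qed.

Let mmC c f : mm (c%:P%:P * f) = c * mm f.
Proof. by rewrite /mm !momentCM. Qed.

Let mom_embed p : moment m p = mm p%:P.
Proof. by rewrite /mm momentC/= m0 mulr1. Qed.

Let mom_sqr_ge0 p : 0 <= moment m (p * p).
Proof. by rewrite mom_embed rmorphM. Qed.

Let mm_CS f g : `|mm (f * g)| <= Num.sqrt (mm (f * f)) * Num.sqrt (mm (g * g)).
Proof.
rewrite -(@ler_pXn2r _ 2)// ?nnegrE ?mulr_ge0 ?sqrtr_ge0//.
rewrite exprMn !sqr_sqrtr// real_normK ?num_real//.
apply: quadratic_bound; rewrite ?sqr_ge0// => s s0.
have := mm_ge0 (f - (s * mm (f * g))%:P%:P * g).
set c := (s * _).
have -> : (f - c%:P%:P * g) * (f - c%:P%:P * g) =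
  f * f - (2 * c)%:P%:P * (f * g) + (c * c)%:P%:P * (g * g).
  by rewrite !rmorphM/=; ring.
by rewrite mmD mmB !mmC /c; lra.
Qed.

(* Integrating out the outer variable is a contraction, as a conditional
   expectation. *)
Let mom_contract f : moment m (L f * L f) <= mm (f * f).
Proof.
have := mm_ge0 (f - (L f)%:P).
have -> : (f - (L f)%:P) * (f - (L f)%:P) = f * f - (L f)%:P * f - ((L f)%:P * f - (L f * L f)%:P).
  by rewrite rmorphM/=; ring.
have e : mm ((L f)%:P * f) = moment m (L f * L f) by rewrite /mm momentCM.
by rewrite !mmB -mom_embed e; lra.
Qed.

(* The Fisher bound with a parameter: it is applied after integrating out the
   parameter, instead of pointwise, so that no positivity at points is used. *)
Let fisher2 f : `|moment m (moment (autoconv (polyC \o m)) f)| <=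
  K * Num.sqrt (mm (f * f)).
Proof.
have -> : autoconv (polyC \o m) = polyC \o autoconv m.
  apply/funext => n; rewrite /autoconv/= rmorph_sum/=.
  by apply: eq_bigr => i _; rewrite rmorphM.
rewrite moment_swap; apply: le_trans (fisher _) _; rewrite ler_wpM2l//.
apply: ler_wsqrtr; apply: le_trans (mom_contract _) _.
by rewrite -rmorphM/= /mm -moment_swap.
Qed.

Let mm_S f : mm (S * (f * f)) = mm (f * f) - kap * mm (D ^+ 2 * (f * f)).
Proof. by rewrite -mmC -mmB; congr mm; rewrite /S; ring. Qed.

Let mm_Dsq_ge0 f : 0 <= mm (D ^+ 2 * (f * f)).
Proof. by have := mm_ge0 (D * f); congr (0 <= mm _); ring. Qed.

Let mm_S_ge0 f : 0 <= mm (S * (f * f)).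
Proof. by rewrite mm_S subr_ge0. Qed.

Let a_double n : a (n + n) = mm (S ^+ n * S ^+ n).
Proof. by rewrite /a exprD. Qed.

Let a_doubleS n : a (n + n).+1 = mm (S * (S ^+ n * S ^+ n)).
Proof. by rewrite /a exprS exprD. Qed.

Let a_ge0 n : 0 <= a n.
Proof.
rewrite -(odd_double_half n) -addnn; case: (odd n).
  by rewrite add1n a_doubleS mm_S_ge0.
by rewrite add0n a_double mm_ge0.
Qed.

Let a_decr n : a n.+1 <= a n.
Proof.
rewrite -(odd_double_half n) -addnn; case: (odd n); move: n./2 => k.
  rewrite add1n a_doubleS -subr_ge0.
  have -> : a (k + k).+2 = mm (S * (S * (S ^+ k * S ^+ k))).
    by rewrite /a !exprS exprD.
  have := mulr_ge0 (ltW kap0) (mm_S_ge0 (D * S ^+ k)).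
  rewrite -mmB -mmC; congr (0 <= mm _).
  by move: (S ^+ k) => g; rewrite /S; ring.
rewrite add0n a_doubleS a_double mm_S lerBlDr lerDl mulr_ge0 ?(ltW kap0)//.
Qed.

Let a_mono n k : a (n + k)%N <= a n.
Proof.
elim: k => [|k ih]; first by rewrite addn0.
by rewrite addnS; apply: le_trans (a_decr _) ih.
Qed.

Let a0 : a 0 = 1.
Proof. by rewrite /a expr0 -[1]/(1%:P) -mom_embed momentC mul1r. Qed.

Let a_le1 n : a n <= 1. Proof. by rewrite -a0 -[n]add0n. Qed.

Let beta_sqr n : kap * beta n ^+ 2 = a (n + n) - a (n + n).+1.
Proof.
rewrite sqr_sqrtr// a_doubleS a_double mm_S opprB addrC subrK.
by congr (_ * mm _); ring.
Qed.

Let beta_ge0 n : 0 <= beta n. Proof. exact: sqrtr_ge0. Qed.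

(* The squares of the beta n are increments of the monotone sequence a. *)
Let beta_tail p q : kap * \sum_(i < q) beta (p + i) ^+ 2 <=
  a (p + p) - a (p + q + (p + q)).
Proof.
elim: q => [|q ih]; first by rewrite big_ord0 mulr0 addn0 subrr.
rewrite big_ord_recr/= mulrDr beta_sqr.
rewrite (le_trans (lerD ih (lexx _)))// addrA subrK lerD2l lerN2.
by rewrite addnS addSn addnS a_decr.
Qed.

Let s n := L (S ^+ n).
Let d n := L (D * S ^+ n).
Let t j l := moment m (s j * s l).
Let T n := \sum_(j < n.+1) t j (n - j)%N.

(* By polarization t j l is large when s j and s l are large and close. *)
Let t_polar j l : t j l = (moment m (s j * s j) + moment m (s l * s l)
  - moment m ((s j - s l) * (s j - s l))) / 2.
Proof.
have -> : (s j - s l) * (s j - s l) =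
    s j * s j + s l * s l - (s j * s l + s j * s l) by ring.
by rewrite !(raddfB, raddfD)/= /t; field.
Qed.

Let t_diff j l : moment m ((s j - s l) * (s j - s l)) <=
  a (j + j) - 2 * a (j + l) + a (l + l).
Proof.
rewrite /s -raddfB/=; apply: le_trans (mom_contract _) _.
have -> : (S ^+ j - S ^+ l) * (S ^+ j - S ^+ l) =
    S ^+ (j + j) + S ^+ (l + l) - (S ^+ (j + l) + S ^+ (j + l)).
  by rewrite !exprD; ring.
by rewrite mmB !mmD -!/(a _); lra.
Qed.

Let t_diag j : a j ^+ 2 <= moment m (s j * s j).
Proof.
have := mom_sqr_ge0 (s j - (a j)%:P).
have -> : (s j - (a j)%:P) * (s j - (a j)%:P) =
    s j * s j - (a j)%:P * s j - ((a j)%:P * s j - (a j * a j)%:P).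
  by rewrite rmorphM/=; ring.
rewrite !raddfB/= !momentCM momentC m0 mulr1.
have -> : moment m (s j) = a j by [].
by rewrite expr2; lra.
Qed.

Let t_lower j l : - 1 <= t j l.
Proof.
rewrite t_polar; have := t_diff j l.
have := mom_sqr_ge0 (s j); have := mom_sqr_ge0 (s l).
have := a_le1 (j + j); have := a_le1 (l + l); have := a_ge0 (j + l).
by lra.
Qed.

Let d_bound j l : moment m (d j * d l) <= beta j * beta l.
Proof.
apply: le_trans (ler_norm _) _; rewrite mom_embed rmorphM/=.
apply: le_trans (mm_CS _ _) _; rewrite -!rmorphM/= -!mom_embed.
by rewrite ler_pM ?sqrtr_ge0// ler_wsqrtr// mom_contract.
Qed.

(* The Fisher bound for D S^(n+1), where [moment_autoconv_bump] is used with
   the inner variable as the point z. *)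
Let T_step n : T n.+1 - T n <= K * beta n.+1 +
  kap * \sum_(j < n.+1) beta j * beta (n - j)%N.
Proof.
have a1 : (polyC \o m) 0%N = 1 by rewrite /= m0.
have e : moment m (moment (autoconv (polyC \o m)) (D * S ^+ n.+1)) =
    T n.+1 - T n - kap * \sum_(j < n.+1) moment m (d j * d (n - j)%N).
  transitivity (moment m (\sum_(j < n.+2) s j * s (n.+1 - j)%N
    - \sum_(j < n.+1) s j * s (n - j)%N
    - kap%:P * \sum_(j < n.+1) d j * d (n - j)%N)).
    by congr moment; exact: (moment_autoconv_bump 'X kap%:P a1 n).
  have ms N (F : 'I_N -> {poly R}) :
      moment m (\sum_(j < N) F j) = \sum_(j < N) moment m (F j).
    exact: (raddf_sum (moment m)).
  by rewrite !raddfB/= momentCM !ms.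
have := fisher2 (D * S ^+ n.+1).
rewrite e -/(beta _) => /(le_trans (ler_norm _)).
have : \sum_(j < n.+1) moment m (d j * d (n - j)%N) <=
       \sum_(j < n.+1) beta j * beta (n - j)%N.
  by apply: ler_sum => j _.
by rewrite -(ler_pM2l kap0); lra.
Qed.

Let sigma n := \sum_(j < n) beta j.

(* Telescoping, and then Cauchy products are bounded by squares of sums. *)
Let T_upper n : T n <= 1 + K * sigma n.+1 + kap * sigma n ^+ 2.
Proof.
suff h k : T k <= 1 + K * (sigma k.+1 - beta 0%N) + kap *
    \sum_(i < k) \sum_(j < i.+1) beta j * beta (i - j)%N.
  apply: le_trans (h n) _; rewrite -2!addrA lerD2l lerD//.
    by rewrite ler_wpM2l// gerBl beta_ge0.
  rewrite ler_wpM2l ?(ltW kap0)// expr2 /sigma mulr_suml.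
  rewrite (eq_bigr (fun i : 'I_n =>
      \sum_(j < n | (j <= i)%N) beta j * beta (i - j)%N)); last first.
    move=> i _.
    exact: (big_ord_widen _ (fun j => beta j * beta (i - j)%N) (ltn_ord i)).
  rewrite (exchange_big_dep predT)//=; apply: ler_sum => j _.
  rewrite -mulr_sumr ler_wpM2l ?beta_ge0//.
  have -> : \sum_(i < n | (j <= i)%N) beta (i - j)%N = sigma (n - j)%N.
    transitivity (\sum_(j <= i < n) beta (i - j)%N).
      by rewrite big_geq_mkord; apply: eq_bigl => i.
    rewrite -{1}[j : nat]add0n big_addn big_mkord.
    by apply: eq_bigr => i _; rewrite addnK.
  have jn : (j <= n)%N by exact: ltnW.
  rewrite -[in leRHS](subnK jn) big_split_ord/= lerDl.
  by apply: sumr_ge0.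
elim: k => [|k ih].
  rewrite big_ord0 mulr0 addr0 /sigma !big_ord_recl !big_ord0 addr0 subrr mulr0 addr0.
  have s0 : s 0%N = 1.
    by rewrite /s expr0 -[1 in LHS]/(1%:P%:P) /L momentC /= m0 mulr1.
  rewrite /T big_ord_recl big_ord0 addr0 /t s0 mulr1 -[1 in leLHS]/(1%:P).
  by rewrite momentC m0 mulr1.
rewrite -[T _](subrK (T k)) (le_trans (lerD (T_step k) ih))//.
rewrite [in leRHS]big_ord_recr/= /sigma [in leRHS]big_ord_recr/= mulrDr.
by lra.
Qed.

Lemma sqr_sum_le (x : nat -> R) n :
  (\sum_(i < n) x i) ^+ 2 <= n%:R * \sum_(i < n) x i ^+ 2.
Proof.
elim: n => [|n ih]; first by rewrite !big_ord0 expr2 mul0r.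
rewrite !big_ord_recr/=; move: ih.
set u := \sum_(i < n) x i; set q := \sum_(i < n) x i ^+ 2; set y := x n => ih.
have [n0|n0] := posnP n.
  have u0 : u = 0 by rewrite /u n0 big_ord0.
  by rewrite /q u0 n0 big_ord0 !add0r mul1r.
have nR : 0 < n%:R :> R by rewrite ltr0n.
have : 2 * u * y * n%:R <= n%:R * (q + n%:R * y ^+ 2).
  by have := sqr_ge0 (u - n%:R * y); nra.
rewrite -natr1 [n%:R * (_ + _)]mulrC ler_pM2r//.
by lra.
Qed.

Let sigma_bound p q :
  sigma (p + q) ^+ 2 <= 2 * sigma p ^+ 2 +
   2 * q%:R * ((a (p + p) - a (p + q + (p + q))) / kap).
Proof.
rewrite /sigma big_split_ord/= -/(sigma p).
set v := \sum_(i < q) _; have hv : v ^+ 2 <= q%:R *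
    ((a (p + p) - a (p + q + (p + q))) / kap).
  apply: le_trans (sqr_sum_le (fun i => beta (p + i)%N) q) _.
  by rewrite ler_wpM2l// ler_pdivlMr// mulrC beta_tail.
by have := sqr_ge0 (sigma p - v); lra.
Qed.

(** If [a n], the integral of S^n for mu (x) mu, stayed above [al] > 0, then
    nearly all the terms of [T n] would be at least [al ^+ 2 / 2], so that [T n]
    would grow linearly. But [T_upper] bounds it in terms of sigma^2, which is o(n) since
    the sequence beta is square summable. *)
Lemma bump_vanishes e : 0 < e -> exists n, a n <= e.
Proof.
move=> e0; apply: contrapT => /forallNP ae.
have {}ae n : e < a n by rewrite ltNge; apply/negP/ae.
pose al := inf (range a).
have ia : has_inf (range a) by split; [exists (a 0%N), 0%N | exists 0 => _ [n _ <-]].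
have al_le n : al <= a n by apply: ge_inf; [exact: ia.2 | exists n].
have al0 : 0 < al.
  apply: lt_le_trans e0 _; apply: lb_le_inf; first exact: ia.1.
  by move=> _ [n _ <-]; exact: ltW.
pose c := (K + kap) * 2 / kap.
have c0 : 0 < c by rewrite /c divr_gt0 ?mulr_gt0 ?(ltr_wpDl K0 kap0).
pose del := Num.min (al ^+ 2 / 2) (al ^+ 2 / (4 * c)).
have del0 : 0 < del.
  have al2 : 0 < al ^+ 2 by exact: exprn_gt0.
  have c4 : 0 < 4 * c by rewrite pmulr_rgt0.
  by rewrite lt_min; apply/andP; split; rewrite divr_gt0.
have [_ [p _ <-]] := inf_adherent del0 ia; rewrite -/al => ap.
have app : a (p + p) - al <= del by have := a_mono p p; lra.
have d1 : del <= al ^+ 2 / 2 by rewrite ge_min lexx.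
have d2 : c * del <= al ^+ 2 / 4.
  have : del <= al ^+ 2 / (4 * c) by rewrite ge_min lexx orbT.
  have c4 : 0 < 4 * c by rewrite pmulr_rgt0.
  by rewrite ler_pdivlMr; lra.
pose M : R := 1 + K + (K + kap) * (2 * sigma p ^+ 2) + c * (p.+1)%:R * del + 2 * p%:R.
have key q : q%:R * (al ^+ 2 / 4) <= M.
  (* Of the n + 1 terms of T n, the first p and the last p are only bounded
     below by -1, see e1 and e2. *)
  pose n := (p + (q.+1 + p)).-1.
  have nE : n.+1 = (p + (q.+1 + p))%N by rewrite /n addSn addnS.
  have up := T_upper n.
  have sn : sigma n ^+ 2 <= sigma n.+1 ^+ 2.
    rewrite ler_pXn2r ?nnegrE ?sumr_ge0//.
    by rewrite /sigma big_ord_recr lerDl.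
  have sb := sigma_bound p (q.+1 + p); rewrite -nE in sb.
  have s1 : K * sigma n.+1 <= K * (1 + sigma n.+1 ^+ 2).
    by rewrite ler_wpM2l//; have := sqr_ge0 (sigma n.+1 - 1); nra.
  have low : (q.+1)%:R * (al ^+ 2 / 2) - 2 * p%:R <= T n.
    have tl j l : (p <= j)%N -> (p <= l)%N -> al ^+ 2 / 2 <= t j l.
      move=> pj pl; rewrite t_polar; have := t_diff j l.
      have sq i : al ^+ 2 <= moment m (s i * s i).
        apply: le_trans (t_diag i).
        by rewrite ler_pXn2r ?nnegrE ?(ltW al0) ?a_ge0.
      have := sq j; have := sq l; have := al_le (j + l)%N.
      have mo i : (p <= i)%N -> a (i + i) <= a (p + p).
        by move=> /subnKC <-; rewrite addnACA a_mono.
      have := mo _ pj; have := mo _ pl; lra.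
    rewrite /T nE !big_split_ord/=.
    have e1 : - (p%:R : R) <= \sum_(i < p) t i (n - i)%N.
      rewrite -mulN1r mulr_natr -[p in leLHS]card_ord -sumr_const.
      by apply: ler_sum => i _; exact: t_lower.
    have e2 : - (p%:R : R) <=
        \sum_(i < p) t (p + (q.+1 + i))%N (n - (p + (q.+1 + i)))%N.
      rewrite -mulN1r mulr_natr -[p in leLHS]card_ord -sumr_const.
      by apply: ler_sum => i _; exact: t_lower.
    have e3 : q.+1%:R * (al ^+ 2 / 2) <=
        \sum_(i < q.+1) t (p + i)%N (n - (p + i))%N.
      rewrite mulrC mulr_natr -[q.+1 in leLHS]card_ord -sumr_const.
      apply: ler_sum => i _; apply: tl; first exact: leq_addr.
      exact: midrange.
    by lra.
  have tail : (a (p + p) - a (n.+1 + n.+1)) / kap <= del / kap.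
    by rewrite ler_pM2r ?invr_gt0//; have := al_le (n.+1 + n.+1)%N; lra.
  set X := sigma n.+1 ^+ 2 in sn sb s1.
  have Xb : (K + kap) * X <= (K + kap) * (2 * sigma p ^+ 2) +
      (q.+1 + p)%:R * (c * del).
    have -> : (K + kap) * (2 * sigma p ^+ 2) + (q.+1 + p)%:R * (c * del) =
        (K + kap) * (2 * sigma p ^+ 2 + 2 * (q.+1 + p)%:R * (del / kap)).
      by rewrite /c; field; rewrite gt_eqF.
    rewrite ler_wpM2l ?addr_ge0 ?(ltW kap0)//; apply: le_trans sb _.
    by rewrite lerD2l ler_wpM2l ?mulr_ge0.
  have qd : q%:R * (c * del) <= q%:R * (al ^+ 2 / 4) by rewrite ler_wpM2l.
  have kX : kap * sigma n ^+ 2 <= kap * X by rewrite ler_pM2l.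
  have eq1 : (q.+1 + p)%:R = q%:R + p.+1%:R :> R by rewrite -natrD addSnnS.
  rewrite eq1 in Xb; rewrite -natr1 in low.
  have al2 : 0 <= al ^+ 2 by exact: sqr_ge0.
  have low' : q%:R * (al ^+ 2 / 4) + q%:R * (al ^+ 2 / 4) - 2 * p%:R <= T n.
    by lra.
  by rewrite /M; lra.
have q2 : 0 < al ^+ 2 / 4 by rewrite divr_gt0 ?exprn_gt0.
have := archi_boundP (normr_ge0 (M / (al ^+ 2 / 4))).
move=> /(le_lt_trans (ler_norm _)); rewrite ltr_pdivrMr//.
by have := key (Num.bound `|M / (al ^+ 2 / 4)|); lra.
Qed.

(** The geometric series: 1 - S^n is a multiple of 1 - S, hence of D = x - y. *)
Lemma diffuse_ideal_dense e : 0 < e ->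
  exists h : {poly {poly R}}, mm ((1 - D * h) * (1 - D * h)) <= e.
Proof.
move=> e0; have [n an] := bump_vanishes e0.
exists (kap%:P%:P * D * \sum_(i < n) S ^+ i).
have -> : 1 - D * (kap%:P%:P * D * \sum_(i < n) S ^+ i) = S ^+ n.
  have := subrX1 S n; set Sg := \sum_(i < n) _ => h.
  have -> : S ^+ n = 1 + (S ^+ n - 1) by ring.
  by rewrite h /S; ring.
by rewrite -a_double; apply: le_trans (a_mono n n) an.
Qed.

End Diffuse.

(** * Weak approximation of a central functional *)

Lemma psd_add (R : realType) (V : lmodType R[i]%C) (D : set V) B B' :
  psd D B -> psd D B' -> psd D (fun x y => B x y + B' x y).
Proof.
move=> P P'; split=> [|||x y Dx Dy|x Dx].
- exact: psd_0 P.
- exact: psd_closed P.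
- move=> a x y z Dx Dy Dz; rewrite (psd_linl P)// (psd_linl P')//.
  by rewrite mulrDr addrACA.
- by rewrite (psd_herm P)// (psd_herm P')// rmorphD.
- by rewrite addr_ge0 ?(psd_ge0 P) ?(psd_ge0 P').
Qed.

Lemma sqr_le_mono (R : realType) (x y : R) : 0 <= x -> x <= y -> x ^+ 2 <= y ^+ 2.
Proof. by move=> x0 xy; rewrite ler_pXn2r ?nnegrE// (le_trans x0). Qed.

Lemma sqr_le_inv (R : realType) (x y : R) : 0 <= y -> x ^+ 2 <= y ^+ 2 -> x <= y.
Proof.
move=> y0 xy; have [x0|/ltW x0] := leP 0 x; last exact: le_trans y0.
by rewrite -(@ler_pXn2r _ 2)// nnegrE.
Qed.

Lemma sqr_le_mul (R : realType) (k x y : R) :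
  0 <= x -> x <= k * y -> x ^+ 2 <= k ^+ 2 * y ^+ 2.
Proof. by move=> x0 xy; rewrite -exprMn sqr_le_mono. Qed.

(** [V] and [W] stand for the polynomials and their tensor square, [d] for a
    difference quotient, [a0], [a1] for the commutators with two variables of
    which [d] sees the first only, and [b1] for the commutator with the second
    one on the tensor square. *)
Section CentralApproximation.
Variables (R : realType) (V W : lmodType R[i]%C).
Local Notation C := R[i]%C.
Variables (B0 : V -> V -> C) (B1 : W -> W -> C) (d : V -> W).
Variables (a0 a1 : V -> V) (b1 : W -> W) (l : V -> C) (k M : R).
Local Notation nrm0 := (nrm B0).
Local Notation nrm1 := (nrm B1).
Hypotheses (B0P : psd setT B0) (B1P : psd setT B1) (d_lin : linear d)
  (k_ge0 : 0 <= k)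
  (a0_sym : forall x y, B0 (a0 x) y = B0 x (a0 y))
  (a1_sym : forall x y, B0 (a1 x) y = B0 x (a1 y))
  (b1_sym : forall x y, B1 (b1 x) y = B1 x (b1 y))
  (a0_bound : forall x, nrm0 (a0 x) <= k * nrm0 x)
  (a1_bound : forall x, nrm0 (a1 x) <= k * nrm0 x)
  (b1_bound : forall x, nrm1 (b1 x) <= k * nrm1 x)
  (d_a1 : forall x, d (a1 x) = b1 (d x))
  (b1_dense : forall Q e, 0 < e -> exists h, nrm1 (Q - b1 h) <= e)
  (M0 : 0 <= M) (l_lin : linear (l : V -> C^o))
  (l_bound : forall x, cabs (l x) <= M * nrm0 x)
  (l_a0 : forall x, l (a0 x) = 0) (l_a1 : forall x, l (a1 x) = 0).

(* The graph form of [d]. *)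
Let BG (P Q : V) : C := B0 P Q + B1 (d P) (d Q).

Let BGP : psd setT BG.
Proof.
exact: (psd_add B0P (psd_pullback d_lin B1P (fun=> I))).
Qed.

Local Notation nrmG := (nrm BG).

Let sqr_nrmG P : nrmG P ^+ 2 = nrm0 P ^+ 2 + nrm1 (d P) ^+ 2.
Proof.
by rewrite (sqr_nrm BGP I) /BG ReD -(sqr_nrm B0P I) -(sqr_nrm B1P I).
Qed.

Let nrm0_le P : nrm0 P <= nrmG P.
Proof. by apply: sqr_le_inv (nrm_ge0 _ _) _; rewrite sqr_nrmG lerDl sqr_ge0. Qed.

Let nrm1_le P : nrm1 (d P) <= nrmG P.
Proof. by apply: sqr_le_inv (nrm_ge0 _ _) _; rewrite sqr_nrmG lerDr sqr_ge0. Qed.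

Let ad1_boundG P : nrmG (a1 P) <= k * nrmG P.
Proof.
apply: sqr_le_inv; first by rewrite mulr_ge0 ?nrm_ge0.
rewrite (sqr_nrmG (a1 P)) d_a1 exprMn (sqr_nrmG P) mulrDr; apply: lerD.
  exact: sqr_le_mul (nrm_ge0 _ _) (a1_bound P).
exact: sqr_le_mul (nrm_ge0 _ _) (b1_bound (d P)).
Qed.

Definition represents e (p : V) :=
  forall q, cabs (l q - BG q p) <= e * nrmG q.

Let represents_exists e : 0 < e -> exists p, represents e p.
Proof.
move=> e0.
have lG x : setT x -> cabs (l x) <= M * nrmG x.
  move=> _; exact: le_trans (l_bound x) (ler_wpM2l M0 (nrm0_le x)).
have [p [_ hp]] := near_riesz BGP M0 (fun a x y _ _ => l_lin a x y) lG e0.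
by exists p => q; exact: hp.
Qed.

Let represents_norm e p : 0 <= e -> e <= 1 -> represents e p -> nrmG p <= M + 1.
Proof.
move=> e0 e1 hp; have M1 : 0 <= M + 1 := addr_ge0 M0 ler01.
apply: (nrm_le_eps BGP) I M1 => q _; have -> : BG q p = l q - (l q - BG q p) by rewrite opprB addrC subrK.
apply: le_trans (cabsD _ _) _; rewrite cabsN mulrDl; apply: lerD.
  exact: le_trans (l_bound q) (ler_wpM2l M0 (nrm0_le q)).
exact: le_trans (hp q) (ler_wpM2r (nrm_ge0 _ _) e1).
Qed.

(** [F p] tends to 0 along the elements [p] that represent [l] up to e --> 0. *)
Definition vanishing (F : V -> R) := forall eta, 0 < eta ->
  exists2 del, 0 < del & forall e p, 0 < e -> e <= del -> represents e p -> F p <= eta.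

Let van_le F G K : 0 <= K -> (forall p, F p <= K * G p) -> vanishing G -> vanishing F.
Proof.
move=> K0' FG vG eta eta0; have K1 : 0 < K + 1 by rewrite ltr_wpDl.
have [del del0 h] := vG (eta / (K + 1)) (divr_gt0 eta0 K1).
exists del => // e p e0 ed hp; apply: le_trans (FG p) _.
have := h e p e0 ed hp; rewrite ler_pdivlMr// => h'.
have [Gp|Gp] := leP 0 (G p); first by nra.
by apply: le_trans (ltW eta0); rewrite mulr_ge0_le0// ltW.
Qed.

Let van_add F G : vanishing F -> vanishing G -> vanishing (fun p => F p + G p).
Proof.
move=> vF vG eta eta0; have e2 : 0 < eta / 2 by rewrite divr_gt0.
have [d1 d10 h1] := vF _ e2; have [d2 d20 h2] := vG _ e2.
exists (Num.min d1 d2); first by rewrite lt_min d10.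
move=> e p e0; rewrite le_min => /andP[ed1 ed2] hp; rewrite [eta]splitr.
by rewrite lerD ?(h1 e)// (h2 e).
Qed.

Let van_linear F K : 0 <= K ->
  (forall e p, 0 < e -> e <= 1 -> represents e p -> F p <= K * e) -> vanishing F.
Proof.
move=> K0' h eta eta0; have K1 : 0 < K + 1 by rewrite ltr_wpDl.
exists (Num.min 1 (eta / (K + 1))); first by rewrite lt_min ltr01 divr_gt0.
move=> e p e0; rewrite le_min => /andP[e1]; rewrite ler_pdivlMr// => ee hp.
by apply: le_trans (h e p e0 e1 hp) _; nra.
Qed.

Let van_sqr F : vanishing (fun p => F p ^+ 2) -> vanishing F.
Proof.
move=> vF eta eta0; have [del del0 h] := vF _ (exprn_gt0 2 eta0).
exists del => // e p e0 ed hp; apply: sqr_le_inv; first exact: ltW.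
exact: h ed hp.
Qed.

(* Test against a1 (a1 p), on which l vanishes. *)
Let ad1_energy e p : 0 < e -> e <= 1 -> represents e p ->
  nrm0 (a1 p) ^+ 2 + nrm1 (b1 (d p)) ^+ 2 <= (k ^+ 2 * (M + 1)) * e.
Proof.
move=> e0 e1 hp; have := hp (a1 (a1 p)).
have -> : BG (a1 (a1 p)) p = BG (a1 p) (a1 p).
  by rewrite /BG !d_a1 a1_sym b1_sym.
rewrite l_a1 sub0r cabsN (psdE BGP I) cabs_real (ger0_norm (sqr_ge0 _)).
rewrite sqr_nrmG d_a1 => /le_trans; apply.
rewrite mulrC; apply: (ler_wpM2r (ltW e0)); rewrite expr2 -mulrA.
apply: le_trans (ad1_boundG _) _; apply: (ler_wpM2l k_ge0).
apply: le_trans (ad1_boundG _) _; apply: (ler_wpM2l k_ge0).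
exact: represents_norm (ltW e0) e1 hp.
Qed.

Let van_ad2 : vanishing (fun p => nrm1 (b1 (d p))).
Proof.
apply: van_sqr; apply: van_linear (_ : 0 <= k ^+ 2 * (M + 1)) _.
  exact: mulr_ge0 (sqr_ge0 _) (addr_ge0 M0 ler01).
move=> e p e0 e1 hp; apply: le_trans (ad1_energy e0 e1 hp).
by rewrite lerDr sqr_ge0.
Qed.

(* b1 is symmetric, tends to 0 on d p, and has dense range. *)
Let van_weak Q : vanishing (fun p => cabs (B1 Q (d p))).
Proof.
move=> eta eta0; have M1 : 0 < M + 1 by rewrite ltr_wpDl.
have e2 : 0 < eta / 2 by rewrite divr_gt0.
have [h hh] := b1_dense Q (divr_gt0 e2 M1).
have vh : vanishing (fun p => nrm1 h * nrm1 (b1 (d p))).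
  exact: van_le (nrm_ge0 _ _) (fun p => lexx _) van_ad2.
have [del del0 hd] := vh _ e2; exists (Num.min 1 del).
  by rewrite lt_min ltr01.
move=> e p e0; rewrite le_min => /andP[e1 ed] hp.
have -> : B1 Q (d p) = B1 (Q - b1 h) (d p) + B1 h (b1 (d p)).
  by rewrite (psdBl B1P I I I) b1_sym subrK.
apply: le_trans (cabsD _ _) _; rewrite [eta]splitr; apply: lerD.
  apply: le_trans (cauchy_schwarz B1P I I) _.
  rewrite -[leRHS](divfK (lt0r_neq0 M1)).
  apply: (ler_pM (nrm_ge0 _ _) (nrm_ge0 _ _) hh).
  exact: le_trans (nrm1_le p) (represents_norm (ltW e0) e1 hp).
apply: le_trans (cauchy_schwarz B1P I I) _; exact: hd e0 ed hp.
Qed.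

Let van_rep q : vanishing (fun p => cabs (l q - B0 q p)).
Proof.
have v1 : vanishing (fun p => cabs (l q - BG q p)).
  apply: van_linear (nrm_ge0 BG q) _ => e p _ _ hp.
  by rewrite mulrC; exact: hp.
apply: van_le ler01 _ (van_add v1 (van_weak (d q))) => p; rewrite mul1r.
have -> : l q - B0 q p = (l q - BG q p) + B1 (d q) (d p).
  by rewrite /BG opprD addrA subrK.
exact: cabsD.
Qed.

(* |a0 p|^2 = <a0 (a0 p), p>, and l vanishes on q = a0 (a0 p). But q depends on
   p, while <q, p> --> l q is known for a fixed q only: hence a second, more
   precise, representing element p', which is close to p in the graph norm. *)
Let van_ad0 : vanishing (fun p => nrm0 (a0 p)).
Proof.
apply: van_sqr.
have K1 : 0 <= k ^+ 2 * (M + 1).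
  exact: mulr_ge0 (sqr_ge0 _) (addr_ge0 M0 ler01).
apply: van_linear (_ : 0 <= k ^+ 2 * (M + 1) * 2 + 1) _.
  exact: addr_ge0 (mulr_ge0 K1 (ler0n _ 2)) ler01.
move=> e p e0 e1 hp; set q := a0 (a0 p).
have [del del0 hdel] := van_rep q e0.
have e'0 : 0 < Num.min e del by rewrite lt_min e0.
have [p' hp'] := represents_exists e'0.
have := hdel _ p' e'0 _ hp'; rewrite ge_min lexx orbT => /(_ isT).
rewrite l_a0 sub0r cabsN => small.
have qn : nrm0 q <= k ^+ 2 * (M + 1).
  rewrite expr2 -mulrA; apply: le_trans (a0_bound _) _; apply: (ler_wpM2l k_ge0).
  apply: le_trans (a0_bound _) _; apply: (ler_wpM2l k_ge0).
  exact: le_trans (nrm0_le p) (represents_norm (ltW e0) e1 hp).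
have pp' : nrm0 (p - p') <= e + e.
  apply: le_trans (nrm0_le _) _.
  apply: (nrm_le_eps BGP) I (addr_ge0 (ltW e0) (ltW e0)) => y _.
  rewrite (psdBr BGP I I I).
  have -> : BG y p - BG y p' = (l y - BG y p') - (l y - BG y p).
    by rewrite opprB [RHS]addrC addrA subrK.
  apply: le_trans (cabsD _ _) _; rewrite cabsN mulrDl; apply: lerD (hp y).
  apply: le_trans (hp' y) _; apply: (ler_wpM2r (nrm_ge0 _ _)).
  by rewrite ge_min lexx.
have -> : nrm0 (a0 p) ^+ 2 = complex.Re (B0 q p).
  by rewrite (sqr_nrm B0P I) /q (a0_sym (a0 p) p).
apply: le_trans (le_trans (ler_norm _) (Re_le_cabs _)) _.
have -> : B0 q p = B0 q (p - p') + B0 q p' by rewrite (psdBr B0P I I I) subrK.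
apply: le_trans (cabsD _ _) _; rewrite mulrDl mul1r; apply: lerD small.
apply: le_trans (cauchy_schwarz B0P I I) _.
have -> : k ^+ 2 * (M + 1) * 2 * e = k ^+ 2 * (M + 1) * (e + e).
  by rewrite -mulrA mulr_natl mulr2n.
exact: ler_pM (nrm_ge0 _ _) (nrm_ge0 _ _) qn pp'.
Qed.

Lemma central_approximation q1 q2 Q eta : 0 < eta -> exists p,
  [/\ cabs (l q1 - B0 q1 p) <= eta, cabs (l q2 - B0 q2 p) <= eta,
      cabs (B1 Q (d p)) <= eta & nrm0 (a0 p) <= eta].
Proof.
move=> eta0.
have [e1 e10 h1] := van_rep q1 eta0; have [e2 e20 h2] := van_rep q2 eta0.
have [e3 e30 h3] := van_weak Q eta0; have [e4 e40 h4] := van_ad0 eta0.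
pose e := Num.min (Num.min e1 e2) (Num.min e3 e4).
have e_gt0 : 0 < e by rewrite !lt_min e10 e20 e30.
have [p hp] := represents_exists e_gt0; exists p.
split; [apply: (h1 e)|apply: (h2 e)|apply: (h3 e)|apply: (h4 e)] => //;
  by rewrite !ge_min lexx ?orbT.
Qed.

End CentralApproximation.

Lemma adherent_sum (R : realType) (W : lmodType R[i]%C) (B : W -> W -> R[i]%C)
    (b : W -> W) (T : Type) (r : seq T) (a : T -> R[i]%C) (v : T -> W) :
    psd setT B -> linear b ->
    (forall i (e : R), 0 < e -> exists h, nrm B (v i - b h) <= e) ->
  forall e : R, 0 < e -> exists h, nrm B (\sum_(i <- r) a i *: v i - b h) <= e.
Proof.
move=> BP lb hv; have b0 : b 0 = 0.
  by have := lb (-1) 0 0; rewrite scaler0 addr0 scaleN1r addNr.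
elim: r => [|i r ih] e e0.
  exists 0; rewrite big_nil b0 subr0 /nrm (psd_0l BP I) sqrtr0; exact: ltW.
have a1 : 0 < cabs (a i) + 1 by rewrite ltr_wpDl ?cabs_ge0.
have e2 : 0 < e / 2 by rewrite divr_gt0.
have [h1 hh1] := ih _ e2; have [h2 hh2] := hv i _ (divr_gt0 e2 a1).
exists (a i *: h2 + h1); rewrite big_cons lb.
have -> : a i *: v i + \sum_(j <- r) a j *: v j - (a i *: b h2 + b h1) =
  a i *: (v i - b h2) + (\sum_(j <- r) a j *: v j - b h1).
  by rewrite opprD addrACA scalerBr.
apply: le_trans (nrmD BP I I) _; rewrite [e]splitr lerD// (nrmZ BP _ I).
move: hh2; rewrite ler_pdivlMr// mulrDr mulr1 mulrC => /(le_trans _); apply.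
by rewrite lerDl nrm_ge0.
Qed.

Local Opaque lin_ext.

(** * Commutators and free difference quotients *)

Section Words.
Variable n : nat.
Local Notation word := (fmonom 'I_n).
Implicit Types u v w : word.

(** The adjoint of a word in self-adjoint variables. *)
Definition wrev w : word := FMonom (rev w).

Lemma wrevM u v : wrev (fmmul u v) = fmmul (wrev v) (wrev u).
Proof. by rewrite /wrev !fmmulE /= rev_cat. Qed.

Lemma wrevK w : wrev (wrev w) = w.
Proof. by rewrite /wrev /= revK; case: w. Qed.

Lemma wrev1 : wrev (fmone 'I_n) = fmone 'I_n.
Proof. by rewrite /wrev !fmoneE. Qed.

Lemma wrev_letter i : wrev (fmu i) = fmu i.
Proof. by rewrite /wrev !fmuE. Qed.

Lemma size_letterl i w : size (fmmul (fmu i) w) = (size w).+1.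
Proof. by rewrite fmmulE fmuE. Qed.

Lemma size_letterr i w : size (fmmul w (fmu i)) = (size w).+1.
Proof. by rewrite fmmulE fmuE /= size_cat addn1. Qed.

Lemma word_ind (P : word -> Prop) :
  P (fmone _) -> (forall i w, P w -> P (fmmul (fmu i) w)) -> forall w, P w.
Proof.
move=> P1 PM [s]; elim: s => [|i s ih]; first by rewrite -fmoneE.
by have := PM i _ ih; rewrite fmmulE fmuE.
Qed.

Lemma word_rind (P : word -> Prop) :
  P (fmone _) -> (forall i w, P w -> P (fmmul w (fmu i))) -> forall w, P w.
Proof.
move=> P1 PM [s]; elim/last_ind: s => [|s i ih]; first by rewrite -fmoneE.
by have := PM i _ ih; rewrite fmmulE fmuE /= cats1.
Qed.

End Words.

Lemma iter_scale (A : nzRingType) (V : lmodType A) (f : V -> V) :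
  (forall a x, f (a *: x) = a *: f x) ->
  forall k a x, iter k f (a *: x) = a *: iter k f x.
Proof. by move=> fZ; elim=> //= k ih a x; rewrite ih fZ. Qed.

Lemma iter_add (V : zmodType) (f : V -> V) : {morph f : x y / x + y} ->
  forall k, {morph iter k f : x y / x + y}.
Proof. by move=> fD k x y; elim: k => //= k ->; rewrite fD. Qed.

Lemma iter_fix (T : Type) (f : T -> T) x : f x = x -> forall k, iter k f x = x.
Proof. by move=> fx; elim=> //= k ->. Qed.

Lemma iter_orbit (T : Type) (f : T -> T) (s : nat -> T) :
  (forall k, f (s k) = s k.+1) -> forall k, iter k f (s 0%N) = s k.
Proof. by move=> fs; elim=> //= k ->. Qed.

Section PolyAction.
Variables (T : nzRingType) (V : zmodType) (u : T -> V) (A : V -> V).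
Hypotheses (uD : {morph u : x y / x + y}) (AD : {morph A : x y / x + y}).
Implicit Types p q : {poly T}.

(** The polynomial [p] in the operator [A], applied to the coefficients through
    [u]. Iterating it lets {poly {poly R}} act on the tensor square by the left
    and the right multiplication. *)
Definition poly_act p : V := \sum_(k < size p) iter k A (u p`_k).

Let u0 : u 0 = 0.
Proof. by apply: (addrI (u 0)); rewrite -uD !addr0. Qed.

Let A0 : A 0 = 0.
Proof. by apply: (addrI (A 0)); rewrite -AD !addr0. Qed.

Let iter0 k : iter k A 0 = 0. Proof. by elim: k => //= k ->. Qed.

Lemma poly_actE N p : (size p <= N)%N ->
  poly_act p = \sum_(k < N) iter k A (u p`_k).
Proof.
move=> pN; rewrite /poly_act (big_ord_widen N (fun k => iter k A (u p`_k)) pN).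
rewrite big_mkcond/=; apply: eq_bigr => k _; case: ltnP => // pk.
by rewrite nth_default// u0 iter0.
Qed.

Lemma poly_actD p q : poly_act (p + q) = poly_act p + poly_act q.
Proof.
rewrite (@poly_actE (maxn (size p) (size q)) (p + q)) ?size_polyD//.
rewrite (@poly_actE (maxn (size p) (size q)) p) ?leq_maxl//.
rewrite (@poly_actE (maxn (size p) (size q)) q) ?leq_maxr// -big_split/=.
apply: eq_bigr => k _; rewrite coefD uD.
by elim: (k : nat) (p`_k) (q`_k) => [|j ih] x y; rewrite ?iterS ?ih ?AD.
Qed.

Lemma poly_actC c : poly_act c%:P = u c.
Proof.
by rewrite (@poly_actE 1) ?size_polyC_leq1// big_ord1 coefC.
Qed.

Lemma poly_actMX p : poly_act (p * 'X) = A (poly_act p).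
Proof.
rewrite (@poly_actE (size p).+1); last first.
  by rewrite (leq_trans (size_polyMleq _ _))// size_polyX addn2.
rewrite big_ord_recl/= coefMX/= u0 add0r (big_morph A AD A0).
by apply: eq_bigr => k _; rewrite coefMX.
Qed.

Lemma poly_act0 : poly_act 0 = 0.
Proof. by rewrite -[0 in LHS]/(0%:P) poly_actC u0. Qed.

End PolyAction.

(* Identities isolated in abstract modules: in the concrete module of
   noncommutative polynomials, unification would unfold the sums. *)
Lemma form_combination (A : comNzRingType) (k a u v u' v' : A) :
  k * (a * u + v) - (a * u' + v') = a * (k * u - u') + (k * v - v').
Proof. by ring. Qed.

Lemma subr_congr (V : zmodType) (x x' y y' : V) :
  x = x' -> y = y' -> x - y = x' - y'.
Proof. by move=> -> ->. Qed.

Lemma linear_combination (A : nzRingType) (V : lmodType A) a (u v p q r s : V) :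
  (a *: u + v) + ((a *: p + q) - (a *: r + s)) =
  a *: (u + (p - r)) + (v + (q - s)).
Proof. by rewrite opprD [X in _ + X = _]addrACA [LHS]addrACA scalerDr scalerBr. Qed.

Lemma scalerD_addrACA (A : nzRingType) (V : lmodType A) a (u v p q : V) :
  (a *: u + v) + (a *: p + q) = a *: (u + p) + (v + q).
Proof. by rewrite addrACA scalerDr. Qed.

Lemma mul_affine (A : comNzRingType) (c a x y t : A) :
  c * ((a * x + y) * t) = a * (c * (x * t)) + c * (y * t).
Proof. by ring. Qed.

Lemma addrC_addB (V : zmodType) (x y z t : V) :
  (x + y) - (z + t) = (y - z) + (x - t).
Proof. by rewrite [x + y]addrC opprD addrACA. Qed.

Section FreeDerivation.
Variables (A : comNzRingType) (n : nat).
Local Notation word := (fmonom 'I_n).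
Local Notation ncpoly := (malg word A).
Local Notation ncpoly2 := (malg (word * word)%type A).
Local Notation "''U' w" := (mkmalgU w 1) (at level 8).
Implicit Types (P : ncpoly) (Q : ncpoly2).

Definition lmulw (u : word) : word -> word := fun v => fmmul u v.
Definition rmulw (u : word) : word -> word := fun v => fmmul v u.
Definition leg1 (f : word -> word) (p : word * word) := (f p.1, p.2).
Definition leg2 (f : word -> word) (p : word * word) := (p.1, f p.2).
Definition inl2 (w : word) := (w, fmone 'I_n).
Definition inr2 (w : word) := (fmone 'I_n, w).

(** The commutator with the variable [i]; [ad2] is its analogue for the outer
    bimodule structure of the tensor square. *)
Definition ad i P : ncpoly :=
  basis_map (lmulw (fmu i)) P - basis_map (rmulw (fmu i)) P.

Definition ad2 i Q : ncpoly2 :=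
  basis_map (leg1 (lmulw (fmu i))) Q - basis_map (leg2 (rmulw (fmu i))) Q.

Lemma basis_map_legs f g Q :
  basis_map (leg1 f) (basis_map (leg2 g) Q) =
  basis_map (leg2 g) (basis_map (leg1 f) Q).
Proof. by rewrite !basis_map_comp. Qed.

Lemma ad_linear i : linear (ad i).
Proof. by move=> a P Q; rewrite /ad !linearP/= scalerBr scalerN addrACA. Qed.

Lemma ad2_linear i : linear (ad2 i).
Proof. by move=> a P Q; rewrite /ad2 !linearP/= scalerBr scalerN addrACA. Qed.

HB.instance Definition _ i := GRing.isLinear.Build A ncpoly ncpoly _ (ad i) (ad_linear i).
HB.instance Definition _ i := GRing.isLinear.Build A ncpoly2 ncpoly2 _ (ad2 i) (ad2_linear i).

Lemma ad2_rmul_leg1 i j Q : basis_map (leg1 (rmulw (fmu j))) (ad2 i Q) =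
  ad2 i (basis_map (leg1 (rmulw (fmu j))) Q).
Proof.
rewrite /ad2 basis_mapB; apply: subr_congr; apply: basis_map_comm => p.
  by rewrite /leg1/= /lmulw /rmulw fmmulA.
by [].
Qed.

Lemma ad2_lmul_leg2 i j Q : basis_map (leg2 (lmulw (fmu j))) (ad2 i Q) =
  ad2 i (basis_map (leg2 (lmulw (fmu j))) Q).
Proof.
rewrite /ad2 basis_mapB; apply: subr_congr; apply: basis_map_comm => p.
  by [].
by rewrite /leg2/= /lmulw /rmulw fmmulA.
Qed.

Definition one2 : ncpoly2 := 'U (fmone 'I_n, fmone 'I_n).

Section Derivation.
Variable i0 : 'I_n.
Local Notation d := (free_diff i0 : ncpoly -> ncpoly2).

Lemma free_diffU w : d 'U w = word_diff A i0 w.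
Proof. exact: lin_extU. Qed.

Lemma word_diff_letter j :
  word_diff A i0 (fmu j) = if i0 == j then one2 else 0.
Proof. by rewrite -free_diffU; exact: free_diff_var. Qed.

Lemma lact_letter u Q : ncpoly2_lact ('U u : ncpoly) Q = basis_map (leg1 (lmulw u)) Q.
Proof. by rewrite lact_word basis_mapE. Qed.

Lemma ract_letter v Q : ncpoly2_ract Q ('U v : ncpoly) = basis_map (leg2 (rmulw v)) Q.
Proof. by rewrite ract_word basis_mapE. Qed.

Lemma word_diff_lmul w : word_diff A i0 (lmulw (fmu i0) w) =
  'U (inr2 w) + basis_map (leg1 (lmulw (fmu i0))) (word_diff A i0 w).
Proof.
rewrite word_diffM ract_letter lact_letter word_diff_letter eqxx.
by rewrite /one2 basis_mapU /leg2/= /rmulw fmmul1m.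
Qed.

Lemma word_diff_rmul w : word_diff A i0 (rmulw (fmu i0) w) =
  basis_map (leg2 (rmulw (fmu i0))) (word_diff A i0 w) + 'U (inl2 w).
Proof.
rewrite word_diffM ract_letter lact_letter word_diff_letter eqxx.
by rewrite /one2 basis_mapU /leg1/= /lmulw fmmulm1.
Qed.

Lemma word_diff_lmul_other j w : i0 != j -> word_diff A i0 (lmulw (fmu j) w) =
  basis_map (leg1 (lmulw (fmu j))) (word_diff A i0 w).
Proof.
move=> /negPf ij; rewrite word_diffM ract_letter lact_letter word_diff_letter ij.
rewrite linear0; exact: add0r.
Qed.

Lemma word_diff_rmul_other j w : i0 != j -> word_diff A i0 (rmulw (fmu j) w) =
  basis_map (leg2 (rmulw (fmu j))) (word_diff A i0 w).
Proof.
move=> /negPf ij; rewrite word_diffM ract_letter lact_letter word_diff_letter ij.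
rewrite linear0; exact: addr0.
Qed.

Lemma free_diff_linear : linear d.
Proof. exact: lin_ext_is_linear. Qed.

Lemma free_diffB P P' : d (P - P') = d P - d P'.
Proof.
by rewrite -[P - P']addrC -scaleN1r free_diff_linear scaleN1r addrC.
Qed.

(** The derivation kills the variable [j], hence commutes with [ad j]. *)
Lemma free_diff_ad_other j P : i0 != j -> d (ad j P) = ad2 j (d P).
Proof.
move=> ij.
apply: (@linear_ext A _ _ (fun P => d (ad j P)) (fun P => ad2 j (d P))).
- by move=> a x y; rewrite ad_linear free_diff_linear.
- by move=> a x y; rewrite free_diff_linear ad2_linear.
move=> w; rewrite /ad !basis_mapU free_diffB !free_diffU /ad2.
by rewrite word_diff_lmul_other// word_diff_rmul_other.
Qed.

(** The Leibniz rule, with d t_i = 1 (x) 1 for the variable itself. *)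
Lemma free_diff_ad P : d (ad i0 P) =
  ad2 i0 (d P) + (basis_map inr2 P - basis_map inl2 P).
Proof.
apply: (@linear_ext A _ _ (fun P => d (ad i0 P))
  (fun P => ad2 i0 (d P) + (basis_map inr2 P - basis_map inl2 P))).
- by move=> a x y; rewrite ad_linear free_diff_linear.
- move=> a x y; rewrite free_diff_linear ad2_linear.
  by rewrite (basis_map_linear inr2) (basis_map_linear inl2) linear_combination.
move=> w; rewrite /ad !basis_mapU free_diffB !free_diffU /ad2.
by rewrite word_diff_lmul word_diff_rmul addrC_addB.
Qed.

Section Pairing.
Variable phi : word -> A.

Definition pairing Q : A := lin_ext (fun p => (phi p.1 * phi p.2 : A^o)) Q.

Lemma pairing_linear : linear (pairing : _ -> A^o).
Proof. exact: lin_ext_is_linear. Qed.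

HB.instance Definition _ := GRing.isLinear.Build A ncpoly2 A^o _ pairing pairing_linear.

Lemma pairingU u v : pairing 'U (u, v) = phi u * phi v.
Proof. by rewrite /pairing lin_extU. Qed.

Lemma lact_linearl Q : linear (fun P => ncpoly2_lact P Q).
Proof. exact: lin_ext_is_linear. Qed.

(** The Leibniz rule for d (P w). *)
Lemma free_diff_rmul w P : pairing (d (basis_map (rmulw w) P)) =
  pairing (basis_map (leg2 (rmulw w)) (d P))
  + pairing (ncpoly2_lact P (word_diff A i0 w)).
Proof.
apply: (@linear_ext A _ A^o (fun P => pairing (d (basis_map (rmulw w) P)))
  (fun P => pairing (basis_map (leg2 (rmulw w)) (d P))
    + pairing (ncpoly2_lact P (word_diff A i0 w)))).
- by move=> a u v; rewrite linearP/= free_diff_linear linearP.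
- move=> a u v; rewrite free_diff_linear lact_linearl linearP !pairing_linear.
  exact: scalerD_addrACA.
by move=> u; rewrite basis_mapU !free_diffU word_diffM -ract_letter linearD.
Qed.

Lemma pairing_lact P Q : pairing (ncpoly2_lact P Q) =
  \sum_(p <- msupp Q) mcoeff p Q * (lin_ext (fun u => (phi (fmmul u p.1) : A^o)) P * phi p.2).
Proof.
apply: (@linear_ext A _ A^o (fun P => pairing (ncpoly2_lact P Q))
  (fun P => \sum_(p <- msupp Q) mcoeff p Q *
    (lin_ext (fun u => (phi (fmmul u p.1) : A^o)) P * phi p.2))).
- by move=> a u v; rewrite lact_linearl linearP.
- move=> a u v; rewrite scaler_sumr -big_split/=; apply: eq_bigr => p _.
  by rewrite lin_ext_is_linear; exact: mul_affine.
move=> u; rewrite lact_word (linear_lin_ext _ _ pairing_linear).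
rewrite (lin_extE _ (fsubset_refl _)); apply: eq_bigr => p _.
by rewrite pairingU lin_extU.
Qed.

End Pairing.
End Derivation.
End FreeDerivation.

(* The two scalar computations of [central_functional], stated for arbitrary
   numbers. *)
Lemma scalar_chain (A : zmodType) (t1 tb t2 b s u r l x y q q' : A) :
  t1 = tb + t2 -> tb = b -> b = s + u -> u = r - l -> r = x -> l = y ->
  s = q -> q = q' -> x - y = t1 - t2 - q'.
Proof.
move=> -> -> -> -> <- <- <- <-.
by rewrite addrK addrAC subrr add0r.
Qed.

Lemma central_estimate (R : realType) (a b x y x' y' f t1 t2 z : R[i]%C)
    (h K K1 K2 s s1 : R) : 0 <= K -> 0 <= K1 -> 0 <= K2 ->
  cabs (a - x') <= h -> x' = x^* -> cabs (b - y') <= h -> y' = y^* ->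
  cabs z <= h -> cabs t1 <= K * s1 -> s1 <= K1 * s -> cabs t2 <= K2 * s ->
  s <= h -> x - f * y = t1 - t2 - z^* ->
  cabs (a - b * f^*) <= h * (1 + cabs f + K * K1 + K2 + 1).
Proof.
move=> K0 K10 K20 hx ex hy ey hz ht1 hs1 ht2 hs e; rewrite ex in hx; rewrite ey in hy.
have -> : a - b * f^* = (a - x^*) + f^* * (y^* - b) + (t1 - t2 - z^*)^*.
  by rewrite -e rmorphB rmorphM/=; ring.
have := cabsD (a - x^* + f^* * (y^* - b)) (t1 - t2 - z^*)^*.
have := cabsD (a - x^*) (f^* * (y^* - b)).
rewrite cabsM !cabs_conj [cabs (y^* - b)]cabsB.
have := cabsD (t1 - t2) (- z^*); have := cabsD t1 (- t2).
rewrite !cabsN cabs_conj.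
have := cabs_ge0 f; have : K * s1 <= K * (K1 * h) by rewrite ler_wpM2l// (le_trans hs1)// ler_wpM2l.
have : K2 * s <= K2 * h by rewrite ler_wpM2l.
have : cabs f * cabs (b - y^*) <= cabs f * h by rewrite ler_wpM2l ?cabs_ge0.
by lra.
Qed.

(** * Central functionals of a law with finite Fisher information *)

Section FisherLaw.
Variables (R : realType) (n : nat).
Local Notation C := R[i]%C.
Local Notation word := (fmonom 'I_n).
Local Notation ncpoly := (malg word C).
Local Notation ncpoly2 := (malg (word * word)%type C).
Local Notation "''U' w" := (mkmalgU w 1) (at level 8).
Variables (phi : word -> C) (K0 c : R).

(** tau (v(X)^* u(X)), and its tensor square. *)
Definition law_kernel (u v : word) : C := phi (fmmul (wrev v) u).
Definition law_kernel2 (p q : word * word) : C :=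
  law_kernel p.1 q.1 * law_kernel p.2 q.2.

Hypotheses (phi1 : phi (fmone _) = 1)
  (phi_trace : forall u v, phi (fmmul u v) = phi (fmmul v u))
  (phi_pos : forall P, 0 <= kform law_kernel P P)
  (c0 : 0 < c)
  (phi_growth : forall w, cabs (phi w) <= K0 * c ^+ size w).

Let B0 := kform law_kernel.
Let B1 := kform law_kernel2.

Let B0P : psd setT B0. Proof. exact: kform_psd. Qed.

Let B1P : psd setT B1.
Proof.
have := @tensor_psd R _ _ _ _ _ _ (word * word)%type (fun p => 'U p.1)
  (fun p => 'U p.2) B0P B0P (fun _ => I) (fun _ => I).
by congr (psd _ (kform _)); apply/funext => p; apply/funext => q; rewrite /B0 !kformU.
Qed.

Local Notation tau2 := (pairing phi).
Local Notation one2 := (one2 C n).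
Local Notation nrm0 := (nrm B0).
Local Notation nrm1 := (nrm B1).

Lemma kernel_lmulw u v w : law_kernel (lmulw u v) w = law_kernel v (lmulw (wrev u) w).
Proof. by rewrite /law_kernel /lmulw wrevM wrevK fmmulA. Qed.

Lemma kernel_rmulw u v w : law_kernel (rmulw u v) w = law_kernel v (rmulw (wrev u) w).
Proof. by rewrite /law_kernel /rmulw wrevM wrevK fmmulA phi_trace fmmulA. Qed.

(** The growth of the moments bounds the operator norm of a multiplication by a
    letter, through [symmetric_growth_bound]. *)
Lemma letter_bound (f : word -> word) : (forall w, size (f w) = (size w).+1) ->
  (forall v w, law_kernel (f v) w = law_kernel v (f w)) ->
  forall P, nrm0 (basis_map f P) ^+ 2 <= c ^+ 2 * nrm0 P ^+ 2.
Proof.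
move=> fs fsym P.
apply: (symmetric_growth_bound B0P) => //; first by rewrite exprn_gt0.
  by move=> x y _ _; exact: kform_adjoint.
move=> {}P _; exists (\sum_(x <- msupp P) \sum_(y <- msupp P)
  cabs (mcoeff x P) * cabs (mcoeff y P) * (K0 * c ^+ (size x + size y))) => k.
have iterE : iter k (basis_map f) P = basis_map (iter k f) P.
  elim: k => [|k ih]; first by rewrite basis_map_id.
  rewrite iterS ih basis_map_comp.
  congr (basis_map _ _).
rewrite (sqr_nrm B0P I) iterE /B0 kform_basis_map kformE.
apply: le_trans (le_trans (ler_norm _) (Re_le_cabs _)) _.
apply: le_trans (cabs_sum _ _) _; rewrite mulr_suml; apply: ler_sum => x _.
apply: le_trans (cabs_sum _ _) _; rewrite mulr_suml; apply: ler_sum => y _.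
rewrite !cabsM cabs_conj -!mulrA !ler_wpM2l ?cabs_ge0//.
apply: le_trans (phi_growth _) _; rewrite fmmulE/= size_cat size_rev.
have si u : size (iter k f u) = (k + size u)%N.
  by elim: k {iterE} => //= k ih; rewrite fs ih.
have -> : (size (iter k f y) + size (iter k f x) = size x + size y + 2 * k)%N.
  by rewrite !si addnACA addnC [(size y + _)%N]addnC mul2n addnn.
by rewrite exprD exprM mulrA.
Qed.

Lemma lmul_letter_bound i P :
  nrm0 (basis_map (lmulw (fmu i)) P) ^+ 2 <= c ^+ 2 * nrm0 P ^+ 2.
Proof.
apply: letter_bound => [w|v w]; first exact: size_letterl.
by rewrite kernel_lmulw wrev_letter.
Qed.

Lemma rmul_letter_bound i P :
  nrm0 (basis_map (rmulw (fmu i)) P) ^+ 2 <= c ^+ 2 * nrm0 P ^+ 2.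
Proof.
apply: letter_bound => [w|v w]; first exact: size_letterr.
by rewrite kernel_rmulw wrev_letter.
Qed.

(** Boundedness of an operator on a leg of the tensor square is the positivity
    of the product kernel built from c^2 <P, P'> - <f P, f P'>. *)
Lemma leg1_bound f : (forall P, nrm0 (basis_map f P) ^+ 2 <= c ^+ 2 * nrm0 P ^+ 2) ->
  forall Q, nrm1 (basis_map (leg1 f) Q) ^+ 2 <= c ^+ 2 * nrm1 Q ^+ 2.
Proof.
move=> fb Q.
pose G P P' := (c ^+ 2)%:C%C * B0 P P' - B0 (basis_map f P) (basis_map f P').
have GP : psd setT G.
  apply: psd_intro => //.
  - move=> a x y z _ _ _; rewrite /G linearP/= !(psd_linl B0P _ I I I).
    exact: form_combination.
  - move=> a x y z _ _ _; rewrite /G linearP/= !(psdDr B0P I I I) ?(psdZr B0P _ I I).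
    exact: form_combination.
  - move=> P _; rewrite /G !(psdE B0P I) -rmorphM -rmorphB/= ler0c subr_ge0.
    exact: fb.
have := tensor_psd GP B0P (f := fun p : word * word => 'U p.1)
  (g := fun p => 'U p.2) (fun _ => I) (fun _ => I).
move=> /psd_ge0/(_ Q I).
rewrite (_ : (fun _ => _) = fun p q => (c ^+ 2)%:C%C * law_kernel2 p q -
    law_kernel2 (leg1 f p) (leg1 f q)); last first.
  apply/funext => p; apply/funext => q; rewrite /G !basis_mapU /B0 !kformU.
  by rewrite /law_kernel2/= mulrBl mulrA.
rewrite kformB -kform_basis_map -/B1 !(psdE B1P I) -rmorphM -rmorphB/= ler0c.
by rewrite subr_ge0.
Qed.

Lemma leg2_bound f : (forall P, nrm0 (basis_map f P) ^+ 2 <= c ^+ 2 * nrm0 P ^+ 2) ->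
  forall Q, nrm1 (basis_map (leg2 f) Q) ^+ 2 <= c ^+ 2 * nrm1 Q ^+ 2.
Proof.
move=> fb Q.
pose G P P' := (c ^+ 2)%:C%C * B0 P P' - B0 (basis_map f P) (basis_map f P').
have GP : psd setT G.
  apply: psd_intro => //.
  - move=> a x y z _ _ _; rewrite /G linearP/= !(psd_linl B0P _ I I I).
    exact: form_combination.
  - move=> a x y z _ _ _; rewrite /G linearP/= !(psdDr B0P I I I) ?(psdZr B0P _ I I).
    exact: form_combination.
  - move=> P _; rewrite /G !(psdE B0P I) -rmorphM -rmorphB/= ler0c subr_ge0.
    exact: fb.
have := tensor_psd B0P GP (f := fun p : word * word => 'U p.1)
  (g := fun p => 'U p.2) (fun _ => I) (fun _ => I).
move=> /psd_ge0/(_ Q I).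
rewrite (_ : (fun _ => _) = fun p q => (c ^+ 2)%:C%C * law_kernel2 p q -
    law_kernel2 (leg2 f p) (leg2 f q)); last first.
  apply/funext => p; apply/funext => q; rewrite /G !basis_mapU /B0 !kformU.
  by rewrite /law_kernel2/= mulrBr mulrCA.
rewrite kformB -kform_basis_map -/B1 !(psdE B1P I) -rmorphM -rmorphB/= ler0c.
by rewrite subr_ge0.
Qed.

Lemma le_of_sqr (x y : R) : 0 <= y -> x ^+ 2 <= c ^+ 2 * y ^+ 2 -> x <= c * y.
Proof.
move=> y0; have cy : 0 <= c * y by rewrite mulr_ge0// ltW.
rewrite -exprMn => xy; case: (leP x 0) => [x0|x0]; first exact: le_trans cy.
by rewrite -(@ler_pXn2r _ 2)// nnegrE ltW.
Qed.

Lemma ad_bound i P : nrm0 (ad i P) <= (c + c) * nrm0 P.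
Proof.
apply: le_trans (nrmB B0P _ _) _ => //; rewrite mulrDl lerD//.
  by apply: le_of_sqr; rewrite ?nrm_ge0// lmul_letter_bound.
by apply: le_of_sqr; rewrite ?nrm_ge0// rmul_letter_bound.
Qed.

Lemma ad2_bound i Q : nrm1 (ad2 i Q) <= (c + c) * nrm1 Q.
Proof.
apply: le_trans (nrmB B1P _ _) _ => //; rewrite mulrDl lerD//.
  apply: le_of_sqr; rewrite ?nrm_ge0// leg1_bound// => P.
  exact: lmul_letter_bound.
apply: le_of_sqr; rewrite ?nrm_ge0// leg2_bound// => P.
exact: rmul_letter_bound.
Qed.

Lemma ad_sym i P Q : B0 (ad i P) Q = B0 P (ad i Q).
Proof.
rewrite /ad (psdBl B0P I I I) (psdBr B0P I I I).
congr (_ - _); apply: kform_adjoint => u v.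
  by rewrite kernel_lmulw wrev_letter.
by rewrite kernel_rmulw wrev_letter.
Qed.

Lemma ad2_sym i P Q : B1 (ad2 i P) Q = B1 P (ad2 i Q).
Proof.
rewrite /ad2 (psdBl B1P I I I) (psdBr B1P I I I).
congr (_ - _); apply: kform_adjoint => u v.
  by rewrite /law_kernel2/= kernel_lmulw wrev_letter.
by rewrite /law_kernel2/= kernel_rmulw wrev_letter.
Qed.

Lemma law_kernel1 u : law_kernel u (fmone _) = phi u.
Proof. by rewrite /law_kernel wrev1 fmmul1m. Qed.

Lemma tau2E Q : tau2 Q = B1 Q one2.
Proof.
apply: (@linear_ext C _ C^o tau2 (B1^~ one2)); [|exact: kform_linl|].
  exact: lin_ext_is_linear.
move=> [u v]; rewrite /pairing lin_extU /B1 kformU /law_kernel2/=.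
by rewrite !law_kernel1.
Qed.

Lemma phi_rev w : phi (wrev w) = (phi w)^*.
Proof.
have := psd_herm B0P (x := 'U w) (y := 'U (fmone _)) I I.
by rewrite /B0 !kformU law_kernel1 /law_kernel fmmulm1.
Qed.

(** The polynomials in one variable [X i] form a commutative algebra, and
    [J f] identifies f(x, y) with f(X_i (x) 1, 1 (x) X_i). Through it the form
    [B1] becomes integration of f g against mu (x) mu, mu being the distribution
    of [X i], and the commutator becomes multiplication by x - y. *)
Section Powers.
Variable i : 'I_n.
Hypothesis i_fisher : exists2 K, 0 <= K & forall P : ncpoly,
  cabs (tau2 (free_diff i P)) <= K * nrm0 P.

Let pw k : word := FMonom (nseq k i).
Let mr k : R := complex.Re (phi (pw k)).
(* Integration against mu (x) mu. *)
Let mm (f : {poly {poly R}}) := moment mr (moment (polyC \o mr) f).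

Let phi_pw k : phi (pw k) = (mr k)%:C%C.
Proof.
have : phi (pw k) = (phi (pw k))^*.
  by rewrite -phi_rev /wrev /= rev_nseq.
by rewrite /mr; case: (phi (pw k)) => a b [/eqP]; rewrite -addr_eq0 -mulr2n mulrn_eq0/= => /eqP ->.
Qed.

Let X1 := basis_map (A := C) (leg1 (lmulw (fmu i))).
Let X2 := basis_map (A := C) (leg2 (rmulw (fmu i))).
Let J2 := poly_act (fun r : R => r%:C%C *: one2) X2.
Let J := poly_act J2 X1.

Let uD : {morph (fun r : R => r%:C%C *: one2) : x y / x + y}.
Proof. by move=> x y; rewrite rmorphD/= scalerDl. Qed.

Let X1D : {morph X1 : x y / x + y}. Proof. exact: linearD. Qed.
Let X2D : {morph X2 : x y / x + y}. Proof. exact: linearD. Qed.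

Let J2D : {morph J2 : x y / x + y}. Proof. exact: (poly_actD uD X2D). Qed.
Let JD : {morph J : x y / x + y}. Proof. exact: (poly_actD J2D X1D). Qed.

Let JMX f : J (f * 'X) = X1 (J f). Proof. exact: (poly_actMX J2D X1D). Qed.
Let J2MX f : J2 (f * 'X) = X2 (J2 f). Proof. exact: (poly_actMX uD X2D). Qed.
Let JC f : J f%:P = J2 f. Proof. exact: (poly_actC J2D X1D). Qed.
Let J2C r : J2 r%:P = r%:C%C *: one2. Proof. exact: (poly_actC uD X2D). Qed.

Let X12 Q : X1 (X2 Q) = X2 (X1 Q).
Proof. exact: basis_map_legs. Qed.

Let JMY f : J (('X)%:P * f) = X2 (J f).
Proof.
elim/poly_ind: f => [|f a ih].
  rewrite mulr0 /J (poly_act0 J2D X1D) /X2 linear0//.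
rewrite mulrDr mulrA -rmorphM/= !JD !JMX !JC ih X2D X12; congr (_ + _).
exact: (etrans (congr1 J2 (mulrC _ _)) (J2MX a)).
Qed.

Let JD1 f : J (('X - ('X)%:P) * f) = ad2 i (J f).
Proof.
have e : ad2 i (J f) = J (f * 'X) - J (('X)%:P * f) by rewrite JMX JMY.
rewrite e mulrBl [f * 'X]mulrC.
by apply: (addIr (J (('X)%:P * f))); rewrite subrK -JD subrK.
Qed.

Let X1pw a b : X1 'U (pw a, pw b) = 'U (pw a.+1, pw b).
Proof. by rewrite /X1 basis_mapU /leg1/= /lmulw fmmulE fmuE. Qed.

Let X2pw a b : X2 'U (pw a, pw b) = 'U (pw a, pw b.+1).
Proof.
rewrite /X2 basis_mapU /leg2/= /rmulw fmmulE fmuE /pw/=.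
by rewrite (_ : nseq b i ++ [:: i] = i :: nseq b i)// -[[:: i]]/(nseq 1 i) -nseqD addn1.
Qed.

Let X1Z a Q : X1 (a *: Q) = a *: X1 Q. Proof. exact: linearZ. Qed.
Let X2Z a Q : X2 (a *: Q) = a *: X2 Q. Proof. exact: linearZ. Qed.

Let iterX1Z := iter_scale X1Z.
Let iterX2Z := iter_scale X2Z.

Let one2E : one2 = 'U (pw 0%N, pw 0%N). Proof. by rewrite /one2 fmoneE. Qed.

Let iterX2 b : iter b X2 one2 = 'U (pw 0%N, pw b).
Proof. by rewrite one2E; exact: (iter_orbit (X2pw 0%N)). Qed.

Let iterX1 a b : iter a X1 'U (pw 0%N, pw b) = 'U (pw a, pw b).
Proof. exact: (iter_orbit (fun a => X1pw a b)). Qed.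

Let iterX1D k : {morph iter k X1 : x y / x + y}. Proof. exact: iter_add X1D k. Qed.

Let iterX1_0 k : iter k X1 0 = 0.
Proof. by apply: iter_fix; rewrite /X1 linear0. Qed.

Let J2E p : J2 p = \sum_(k < size p) (p`_k)%:C%C *: 'U (pw 0%N, pw k).
Proof.
by apply: eq_bigr => k _; rewrite iterX2Z iterX2.
Qed.

Let JE f : J f = \sum_(k < size f) \sum_(l < size f`_k)
  (f`_k`_l)%:C%C *: 'U (pw k, pw l).
Proof.
apply: eq_bigr => k _; rewrite J2E (big_morph _ (iterX1D k) (iterX1_0 k)).
by apply: eq_bigr => l _; rewrite iterX1Z iterX1.
Qed.

Let tau2J f : tau2 (J f) = (mm f)%:C%C.
Proof.
have -> : mm f = \sum_(k < size f) \sum_(l < size f`_k) f`_k`_l * (mr k * mr l).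
  rewrite /mm (momentE (polyC \o mr) (leqnn _)) (raddf_sum (moment mr)).
  apply: eq_bigr => k _; rewrite /= mulrC momentCM /moment mulr_sumr.
  by apply: eq_bigr => l _; rewrite mulrCA.
rewrite JE linear_sum (rmorph_sum (real_complex R)); apply: eq_bigr => k _.
rewrite linear_sum (rmorph_sum (real_complex R)); apply: eq_bigr => l _.
rewrite linearZ/= /pairing lin_extU/= !phi_pw.
by rewrite -[LHS]/((f`_k`_l)%:C%C * _) -!rmorphM.
Qed.

Let B1J f g : B1 (J f) (J g) = (mm (f * g))%:C%C.
Proof.
have symX1 P Q : B1 (X1 P) Q = B1 P (X1 Q).
  apply: kform_adjoint => u v.
  by rewrite /law_kernel2/= kernel_lmulw wrev_letter.
have symX2 P Q : B1 (X2 P) Q = B1 P (X2 Q).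
  apply: kform_adjoint => u v.
  by rewrite /law_kernel2/= kernel_rmulw wrev_letter.
have mmD p q : mm (p + q) = mm p + mm q by rewrite /mm !raddfD.
elim/poly_ind: f g => [|f a ihf] g.
  rewrite mul0r /J (poly_act0 J2D X1D) (psd_0l B1P I).
  by rewrite /mm !raddf0.
rewrite JD (psdDl B1P I I I) JMX symX1 -JMX ihf mulrDl mmD rmorphD/=.
rewrite JC; congr (_ + _); first by congr ((mm _)%:C%C); ring.
elim/poly_ind: a g => [|p r ihp] g.
  rewrite mul0r /J2 (poly_act0 uD X2D) (psd_0l B1P I).
  by rewrite /mm !raddf0.
rewrite J2D (psdDl B1P I I I) J2MX symX2 -JMY ihp rmorphD/= mulrDl mmD rmorphD/=.
congr (_ + _); first by congr ((mm _)%:C%C); rewrite rmorphM/=; ring.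
rewrite J2C (psdZl B1P _ I I) (psd_herm B1P (x := J g) I I) -tau2E tau2J.
rewrite [_^*](_ : _ = (mm g)%:C%C); last exact: conjc_real.
by rewrite -rmorphM/= /mm !momentCM.
Qed.

Let spoly (p : {poly R}) : ncpoly := \sum_(k < size p) (p`_k)%:C%C *: 'U (pw k).

Let nrm0_spoly p : nrm0 (spoly p) = Num.sqrt (moment mr (p * p)).
Proof.
have m0 : mr 0%N = 1 by rewrite /mr /pw -fmoneE phi1.
have emb : basis_map (fun w => (fmone _, w)) (spoly p) = J p%:P.
  rewrite JC J2E /spoly linear_sum; apply: eq_bigr => k _.
  by rewrite linearZ/= basis_mapU fmoneE.
rewrite /nrm [moment mr _](_ : _ = complex.Re (B1 (J p%:P) (J p%:P))).
  rewrite -emb /B1 kform_basis_map; congr (Num.sqrt (complex.Re (kform _ _ _))).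
  apply/funext => u; apply/funext => v.
  by rewrite /law_kernel2/= law_kernel1 phi1 mul1r.
by rewrite B1J /= /mm -rmorphM/= momentC/= m0 mulr1.
Qed.

Let word_diff_pw k : tau2 (word_diff C i (pw k)) = (autoconv mr k)%:C%C.
Proof.
rewrite /word_diff /= size_nseq.
rewrite linear_sum /autoconv rmorph_sum/= big_mkcond/=.
apply: eq_bigr => j _; rewrite nth_nseq ltn_ord eqxx /pairing lin_ext_tensor/=.
rewrite (take_nseq _ (ltnW (ltn_ord j))) drop_nseq !phi_pw -rmorphM/=.
by congr ((_ * mr _)%:C%C); case: j => j /= jk; rewrite -subn1 -subnDA add1n.
Qed.

(** That 1 (x) 1 is in the closure of the range is [diffuse_ideal_dense] for the
    distribution of [X i]; [kap] makes kap (x - y)^2 at most 1. *)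
Lemma ad2_range_dense e : 0 < e -> exists h, nrm1 (one2 - ad2 i h) <= e.
Proof.
move=> e0; have [K K_ge0 fK] := i_fisher.
have m0 : mr 0%N = 1 by rewrite /mr /pw -fmoneE phi1.
pose kap := ((c + c) ^+ 2)^-1.
have c2 : 0 < (c + c) ^+ 2 by exact: (exprn_gt0 2 (addr_gt0 c0 c0)).
have kap0 : 0 < kap := etrans (invr_gt0 _) c2.
have mmE f : mm (f * f) = nrm1 (J f) ^+ 2 by rewrite (sqr_nrm B1P I) B1J.
have mm_ge0 f : 0 <= mm (f * f) by rewrite mmE sqr_ge0.
have mm_bound f : kap * mm (('X - ('X)%:P) ^+ 2 * (f * f)) <= mm (f * f).
  have -> : ('X - ('X)%:P) ^+ 2 * (f * f) =
    (('X - ('X)%:P) * f) * (('X - ('X)%:P) * f) :> {poly {poly R}} by ring.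
  rewrite !mmE JD1 /kap mulrC (ler_pdivrMr _ _ c2) mulrC -exprMn.
  exact: (sqr_le_mono (nrm_ge0 _ _) (ad2_bound i _)).
have fisher p : `|moment (autoconv mr) p| <= K * Num.sqrt (moment mr (p * p)).
  rewrite -nrm0_spoly -cabs_real; apply: le_trans (fK _).
  rewrite [X in _ <= cabs X](_ : _ = (moment (autoconv mr) p)%:C%C); first exact: lexx.
  pose F : {linear ncpoly -> ncpoly2} := lin_ext (word_diff C i).
  rewrite /spoly /moment -[free_diff i _]/(F _) (linear_sum F) linear_sum.
  rewrite (rmorph_sum (real_complex R)); apply: eq_bigr => k _.
  rewrite linearZ/= lin_extU linearZ/= word_diff_pw rmorphM.
  by [].
have [h hh] := diffuse_ideal_dense m0 kap0 K_ge0 mm_ge0 mm_bound fisher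
  (exprn_gt0 2 e0).
exists (J h); rewrite -JD1.
have -> : one2 = J 1.
  rewrite -[1 in RHS]/(1%:P%:P) JC J2C rmorph1 scale1r; reflexivity.
have -> : J 1 - J (('X - ('X)%:P) * h) = J (1 - ('X - ('X)%:P) * h).
  by apply: (addIr (J (('X - ('X)%:P) * h))); rewrite subrK -JD subrK.
by apply: (sqr_le_inv (ltW e0)); rewrite -mmE.
Qed.

End Powers.

Lemma tau2_rmul w Q :
  tau2 (basis_map (leg2 (rmulw w)) Q) = B1 Q 'U (inr2 (wrev w)).
Proof.
apply: (@linear_ext C _ C^o (fun Q => tau2 (basis_map (leg2 (rmulw w)) Q))
  (fun Q => B1 Q 'U (inr2 (wrev w)))).
- by move=> a x y; rewrite basis_map_linear pairing_linear.
- exact: kform_linl.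
move=> [u v]; rewrite basis_mapU pairingU /B1 kformU /law_kernel2/=.
by rewrite law_kernel1 /law_kernel wrevK /rmulw phi_trace.
Qed.

Lemma B1_inr2 P v : B1 (basis_map (@inr2 n) P) 'U (inr2 v) = B0 P 'U v.
Proof.
apply: (@linear_ext C _ C^o (fun P => B1 (basis_map (@inr2 n) P) 'U (inr2 v))
  (fun P => B0 P 'U v)).
- by move=> a x y; rewrite basis_map_linear (psd_linl B1P a I I I).
- exact: kform_linl.
move=> w; rewrite basis_mapU /B0 /B1 !kformU /law_kernel2/=.
by rewrite law_kernel1 phi1 mul1r.
Qed.

Lemma B1_inl2 P v : B1 (basis_map (@inl2 n) P) 'U (inr2 v) =
  phi (wrev v) * B0 P 'U (fmone _).
Proof.
apply: (@linear_ext C _ C^o (fun P => B1 (basis_map (@inl2 n) P) 'U (inr2 v))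
  (fun P => phi (wrev v) * B0 P 'U (fmone _))).
- by move=> a x y; rewrite basis_map_linear (psd_linl B1P a I I I).
- move=> a x y; rewrite (psd_linl B0P a I I I) mulrDr mulrCA.
  by [].
move=> w; rewrite basis_mapU /B0 /B1 !kformU /law_kernel2/=.
by rewrite mulrC; congr (_ * _); rewrite /law_kernel fmmulm1.
Qed.

(** For a fixed [Q] the trace of y . Q is a finite combination of products of
    tau (y u) with constants. *)
Lemma tau2_lact_bound Q : exists2 K, 0 <= K & forall y : ncpoly,
  cabs (tau2 (ncpoly2_lact y Q)) <= K * nrm0 y.
Proof.
exists (\sum_(p <- msupp Q)
    cabs (mcoeff p Q) * (nrm0 'U (wrev p.1) * cabs (phi p.2))).
  by apply: sumr_ge0 => p _; rewrite !mulr_ge0 ?cabs_ge0 ?nrm_ge0.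
move=> y; rewrite pairing_lact; apply: le_trans (cabs_sum _ _) _.
rewrite mulr_suml; apply: ler_sum => p _.
have -> : (lin_ext (fun u => (phi (fmmul u p.1) : C^o)) y : C) = B0 y 'U (wrev p.1).
  apply: (@linear_ext C _ C^o (lin_ext (fun u => phi (fmmul u p.1) : C^o))
    (fun y => B0 y 'U (wrev p.1))).
  - exact: lin_ext_is_linear.
  - exact: kform_linl.
  by move=> u; rewrite lin_extU /B0 kformU /law_kernel wrevK phi_trace.
rewrite !cabsM -[leRHS]mulrA ler_wpM2l ?cabs_ge0// mulrAC ler_wpM2r ?cabs_ge0//.
by rewrite mulrC; exact: (cauchy_schwarz B0P I I).
Qed.

Lemma rmul_word_bound w P : nrm0 (basis_map (rmulw w) P) <= c ^+ size w * nrm0 P.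
Proof.
elim/word_ind: w P => [|i w ih] P.
  rewrite fmoneE mul1r basis_map_id// => u.
  by rewrite /rmulw -fmoneE fmmulm1.
have -> : basis_map (rmulw (fmmul (fmu i) w)) P =
    basis_map (rmulw w) (basis_map (rmulw (fmu i)) P).
  rewrite basis_map_comp; congr (basis_map _ P); apply/funext => u.
  by rewrite /rmulw/= fmmulA.
apply: le_trans (ih _) _; rewrite size_letterl exprSr -mulrA ler_wpM2l//.
  by rewrite exprn_ge0// ltW.
by apply: le_of_sqr; rewrite ?nrm_ge0// rmul_letter_bound.
Qed.

Definition ad2_adherent i (Q : ncpoly2) :=
  forall e, 0 < e -> exists h, nrm1 (Q - ad2 i h) <= e.

Lemma adherent_map i (f : word * word -> word * word) Q :
  (forall P : ncpoly2, basis_map f (ad2 i P) = ad2 i (basis_map f P)) ->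
  (forall P : ncpoly2, nrm1 (basis_map f P) ^+ 2 <= c ^+ 2 * nrm1 P ^+ 2) ->
  ad2_adherent i Q -> ad2_adherent i (basis_map f Q).
Proof.
move=> fad fb hQ e e0; have [h hh] := hQ _ (divr_gt0 e0 c0).
exists (basis_map f h); rewrite -fad.
have <- : basis_map f (Q - ad2 i h) = basis_map f Q - basis_map f (ad2 i h).
  exact: basis_mapB.
have := le_of_sqr (nrm_ge0 _ _) (fb (Q - ad2 i h)); move=> /le_trans; apply.
by rewrite mulrC -ler_pdivlMr.
Qed.

(** The inner bimodule operations 1 (x) 1 |-> u (x) v commute with the outer
    commutator, so that density at 1 (x) 1 spreads to all the words. *)
Lemma adherent_basis i (i_fisher : exists2 K, 0 <= K & forall P : ncpoly,
    cabs (tau2 (free_diff i P)) <= K * nrm0 P) p :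
  ad2_adherent i 'U p.
Proof.
case: p => u v.
have base : ad2_adherent i one2 by move=> e e0; exact: ad2_range_dense.
elim/word_rind: u => [|j u ih]; last first.
  have <- : basis_map (leg1 (rmulw (fmu j))) 'U (u, v)
      = 'U (fmmul u (fmu j), v) :> ncpoly2 by exact: basis_mapU.
  apply: adherent_map ih; first exact: ad2_rmul_leg1.
  by move=> P; apply: leg1_bound => P'; exact: rmul_letter_bound.
elim/word_ind: v => [//|j v ih].
have <- : basis_map (leg2 (lmulw (fmu j))) 'U (fmone 'I_n, v)
    = 'U (fmone _, fmmul (fmu j) v) :> ncpoly2 by exact: basis_mapU.
apply: adherent_map ih; first exact: ad2_lmul_leg2.
by move=> P; apply: leg2_bound => P'; exact: lmul_letter_bound.
Qed.

Lemma ad2_dense i (i_fisher : exists2 K, 0 <= K & forall P : ncpoly,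
    cabs (tau2 (free_diff i P)) <= K * nrm0 P) Q :
  ad2_adherent i Q.
Proof.
rewrite -[Q]lin_ext_id (lin_extE _ (fsubset_refl _)).
move=> e e0; apply: (@adherent_sum R _ B1 (ad2 i) _ (msupp Q) (fun k => mcoeff k Q)
  (fun k => 'U k) B1P (@ad2_linear C n i) _ e e0) => p.
exact: (adherent_basis i_fisher).
Qed.

Section Central.
Variables (i0 i1 : 'I_n) (l : ncpoly -> C) (M : R).
Hypotheses (i01 : i0 != i1)
  (fisher0 : exists2 K, 0 <= K & forall P : ncpoly,
    cabs (tau2 (free_diff i0 P)) <= K * nrm0 P)
  (fisher1 : exists2 K, 0 <= K & forall P : ncpoly,
    cabs (tau2 (free_diff i1 P)) <= K * nrm0 P)
  (M0 : 0 <= M) (l_lin : linear (l : ncpoly -> C^o))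
  (l_bound : forall P, cabs (l P) <= M * nrm0 P)
  (l_ad0 : forall P, l (ad i0 P) = 0) (l_ad1 : forall P, l (ad i1 P) = 0).

(* The pairing of the formula [free_diff_ad] for p with 1 (x) w^*. *)
Let commutator_identity w p : B0 p 'U (wrev w) - phi w * B0 p 'U (fmone _) =
  tau2 (free_diff i0 (basis_map (rmulw w) (ad i0 p)))
  - tau2 (ncpoly2_lact (ad i0 p) (word_diff C i0 w))
  - (B1 (ad2 i0 'U (inr2 (wrev w))) (free_diff i0 p))^*.
Proof.
have e1 := free_diff_rmul i0 phi w (ad i0 p).
have e2 := tau2_rmul w (free_diff i0 (ad i0 p)).
have e3 := congr1 (B1^~ 'U (inr2 (wrev w))) (free_diff_ad i0 p).
have e4 := B1_inr2 p (wrev w); have e5 := B1_inl2 p (wrev w).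
rewrite wrevK in e5.
have e6 := etrans e3 (psdDl B1P I I I); have e7 := ad2_sym i0 (free_diff i0 p) 'U (inr2 (wrev w)).
have e8 := psd_herm B1P (x := ad2 i0 'U (inr2 (wrev w))) (y := free_diff i0 p) I I.
have e9 := psdBl B1P (x := basis_map (@inr2 n) p) (y := basis_map (@inl2 n) p)
  (z := 'U (inr2 (wrev w))) I I I.
exact: (scalar_chain e1 e2 e6 e9 e4 e5 e7 e8).
Qed.

(** Apply [commutator_identity] to the elements p of [central_approximation],
    where the left hand side tends to the conjugate of l(v) - l(1) phi(v), and
    all the terms on the right hand side are small. *)
Lemma central_functional v : l 'U v = l 'U (fmone _) * phi v.
Proof.
have [w ->] : exists w, v = wrev w by exists (wrev v); rewrite wrevK.
have [K K0' hK] := fisher0.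
have [K2 K20 hK2] := tau2_lact_bound (word_diff C i0 w).
pose T := 1 + cabs (phi w) + K * c ^+ size w + K2 + 1.
have T0 : 0 < T.
  by rewrite ltr_pwDr// !addr_ge0 ?cabs_ge0// mulr_ge0// exprn_ge0// ltW.
apply/eqP; rewrite -subr_eq0; apply/eqP; apply: cabs_le_eps => eta eta0.
have [p [h1 h2 h3 h4]] := central_approximation B0P B1P
  (@free_diff_linear C n i0) (addr_ge0 (ltW c0) (ltW c0))
  (ad_sym i0) (ad_sym i1) (ad2_sym i1) (ad_bound i0) (ad_bound i1)
  (ad2_bound i1) (fun P => free_diff_ad_other P i01)
  (ad2_dense fisher1) M0 l_lin l_bound l_ad0 l_ad1
  'U (wrev w) 'U (fmone _) (ad2 i0 'U (inr2 (wrev w))) (divr_gt0 eta0 T0).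
rewrite phi_rev -[leRHS](divfK (lt0r_neq0 T0)).
exact: (central_estimate K0' (exprn_ge0 (size w) (ltW c0)) K20 h1
  (psd_herm B0P (x := p) (y := 'U (wrev w)) I I) h2
  (psd_herm B0P (x := p) (y := 'U (fmone _)) I I) h3
  (hK (basis_map (rmulw w) (ad i0 p))) (rmul_word_bound w (ad i0 p))
  (hK2 (ad i0 p)) h4 (commutator_identity w p)).
Qed.

End Central.
End FisherLaw.

(** * Limits, Hilbert spaces and square-summable families *)

Section ComplexLimits.
Variable R : realType.
Local Notation C := R[i]%C.
Implicit Types u : nat -> C.

Lemma cvg_cabs u l : (forall e : R, 0 < e ->
    exists N, forall k, (N <= k)%N -> cabs (u k - l) <= e) ->
  (u : nat -> C^o) @ \oo --> (l : C^o).
Proof.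
move=> h; apply/(@cvgrPdist_le _ C^o) => e e0.
have e0' : 0 < complex.Re e by rewrite -ltcR -(ge0_Re (ltW e0)).
have [N hN] := h _ e0'; exists N => // k Nk.
by rewrite [leRHS](ge0_Re (ltW e0)) cabsE lecR cabsB hN.
Qed.

Lemma cabs_cvg u l : (u : nat -> C^o) @ \oo --> (l : C^o) ->
  forall e : R, 0 < e -> exists N, forall k, (N <= k)%N -> cabs (u k - l) <= e.
Proof.
move=> /(@cvgrPdist_le _ C^o) h e e0.
have e0' : 0 < e%:C%C by rewrite ltcR.
have [N _ hN] := h _ e0'; exists N => k Nk.
by rewrite cabsB -lecR -cabsE; exact: hN.
Qed.

Lemma real_cauchy (v : nat -> R) : (forall e : R, 0 < e ->
    exists N, forall k l, (N <= k)%N -> (N <= l)%N -> `|v k - v l| <= e) ->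
  exists a, forall e : R, 0 < e ->
    exists N, forall k, (N <= k)%N -> `|v k - a| <= e.
Proof.
move=> h; have /cauchy_cvgP vc : cauchy (v @ \oo).
  apply: cauchy_exP => e e0; have [N hN] := h _ (divr_gt0 e0 (ltr0n R 2)).
  exists (v N); exists N => // k /= Nk; rewrite /ball/=.
  by rewrite (le_lt_trans (hN _ _ (leqnn N) Nk))// gtr_pMr// invf_lt1 ?ltr1n.
exists (lim (v @ \oo)) => e e0.
have [N _ hN] := (@cvgrPdist_le _ R^o _ _ _ _ _).1 vc _ e0.
by exists N => k Nk; rewrite distrC; exact: hN.
Qed.

(** Completeness of [R[i]], from that of the real and the imaginary parts. *)
Lemma complex_cauchy u : (forall e : R, 0 < e ->
    exists N, forall k l, (N <= k)%N -> (N <= l)%N -> cabs (u k - u l) <= e) ->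
  exists a, forall e : R, 0 < e ->
    exists N, forall k, (N <= k)%N -> cabs (u k - a) <= e.
Proof.
move=> h.
have ci : cabs (0 +i* 1)%C = 1 :> R by rewrite /cabs normc_def/= expr0n expr1n add0r sqrtr1.
have Im_le (z : C) : `|complex.Im z| <= cabs z.
  have -> : complex.Im z = - complex.Re ((0 +i* 1)%C * z) by case: z => x y /=; ring.
  rewrite normrN (le_trans (Re_le_cabs _))// cabsM.
  by rewrite ci mul1r.
have [a ha] : exists a, forall e : R, 0 < e ->
    exists N, forall k, (N <= k)%N -> `|complex.Re (u k) - a| <= e.
  apply: real_cauchy => e /h[N hN]; exists N => k l Nk Nl.
  by rewrite -ReN -ReD; apply: le_trans (Re_le_cabs _) (hN _ _ Nk Nl).
have [b hb] : exists b, forall e : R, 0 < e ->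
    exists N, forall k, (N <= k)%N -> `|complex.Im (u k) - b| <= e.
  apply: real_cauchy => e /h[N hN]; exists N => k l Nk Nl.
  have -> : complex.Im (u k) - complex.Im (u l) = complex.Im (u k - u l).
    by case: (u k) (u l) => ? ? [].
  exact: le_trans (Im_le _) (hN _ _ Nk Nl).
exists (a +i* b)%C => e e0.
have [N1 h1] := ha _ (divr_gt0 e0 (ltr0n R 2)); have [N2 h2] := hb _ (divr_gt0 e0 (ltr0n R 2)).
exists (maxn N1 N2) => k; rewrite geq_max => /andP[/h1 k1 /h2 k2].
have -> : u k - (a +i* b)%C =
    (complex.Re (u k) - a)%:C%C + (0 +i* 1)%C * (complex.Im (u k) - b)%:C%C.
  case: (u k) => x y /=; apply/eqP; rewrite eq_complex/=.
  by apply/andP; split; apply/eqP; ring.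
rewrite (le_trans (cabsD _ _))// cabsM ci mul1r !cabs_real [e]splitr.
exact: lerD.
Qed.

End ComplexLimits.

Section HilbertSpace.
Variables (R : realType) (H : hilbertType R).
Local Notation C := R[i]%C.
Implicit Types (x y z : H) (T S : H -> H).

Lemma inner_psd : psd setT (fun x y : H => inner x y).
Proof.
split=> //.
- by move=> a x y z _ _ _; rewrite linearPl.
- by move=> x y _ _; rewrite hermC/= expr0 mul1r.
Qed.

Definition hnorm x : R := nrm (fun x y : H => inner x y) x.

Lemma hnorm_ge0 x : 0 <= hnorm x. Proof. exact: nrm_ge0. Qed.

Lemma innerE x : inner x x = (hnorm x ^+ 2)%:C%C.
Proof. exact: (psdE inner_psd). Qed.

Lemma normE x : `|x| = (hnorm x)%:C%C.
Proof.
have h : 0 <= (hnorm x)%:C%C by rewrite lecR hnorm_ge0.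
by apply/eqP; rewrite -(@eqrXn2 _ 2)// inner_norm innerE rmorphXn.
Qed.

Lemma hnorm_eq0 x : hnorm x = 0 -> x = 0.
Proof. by move=> x0; apply/eqP; rewrite -normr_eq0 normE x0. Qed.

Lemma hnormBC x y : hnorm (x - y) = hnorm (y - x).
Proof. by apply: complexI; rewrite -!normE distrC. Qed.

Lemma innerC x y : inner y x = (inner x y)^*.
Proof. exact: (psd_herm inner_psd). Qed.

Lemma innerBl x y z : inner (x - y) z = inner x z - inner y z.
Proof. exact: (psdBl inner_psd). Qed.

Lemma innerPl a x y z : inner (a *: x + y) z = a * inner x z + inner y z.
Proof. exact: (psd_linl inner_psd). Qed.

Lemma innerPr a x y z : inner z (a *: x + y) = a^* * inner z x + inner z y.
Proof. by rewrite (psdDr inner_psd)// (psdZr inner_psd). Qed.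

Lemma inner0l z : inner (0 : H) z = 0.
Proof. exact: (psd_0l inner_psd). Qed.

Lemma eq_inner x y : (forall z, inner x z = inner y z) -> x = y.
Proof.
move=> h; apply/eqP; rewrite -subr_eq0; apply/eqP/hnorm_eq0/eqP.
rewrite -sqrf_eq0; apply/eqP/complexI; rewrite -innerE.
by rewrite innerBl h subrr.
Qed.

Lemma hilbert_cauchy (u : nat -> H) : (forall e : R, 0 < e ->
    exists N, forall k l, (N <= k)%N -> (N <= l)%N -> hnorm (u k - u l) <= e) ->
  exists a, forall e : R, 0 < e ->
    exists N, forall k, (N <= k)%N -> hnorm (u k - a) <= e.
Proof.
move=> h.
have pos (e : C) : 0 < e -> 0 < complex.Re e /\ e = (complex.Re e)%:C%C.
  by move=> e0; have eE := ge0_Re (ltW e0); rewrite -ltcR -eE.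
have /cauchy_cvgP uc : cauchy (u @ \oo).
  apply: cauchy_exP => e /pos[e0 eE].
  have [N hN] := h _ (divr_gt0 e0 (ltr0n R 2)).
  exists (u N); exists N => // k /= Nk; rewrite -ball_normE/= normE eE ltcR.
  by rewrite (le_lt_trans (hN _ _ (leqnn N) Nk))// gtr_pMr// invf_lt1 ?ltr1n.
exists (lim (u @ \oo)) => e e0.
have e0' : 0 < e%:C%C by rewrite ltcR.
have [N _ hN] := (@cvgrPdist_le _ H _ _ _ _ _).1 uc _ e0'.
exists N => k Nk; rewrite hnormBC -lecR -normE; exact: hN.
Qed.

(** Continuity of a linear map is boundedness, with a real constant. *)
Lemma bounded_operatorP T : bounded_operator T <->
  linear T /\ exists2 c : R, 0 < c & forall x, hnorm (T x) <= c * hnorm x.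
Proof.
split=> -[linT hT]; split=> //;
  pose a := GRing.isLinear.Build C H H _ T linT;
  pose G : {linear H -> H} := HB.pack T a.
  have := (linear_bounded_continuous G).2 hT.
  move=> /linear_boundedP/pinfty_ex_gt0[c c0 hc].
  have cE := ge0_Re (ltW c0).
  exists (complex.Re c); first by rewrite -ltcR -cE.
  by move=> x; rewrite -lecR rmorphM/= -cE -!normE; exact: hc.
apply: (linear_bounded_continuous G).1; apply/linear_boundedP.
case: hT => c c0 hc; exists c%:C%C; split.
  by apply: gtr0_real; rewrite ltcR.
move=> r cr x; rewrite (le_trans _ (ler_wpM2r (normr_ge0 x) (ltW cr)))//.
by rewrite !normE -rmorphM lecR; exact: hc.
Qed.

Lemma linear_opB (U W : lmodType C) (T : U -> W) (x y : U) : linear T -> T (x - y) = T x - T y.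
Proof. by move=> lT; rewrite -scaleN1r addrC lT scaleN1r addrC. Qed.

Lemma linear_opZ (U W : lmodType C) (T : U -> W) a (x : U) : linear T -> T (a *: x) = a *: T x.
Proof.
move=> lT; have T0 : T 0 = 0.
  by have := lT (-1) 0 0; rewrite scaler0 addr0 scaleN1r addNr.
by rewrite -[a *: x]addr0 lT T0 addr0.
Qed.

Lemma is_adjointC T S : is_adjoint T S -> is_adjoint S T.
Proof. by move=> h x y; rewrite innerC -h -innerC. Qed.

Lemma is_adjoint_uniq T S S' : is_adjoint T S -> is_adjoint T S' -> S = S'.
Proof.
move=> h h'; apply: funext => y; apply: eq_inner => z.
by rewrite (is_adjointC h) (is_adjointC h').
Qed.

Lemma adjointE T S : is_adjoint T S -> adjoint T = S.
Proof.
move=> h; apply: (is_adjoint_uniq _ h); rewrite /adjoint.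
by case: xgetP => [S' _//|/(_ S)/(_ h)].
Qed.

Lemma is_adjoint_comp T S T' S' :
  is_adjoint T S -> is_adjoint T' S' -> is_adjoint (T \o T') (S' \o S).
Proof. by move=> h h' x y /=; rewrite h h'. Qed.

Lemma is_adjoint_lin a T S T' S' : is_adjoint T S -> is_adjoint T' S' ->
  is_adjoint (a *: T + T') (a^* *: S + S').
Proof.
move=> h h' x y; rewrite ![(_ *: _ + _) _]/= innerPl innerPr.
by rewrite conjCK h h'.
Qed.

Lemma is_adjoint_id : is_adjoint (@idfun H) idfun. Proof. by []. Qed.

End HilbertSpace.

Section SquareSummable.
Variables (R : realType) (H : hilbertType R).
Local Notation C := R[i]%C.
Local Notation V := (nat -> H).
Implicit Types (x y z : V).

(** Square summability by bounded partial sums, so that comparison arguments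
    need no limit. *)
Definition sqsum x : Prop :=
  exists K : R, forall n, \sum_(0 <= k < n) hnorm (x k) ^+ 2 <= K.

Definition l2inner x y : C :=
  limn (series (fun k => inner (x k) (y k) : C^o)).

Let block m n x y : C := \sum_(m <= k < n) inner (x k) (y k).

Let block_psd m n : psd setT (block m n).
Proof.
split=> //.
- move=> a x y z _ _ _; rewrite /block mulr_sumr -big_split/=.
  by apply: eq_bigr => k _; rewrite -innerPl.
- move=> x y _ _; rewrite /block rmorph_sum/=.
  by apply: eq_bigr => k _; rewrite innerC.
- by move=> x _; apply: sumr_ge0 => k _; rewrite innerE lecR sqr_ge0.
Qed.

Let block_nrm m n x :
  nrm (block m n) x ^+ 2 = \sum_(m <= k < n) hnorm (x k) ^+ 2.
Proof.
apply: complexI; rewrite -(psdE (block_psd m n) I) /block rmorph_sum/=.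
by apply: eq_bigr => k _; rewrite innerE.
Qed.

Lemma sum_sqr_ge0 m n x : 0 <= \sum_(m <= k < n) hnorm (x k) ^+ 2.
Proof. by apply: sumr_ge0 => k _; rewrite sqr_ge0. Qed.

Lemma sum_inner_cs m n x y (a b : R) : 0 <= a -> 0 <= b ->
  \sum_(m <= k < n) hnorm (x k) ^+ 2 <= a ^+ 2 ->
  \sum_(m <= k < n) hnorm (y k) ^+ 2 <= b ^+ 2 ->
  cabs (\sum_(m <= k < n) inner (x k) (y k)) <= a * b.
Proof.
move=> a0 b0; rewrite -!block_nrm ler_pXn2r ?nnegrE ?nrm_ge0// => xa.
rewrite ler_pXn2r ?nnegrE ?nrm_ge0// => yb.
apply: le_trans (cauchy_schwarz (block_psd m n) I I) _.
by apply: ler_pM => //; exact: nrm_ge0.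
Qed.

Lemma sqsum_tail x : sqsum x -> forall e : R, 0 < e -> exists N, forall m n,
  (N <= m)%N -> \sum_(m <= k < n) hnorm (x k) ^+ 2 <= e.
Proof.
move=> [K hK] e e0; pose s n := \sum_(0 <= k < n) hnorm (x k) ^+ 2.
have supS : has_sup (range s).
  by split; [exists (s 0), 0|exists K => _ [n _ <-]; exact: hK].
have [_ [N _ <-] hN] := sup_adherent e0 supS.
exists N => m n Nm; have [mn|nm] := leqP m n; last first.
  by rewrite big_geq ?(ltW e0)// ltnW.
have snm : s n = s N + \sum_(N <= k < m) hnorm (x k) ^+ 2
    + \sum_(m <= k < n) hnorm (x k) ^+ 2.
  by rewrite /s -!big_cat_nat// (leq_trans Nm).
have : s n <= sup (range s) by apply: ub_le_sup; [exact: supS.2|exists n].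
rewrite snm; have := sum_sqr_ge0 N m x; lra.
Qed.

Lemma sqsum_bound x : sqsum x -> exists2 K : R, 0 < K &
  forall n, \sum_(0 <= k < n) hnorm (x k) ^+ 2 <= K ^+ 2.
Proof.
move=> [K hK]; exists (Num.sqrt (`|K| + 1)).
  by rewrite sqrtr_gt0 ltr_wpDl.
move=> n; rewrite sqr_sqrtr ?addr_ge0//; apply: le_trans (hK n) _.
by apply: le_trans (ler_norm K) _; rewrite lerDl.
Qed.

Lemma l2inner_cvg x y : sqsum x -> sqsum y ->
  series (fun k => inner (x k) (y k) : C^o) @ \oo --> (l2inner x y : C^o).
Proof.
move=> sx sy; have [K K0 hK] := sqsum_bound sy.
have [l hl] : exists l, forall e : R, 0 < e ->
    exists N, forall n, (N <= n)%N -> cabs (block 0 n x y - l) <= e.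
  apply: complex_cauchy => e e0.
  have eK0 : 0 < e / K by rewrite divr_gt0.
  have [N hN] := sqsum_tail sx (exprn_gt0 2 eK0).
  have wlog_ k l : (N <= l)%N -> (l <= k)%N ->
      cabs (block 0 k x y - block 0 l x y) <= e.
    move=> Nl lk; rewrite /block (big_cat_nat _ (n := l))//= [X in X - _]addrC addrK.
    rewrite -[leRHS](divfK (lt0r_neq0 K0)).
    apply: sum_inner_cs; rewrite ?(ltW K0) ?(ltW eK0) ?hN//.
    apply: le_trans (hK k); rewrite [leRHS](big_cat_nat _ (n := l))//=.
    by rewrite lerDr sum_sqr_ge0.
  exists N => k l Nk Nl; have [/wlog_|/ltnW/wlog_] := leqP l k; first exact.
  by move=> /(_ Nk); rewrite cabsB.
have c : series (fun k => inner (x k) (y k) : C^o) @ \oo --> (l : C^o).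
  exact: cvg_cabs hl.
by rewrite /l2inner (cvg_lim _ c).
Qed.

Lemma l2inner_eps x y : sqsum x -> sqsum y -> forall e : R, 0 < e ->
  exists N, forall n, (N <= n)%N ->
    cabs (\sum_(0 <= k < n) inner (x k) (y k) - l2inner x y) <= e.
Proof. by move=> sx sy; apply: cabs_cvg; exact: l2inner_cvg. Qed.

Lemma l2inner_cvgE x y (l : C^o) :
  series (fun k => inner (x k) (y k) : C^o) @ \oo --> l -> l2inner x y = l.
Proof. by move=> h; rewrite /l2inner (cvg_lim _ h). Qed.

Let l2inner_seriesP (a : C) x y z :
  series (fun k => inner ((a *: x + y) k) (z k) : C^o) =
     (a \*: series (fun k => inner (x k) (z k) : C^o)) +
               series (fun k => inner (y k) (z k) : C^o).
Proof.
apply: funext => n; rewrite fctE /series/= scaler_sumr -big_split/=.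
by apply: eq_bigr => k _; rewrite -innerPl.
Qed.

Lemma l2inner_lim x y l : sqsum x -> sqsum y -> (forall e : R, 0 < e ->
  exists N, forall n, (N <= n)%N ->
    cabs (\sum_(0 <= k < n) inner (x k) (y k) - l) <= e) -> l2inner x y = l.
Proof.
move=> sx sy hl; apply: (cvg_lim (T := C^o)) => //; exact: cvg_cabs hl.
Qed.

Lemma l2inner_le x y (a b : R) : 0 <= a -> 0 <= b -> sqsum x -> sqsum y ->
  (forall n, \sum_(0 <= k < n) hnorm (x k) ^+ 2 <= a ^+ 2) ->
  (forall n, \sum_(0 <= k < n) hnorm (y k) ^+ 2 <= b ^+ 2) ->
  cabs (l2inner x y) <= a * b.
Proof.
move=> a0 b0 sx sy ha hb; apply/ler_addgt0Pr => e e0.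
have [N hN] := l2inner_eps sx sy e0.
have := hN _ (leqnn N); have := sum_inner_cs a0 b0 (ha N) (hb N).
have := cabsD (l2inner x y - \sum_(0 <= k < N) inner (x k) (y k))
  (\sum_(0 <= k < N) inner (x k) (y k)).
rewrite subrK cabsB; lra.
Qed.

Lemma sqsum_closed (a : C) x y : sqsum x -> sqsum y -> sqsum (a *: x + y).
Proof.
move=> /sqsum_bound[K K0 hK] /sqsum_bound[L L0 hL].
exists ((cabs a * K + L) ^+ 2) => n; rewrite -block_nrm.
have b0 := block_psd 0 n.
rewrite ler_pXn2r ?nnegrE ?nrm_ge0 ?addr_ge0 ?mulr_ge0 ?cabs_ge0 ?(ltW K0) ?(ltW L0)//.
apply: le_trans (nrmD b0 I I) _; rewrite (nrmZ b0)// lerD//.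
  apply: ler_wpM2l; first exact: cabs_ge0.
  by rewrite -(@ler_pXn2r _ 2)// ?nnegrE ?nrm_ge0 ?(ltW K0)// block_nrm.
by rewrite -(@ler_pXn2r _ 2)// ?nnegrE ?nrm_ge0 ?(ltW L0)// block_nrm.
Qed.

Lemma sqsum0 : sqsum 0.
Proof.
exists 0 => n; rewrite big1// => k _.
by apply: complexI; rewrite -innerE inner0l.
Qed.

Lemma l2_psd : psd sqsum l2inner.
Proof.
have hermP x y : sqsum x -> sqsum y -> l2inner y x = (l2inner x y)^*.
  move=> sx sy; apply: l2inner_lim => // e /(l2inner_eps sx sy)[N hN].
  exists N => n /hN; rewrite -cabs_conj rmorphB/= rmorph_sum/=.
  by under eq_bigr do rewrite -innerC.
split=> //.
- exact: sqsum0.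
- exact: sqsum_closed.
- move=> a x y z sx sy sz.
  have c1 := l2inner_cvg sx sz; have c2 := l2inner_cvg sy sz.
  apply: l2inner_cvgE; rewrite (l2inner_seriesP a x y z).
  have c3 : (a \*: series (fun k => inner (x k) (z k) : C^o)) @ \oo -->
      (a *: (l2inner x z : C^o)) by exact: cvgZl_tmp c1.
  exact: (cvgD c3 c2).
- move=> x sx; have lR := hermP _ _ sx sx.
  have Im0 : complex.Im (l2inner x x) = 0.
    by move: lR; case: (l2inner x x) => u v /= [] /eqP; rewrite -addr_eq0 => /eqP; lra.
  have lE : l2inner x x = (complex.Re (l2inner x x))%:C%C.
    by move: Im0; case: (l2inner x x) => u v /= ->.
  rewrite lE lecR leNgt; apply/negP => l0.
  have [N /(_ _ (leqnn N))] := l2inner_eps sx sx (e := - complex.Re (l2inner x x) / 2)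
    ltac:(lra).
  move=> /(le_trans (Re_le_cabs _)); rewrite ReD ReN => h.
  have s0 : 0 <= complex.Re (\sum_(0 <= k < N) inner (x k) (x k)).
    by apply: ge0_ReP; apply: (psd_ge0 (block_psd 0 N)).
  have := ler_norm (complex.Re (\sum_(0 <= k < N) inner (x k) (x k))
    - complex.Re (l2inner x x)); lra.
Qed.

Definition l2norm : V -> R := nrm l2inner.

Lemma sum_le_l2norm x n : sqsum x ->
  \sum_(0 <= k < n) hnorm (x k) ^+ 2 <= l2norm x ^+ 2.
Proof.
move=> sx; apply/ler_addgt0Pr => e e0.
have [N hN] := l2inner_eps sx sx e0.
have := hN _ (leq_maxl N n); rewrite (psdE l2_psd sx) -/(l2norm x).
have -> : \sum_(0 <= k < maxn N n) inner (x k) (x k) =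
    (\sum_(0 <= k < maxn N n) hnorm (x k) ^+ 2)%:C%C.
  by rewrite -block_nrm -(psdE (block_psd _ _) I).
rewrite -rmorphB cabs_real => /(le_trans (ler_norm _)).
rewrite (big_cat_nat _ (n := n)) ?leq_maxr//=.
have := sum_sqr_ge0 n (maxn N n) x; lra.
Qed.

Lemma l2norm_le x (a : R) : 0 <= a -> sqsum x ->
  (forall n, \sum_(0 <= k < n) hnorm (x k) ^+ 2 <= a ^+ 2) -> l2norm x <= a.
Proof.
move=> a0 sx ha; have := l2inner_le a0 a0 sx sx ha ha.
rewrite (psdE l2_psd sx) -/(l2norm x) cabs_real ger0_norm ?sqr_ge0//.
by rewrite -expr2 ler_pXn2r ?nnegrE ?nrm_ge0.
Qed.

Lemma hnorm_le_l2norm x k : sqsum x -> hnorm (x k) <= l2norm x.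
Proof.
move=> sx; rewrite -(@ler_pXn2r _ 2)// ?nnegrE ?hnorm_ge0 ?nrm_ge0//.
apply: le_trans (sum_le_l2norm k.+1 sx); rewrite big_nat_recr//=.
by rewrite lerDr sum_sqr_ge0.
Qed.

Lemma l2norm_eq0 x : sqsum x -> l2norm x = 0 -> x = 0.
Proof.
move=> sx x0; apply: funext => k; apply: hnorm_eq0; apply/eqP.
by rewrite eq_le hnorm_ge0 andbT -x0; exact: hnorm_le_l2norm.
Qed.

(** Completeness of l^2(H): the limit is taken in each coordinate, and a partial
    sum over the first n coordinates is compared with a later term of the
    sequence, chosen depending on n. *)
Lemma l2_cauchy (u : nat -> V) : (forall m, sqsum (u m)) ->
  (forall e : R, 0 < e -> exists N, forall k l,
     (N <= k)%N -> (N <= l)%N -> l2norm (u k - u l) <= e) ->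
  exists x, sqsum x /\ forall e : R, 0 < e ->
    exists N, forall k, (N <= k)%N -> l2norm (u k - x) <= e.
Proof.
move=> su uc.
have suB k l : sqsum (u k - u l) by apply: (psdB l2_psd).
have /choice[x hx] j : exists a, forall e : R, 0 < e ->
    exists N, forall k, (N <= k)%N -> hnorm (u k j - a) <= e.
  apply: hilbert_cauchy => e /uc[N hN]; exists N => k l Nk Nl.
  exact: le_trans (hnorm_le_l2norm j (suB k l)) (hN _ _ Nk Nl).
have tail (e : R) : 0 < e -> exists N, forall k, (N <= k)%N ->
    forall n, \sum_(0 <= j < n) hnorm ((u k - x) j) ^+ 2 <= e ^+ 2.
  move=> e0; have [N hN] := uc _ (divr_gt0 e0 (ltr0n R 2)).
  exists N => k Nk n.
  pose d := e / 2 / n.+1%:R.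
  have d0 : 0 < d by rewrite !divr_gt0.
  have /choice[Nf hNf] j := hx j _ d0.
  pose m := maxn N (\max_(j < n) Nf j).
  have hm : \sum_(0 <= j < n) hnorm ((u m - x) j) ^+ 2 <= (e / 2) ^+ 2.
    have -> : e / 2 = n.+1%:R * d by rewrite /d [RHS]mulrC divfK// pnatr_eq0.
    apply: (@le_trans _ _ (\sum_(0 <= j < n) d ^+ 2)).
      rewrite !big_mkord; apply: ler_sum => j _.
      rewrite ler_pXn2r ?nnegrE ?hnorm_ge0 ?(ltW d0)//; apply: hNf.
      by rewrite leq_max (leq_bigmax j) orbT.
    rewrite big_mkord sumr_const card_ord -[d ^+ 2 *+ n]mulr_natl [leRHS]exprMn.
    apply: ler_wpM2r; first exact: sqr_ge0.
    by rewrite -natrX ler_nat (leq_trans (leqnSn n))// expnS leq_pmulr.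
  have hk : \sum_(0 <= j < n) hnorm ((u k - u m) j) ^+ 2 <= (e / 2) ^+ 2.
    apply: le_trans (sum_le_l2norm n (suB k m)) _.
    rewrite ler_pXn2r ?nnegrE ?nrm_ge0 ?divr_ge0 ?(ltW e0)//.
    by apply: hN => //; exact: leq_maxl.
  have e20 : 0 <= e / 2 by rewrite divr_ge0// ltW.
  have b0 := block_psd 0 n.
  have -> : u k - x = (u k - u m) + (u m - x) by rewrite addrA subrK.
  move: hm hk; rewrite -!block_nrm !ler_pXn2r ?nnegrE ?nrm_ge0 ?(ltW e0)// => hm hk.
  by rewrite [e]splitr (le_trans (nrmD b0 I I))// addrC lerD.
have sx : sqsum x.
  have [N hN] := tail 1 ltr01.
  have -> : x = u N - (u N - x) by rewrite opprB addrC subrK.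
  apply: (psdB l2_psd) => //.
  by exists (1 ^+ 2) => n; exact: hN.
exists x; split=> // e e0; have [N hN] := tail _ e0.
exists N => k Nk; apply: l2norm_le; rewrite ?(ltW e0)//; last exact: hN.
exact: (psdB l2_psd).
Qed.

End SquareSummable.

(** * Projections in the space of square-summable families *)

Section Amplification.
Variables (R : realType) (H : hilbertType R).
Local Notation C := R[i]%C.
Local Notation V := (nat -> H).
Implicit Types (x y z p q : V) (T S : H -> H).
Local Notation l2P := (@l2_psd R H).

Definition amp T x : V := fun k => T (x k).

Lemma amp_linear T : linear T -> linear (amp T).
Proof. by move=> lT a x y; apply: funext => k; exact: lT. Qed.

Lemma amp_block T (c : R) x : (forall h, hnorm (T h) <= c * hnorm h) ->
  forall n, \sum_(0 <= k < n) hnorm (amp T x k) ^+ 2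
    <= c ^+ 2 * \sum_(0 <= k < n) hnorm (x k) ^+ 2.
Proof.
move=> hT n; rewrite mulr_sumr; apply: ler_sum => k _; rewrite -exprMn.
have c0 := le_trans (hnorm_ge0 _) (hT (x k)).
by rewrite ler_pXn2r ?nnegrE ?hnorm_ge0// hT.
Qed.

Lemma amp_sqsum T x : bounded_operator T -> sqsum x -> sqsum (amp T x).
Proof.
move=> /bounded_operatorP[_ [c c0 hT]] [K hK].
exists (c ^+ 2 * K) => n; apply: le_trans (amp_block x hT n) _.
by rewrite ler_wpM2l ?sqr_ge0.
Qed.

Lemma amp_bound T (c : R) x : bounded_operator T -> 0 <= c ->
  (forall h, hnorm (T h) <= c * hnorm h) -> sqsum x ->
  l2norm (amp T x) <= c * l2norm x.
Proof.
move=> bT c0 hT sx; apply: l2norm_le; first by rewrite mulr_ge0 ?nrm_ge0.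
  exact: amp_sqsum.
move=> n; apply: le_trans (amp_block x hT n) _; rewrite exprMn.
by rewrite ler_wpM2l ?sqr_ge0// sum_le_l2norm.
Qed.

Lemma amp_adjoint T S x y : is_adjoint T S ->
  l2inner (amp T x) y = l2inner x (amp S y).
Proof.
move=> h; rewrite /l2inner; under eq_fun do rewrite h.
by [].

Qed.

Definition single j (h : H) : V := fun k => if k == j then h else 0.

Lemma sum_single j h n (F : nat -> H -> C) : (forall k, F k 0 = 0) ->
  (j < n)%N -> \sum_(0 <= k < n) F k (single j h k) = F j h.
Proof.
move=> F0 jn; rewrite big_mkord (bigD1 (Ordinal jn))//= big1 ?addr0.
  by rewrite /single eqxx.
by move=> k; rewrite -val_eqE /single/= => /negPf ->.
Qed.

Lemma single_sqsum j h : sqsum (single j h).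
Proof.
exists (hnorm h ^+ 2) => n; rewrite -lecR rmorph_sum/=.
under eq_bigr do rewrite -innerE.
have [jn|nj] := ltnP j n.
  rewrite (@sum_single j h n (fun k v => inner v v))//; last first.
    by move=> _; exact: inner0l.
  by rewrite innerE.
rewrite big_mkord big1 ?lecR ?sqr_ge0// => k _.
rewrite /single ltn_eqF ?inner0l//; exact: leq_trans (ltn_ord k) nj.
Qed.

Lemma l2inner_single x j h : sqsum x -> l2inner x (single j h) = inner (x j) h.
Proof.
move=> sx; apply: l2inner_lim => //; first exact: single_sqsum.
move=> e e0; exists j.+1 => n jn.
rewrite (@sum_single j h n (fun k v => inner (x k) v))//.
  by rewrite subrr cabs0 ltW.
by move=> k; rewrite innerC inner0l rmorph0.
Qed.

Lemma single_nrm j h : l2norm (single j h) = hnorm h.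
Proof.
rewrite /l2norm /nrm l2inner_single; last exact: single_sqsum.
by rewrite /single eqxx innerE sqrtr_sqr ger0_norm// hnorm_ge0.
Qed.

Lemma single_linear j : linear (single j).
Proof.
move=> a h g; apply: funext => k.
transitivity (a *: single j h k + single j g k); last by [].
by rewrite /single; case: eqP => // _; rewrite scaler0 addr0.
Qed.

Section Projection.
Variable E : set V.
Hypotheses (E_l2 : E `<=` sqsum (H := H)) (E_0 : E 0)
  (E_lin : forall a x y, E x -> E y -> E (a *: x + y)).

Definition adherent x := forall e : R, 0 < e ->
  exists2 q, E q & l2norm (x - q) <= e.

Definition projects x p := [/\ sqsum p, adherent p &
  forall q, E q -> l2inner q (x - p) = 0].

Let E_psd : psd E (l2inner (H := H)).
Proof.
split=> //.
- by move=> a x y z /E_l2 sx /E_l2 sy /E_l2 sz; apply: (psd_linl l2P).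
- by move=> x y /E_l2 sx /E_l2 sy; apply: (psd_herm l2P).
- by move=> x /E_l2 sx; apply: (psd_ge0 l2P).
Qed.

(** Near-representatives of q |-> <q, x> on [E] form a Cauchy sequence. *)
Lemma projection_exists x : sqsum x -> exists p, projects x p.
Proof.
move=> sx; have lin a q q' : E q -> E q' ->
    l2inner (a *: q + q') x = a * l2inner q x + l2inner q' x.
  by move=> /E_l2 sq /E_l2 sq'; rewrite (psd_linl l2P).
have bnd q : E q -> cabs (l2inner q x) <= l2norm x * l2norm q.
  by move=> /E_l2 sq; rewrite mulrC (cauchy_schwarz l2P).
have /choice[u hu] m : exists p, E p /\ forall q, E q ->
    cabs (l2inner q x - l2inner q p) <= m.+1%:R^-1 * l2norm q.
  by apply: (near_riesz E_psd (nrm_ge0 _ _) lin bnd); rewrite invr_gt0.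
have Eu m := (hu m).1; have su m := E_l2 (Eu m).
have inv_small (e : R) : 0 < e -> exists N, forall m, (N <= m)%N -> m.+1%:R^-1 <= e.
  move=> e0; exists (Num.bound e^-1) => m Nm.
  rewrite -[e]invrK lef_pV2 ?posrE ?invr_gt0//.
  apply: ltW; apply: lt_le_trans (archi_boundP _) _; first by rewrite invr_ge0 ltW.
  by rewrite ler_nat (leq_trans Nm).
have uu k l : l2norm (u k - u l) <= k.+1%:R^-1 + l.+1%:R^-1.
  apply: (nrm_le_eps E_psd) => [q Eq||]; last by rewrite addr_ge0.
    have sq := E_l2 Eq.
    rewrite (psdBr l2P)// mulrDl.
    have := (hu l).2 q Eq; have := (hu k).2 q Eq.
    have := cabsD (l2inner q (u k) - l2inner q x) (l2inner q x - l2inner q (u l)).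
    rewrite subrKA [cabs (_ - l2inner q x)]cabsB => h1 h2 h3.
    exact: le_trans h1 (lerD h2 h3).
  by apply: (psdB E_psd).
have [p [sp up]] : exists p, sqsum p /\ forall e : R, 0 < e ->
    exists N, forall k, (N <= k)%N -> l2norm (u k - p) <= e.
  apply: l2_cauchy => // e e0.
  have [N hN] := inv_small _ (divr_gt0 e0 (ltr0n R 2)).
  exists N => k l /hN Nk /hN Nl; rewrite (le_trans (uu k l))// [e]splitr.
  exact: lerD.
have lBC (a b : V) : sqsum a -> sqsum b -> l2norm (a - b) = l2norm (b - a).
  move=> sa sb; rewrite -opprB -scaleN1r /l2norm (nrmZ l2P) ?cabsN ?cabs1 ?mul1r//.
  exact: (psdB l2P).
exists p; split=> // [e /up[N /(_ _ (leqnn N)) hN]|q Eq].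
  by exists (u N) => //; rewrite lBC.
have sq := E_l2 Eq.
apply: cabs_le_eps => e e0.
have d0 : 0 < e / 2 / (l2norm q + 1).
  by rewrite !divr_gt0// ltr_wpDl// nrm_ge0.
have [N1 h1] := inv_small _ d0; have [N2 h2] := up _ d0.
have n1 := h1 _ (leq_maxl N1 N2); have n2 := h2 _ (leq_maxr N1 N2).
set m := maxn N1 N2 in n1 n2.
rewrite (psdBr l2P)//.
have c1 := (hu m).2 q Eq.
have c2 := cauchy_schwarz l2P sq (psdB l2P (su m) sp).
rewrite (psdBr l2P)// in c2.
have := cabsD (l2inner q x - l2inner q (u m)) (l2inner q (u m) - l2inner q p).
rewrite subrKA => c3.
have q0 : 0 <= l2norm q by exact: nrm_ge0.
have eE : e / 2 / (l2norm q + 1) * (l2norm q + 1) = e / 2.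
  by rewrite divfK// gt_eqF// ltr_wpDl.
have c4 : m.+1%:R^-1 * l2norm q <= e / 2 / (l2norm q + 1) * l2norm q.
  exact: ler_wpM2r.
have c5 : l2norm q * l2norm (u m - p) <= l2norm q * (e / 2 / (l2norm q + 1)).
  exact: ler_wpM2l.
apply: le_trans c3 (le_trans (lerD (le_trans c1 c4) (le_trans c2 c5)) _).
move: q0 d0 eE; set d := e / 2 / _; move: d (l2norm q) => d t t0 d0 dE; nra.
Qed.

Lemma adherent_orth r : sqsum r -> adherent r ->
  forall s, sqsum s -> (forall q, E q -> l2inner q s = 0) -> l2inner r s = 0.
Proof.
move=> sr ar s ss os; apply: cabs_le_eps => e e0.
have d0 : 0 < e / (l2norm s + 1) by rewrite divr_gt0// ltr_wpDl// nrm_ge0.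
have [q Eq hq] := ar _ d0; have sq := E_l2 Eq.
have -> : l2inner r s = l2inner (r - q) s by rewrite (psdBl l2P)// (os q Eq) subr0.
apply: le_trans (cauchy_schwarz l2P (psdB l2P sr sq) ss) _.
rewrite -[leRHS](divfK (x := l2norm s + 1)); last first.
  by rewrite gt_eqF// ltr_wpDl// nrm_ge0.
by apply: ler_pM; rewrite ?nrm_ge0// lerDl.
Qed.

Lemma projects_linear a x y p q : sqsum x -> sqsum y ->
  projects x p -> projects y q -> projects (a *: x + y) (a *: p + q).
Proof.
move=> sx sy [sp ap op] [sq aq oq]; split; first exact: sqsum_closed.
  move=> e e0.
  have d0 : 0 < e / 2 / (cabs a + 1) by rewrite !divr_gt0// ltr_wpDl// cabs_ge0.
  have [p' Ep' hp'] := ap _ d0; have [q' Eq' hq'] := aq _ (divr_gt0 e0 (ltr0n R 2)).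
  have sp' := E_l2 Ep'; have sq' := E_l2 Eq'.
  exists (a *: p' + q'); first exact: E_lin.
  have -> : a *: p + q - (a *: p' + q') = a *: (p - p') + (q - q').
    by rewrite scalerBr opprD addrACA.
  apply: le_trans (nrmD l2P (psdZ l2P _ (psdB l2P sp sp')) (psdB l2P sq sq')) _.
  rewrite (nrmZ l2P)//; last exact: (psdB l2P).
  rewrite [e]splitr lerD//.
  have -> : e / 2 = (cabs a + 1) * (e / 2 / (cabs a + 1)).
    by rewrite [RHS]mulrC divfK// gt_eqF// ltr_wpDl// cabs_ge0.
  by apply: ler_pM; rewrite ?nrm_ge0 ?cabs_ge0// lerDl.
move=> r Er; have sr := E_l2 Er.
have -> : a *: x + y - (a *: p + q) = a *: (x - p) + (y - q).
  by rewrite scalerBr opprD addrACA.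
have sxp := psdB l2P sx sp; have syq := psdB l2P sy sq.
by rewrite (psdDr l2P) ?(psdZr l2P) ?op ?oq ?mulr0 ?addr0//; exact: (psdZ l2P).
Qed.

Lemma projects_uniq x p q : sqsum x -> projects x p -> projects x q -> p = q.
Proof.
move=> sx hp hq.
have := projects_linear (-1) sx sx hq hp.
rewrite !scaleN1r addNr [_ + p]addrC => -[sr ar or'].
apply/eqP; rewrite -subr_eq0; apply/eqP/l2norm_eq0 => //.
apply/eqP; rewrite -sqrf_eq0; apply/eqP/complexI; rewrite -(psdE l2P sr).
have : l2inner (p - q) (0 - (p - q)) = 0.
  by apply: adherent_orth => //; apply: (psdB l2P) => //; exact: sqsum0.
have s0 := sqsum0 H.
by rewrite (psdBr l2P)// [l2inner _ 0](psd_herm l2P s0 sr) (psd_0l l2P)// rmorph0 sub0r => /eqP; rewrite oppr_eq0 => /eqP.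
Qed.

Definition proj x : V := xget 0 [set p | projects x p].

Lemma projP x : sqsum x -> projects x (proj x).
Proof.
move=> /projection_exists[p hp]; rewrite /proj.
by case: xgetP => [q _ //|/(_ p)/(_ hp)].
Qed.

Lemma projE x p : sqsum x -> projects x p -> proj x = p.
Proof. by move=> sx; exact: projects_uniq (projP sx). Qed.

Lemma proj_sqsum x : sqsum x -> sqsum (proj x).
Proof. by move=> /projP[]. Qed.

Lemma proj_linear a x y : sqsum x -> sqsum y ->
  proj (a *: x + y) = a *: proj x + proj y.
Proof.
move=> sx sy; apply: projE; first exact: sqsum_closed.
by apply: projects_linear => //; exact: projP.
Qed.

Lemma proj_idem x y : sqsum x -> sqsum y ->
  l2inner (proj x) (proj y) = l2inner (proj x) y.
Proof.
move=> sx sy; have [spx apx _] := projP sx; have [spy apy opy] := projP sy.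
apply/eqP; rewrite eq_sym -subr_eq0 -(psdBr l2P)//; apply/eqP.
by apply: adherent_orth => //; exact: (psdB l2P).
Qed.

Lemma proj_sym x y : sqsum x -> sqsum y ->
  l2inner (proj x) y = l2inner x (proj y).
Proof.
move=> sx sy; rewrite -(proj_idem sx sy).
have spx := proj_sqsum sx; have spy := proj_sqsum sy.
by rewrite (psd_herm l2P spy spx) (proj_idem sy sx) -(psd_herm l2P spy sx).
Qed.

Lemma proj_le x : sqsum x -> l2norm (proj x) <= l2norm x.
Proof.
move=> sx; have spx := proj_sqsum sx.
have := cauchy_schwarz l2P spx sx.
rewrite -(proj_idem sx sx) (psdE l2P spx) cabs_real ger0_norm ?sqr_ge0//.
rewrite expr2 -/(l2norm _) -/(l2norm x).
have := nrm_ge0 (l2inner (H:=H)) (proj x).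
rewrite -/(l2norm _) le_eqVlt => /predU1P[<- _|p0]; first exact: nrm_ge0.
by rewrite ler_pM2l.
Qed.

Lemma proj_fix x : E x -> proj x = x.
Proof.
move=> Ex; have sx := E_l2 Ex; apply: projE => //; split=> //.
  move=> e e0; exists x => //; rewrite subrr /l2norm /nrm (psd_0l l2P (sqsum0 H)).
  by rewrite sqrtr0 ltW.
move=> q Eq; have sq := E_l2 Eq; rewrite subrr (psd_herm l2P (sqsum0 H) sq).
by rewrite (psd_0l l2P)// rmorph0.
Qed.

Lemma proj_amp T S x : bounded_operator T -> bounded_operator S ->
    is_adjoint T S -> (forall q, E q -> E (amp T q)) ->
    (forall q, E q -> E (amp S q)) -> sqsum x ->
  proj (amp T x) = amp T (proj x).
Proof.
move=> bT bS TS ET ES sx; have [lT [c c0 hT]] := (bounded_operatorP T).1 bT.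
have [sp ap op] := projP sx.
have ampB u v : amp T (u - v) = amp T u - amp T v.
  by apply: linear_opB; exact: amp_linear.
apply: projE; first exact: amp_sqsum.
split; first exact: amp_sqsum.
  move=> e e0; have [q Eq hq] := ap _ (divr_gt0 e0 c0).
  exists (amp T q); first exact: ET.
  rewrite -ampB (le_trans (amp_bound bT (ltW c0) hT _))//.
    by apply: (psdB l2P) => //; exact: E_l2.
  by rewrite mulrC -ler_pdivlMr.
by move=> q Eq; rewrite -ampB -(amp_adjoint _ _ (is_adjointC TS)) op//; exact: ES.
Qed.

(** The entries of the projection as an infinite matrix of operators on [H]. *)
Definition proj_entry i j (h : H) : H := proj (single j h) i.

Lemma proj_entry_adjoint i j :
  is_adjoint (proj_entry i j) (proj_entry j i).
Proof.
move=> h g; have ss := single_sqsum.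
rewrite -(l2inner_single i g (proj_sqsum (ss j h))) proj_sym//.
rewrite (psd_herm l2P (proj_sqsum (ss i g)) (ss j h)) l2inner_single.
  by rewrite -innerC.
exact: proj_sqsum.
Qed.

Lemma proj_entry_bounded i j : bounded_operator (proj_entry i j).
Proof.
have ss := single_sqsum; apply/bounded_operatorP; split.
  by move=> a h g; rewrite /proj_entry single_linear proj_linear.
exists 1 => // h; rewrite mul1r -(single_nrm j h).
apply: le_trans (hnorm_le_l2norm i (proj_sqsum (ss j h))) _.
exact: proj_le.
Qed.

Lemma proj_entry_comm i j T S : bounded_operator T -> bounded_operator S ->
    is_adjoint T S -> (forall q, E q -> E (amp T q)) ->
    (forall q, E q -> E (amp S q)) ->
  proj_entry i j \o T = T \o proj_entry i j.
Proof.
move=> bT bS TS ET ES; apply: funext => h; rewrite /proj_entry/=.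
have -> : single j (T h) = amp T (single j h).
  apply: funext => k; rewrite /single /amp; case: eqP => // _.
  by have /bounded_operatorP[/(linear_opB 0 0)] := bT; rewrite !subrr.
by rewrite (proj_amp bT bS)//; exact: single_sqsum.
Qed.

(** The commutation of [T] with the entries says that its amplification commutes
    with the projection onto the closure of [E], which thus fixes [amp T x]. The
    infinite matrix product is avoided by pairing with a vector supported in one
    coordinate and moving [T] to the other side. *)
Lemma bicommutant_adherent T S x : bounded_operator T -> bounded_operator S ->
    is_adjoint T S ->
    (forall i j, proj_entry i j \o T = T \o proj_entry i j) ->
  E x -> adherent (amp T x).
Proof.
move=> bT bS TS comT Ex; have sx := E_l2 Ex; have ss := single_sqsum.
have sTx := amp_sqsum bT sx.
have comS i j : S \o proj_entry i j = proj_entry i j \o S.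
  apply: (is_adjoint_uniq (is_adjoint_comp (proj_entry_adjoint j i) TS)).
  rewrite comT; apply: is_adjoint_comp => //; exact: proj_entry_adjoint.
suff <- : proj (amp T x) = amp T x by have [] := projP sTx.
apply: funext => i; apply: eq_inner => g.
rewrite -(l2inner_single i g (proj_sqsum sTx)) proj_sym//.
rewrite (amp_adjoint _ _ TS).
have -> : amp S (proj (single i g)) = proj (single i (S g)).
  by apply: funext => k; exact: (congr1 (@^~ g) (comS k i)).
by rewrite -proj_sym// proj_fix// l2inner_single// /amp TS.
Qed.

End Projection.
End Amplification.

(** * The weak and the ultraweak topologies *)

Section SpatialContinuity.
Variables (R : realType) (H : hilbertType R).
Local Notation C := R[i]%C.
Implicit Types (T S : H -> H) (M : set (H -> H)).
Local Notation l2P := (@l2_psd R H).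

Lemma initial_cvg (S0 : choiceType) (T0 : topologicalType) (f : S0 -> T0)
    (F : set_system S0) (s : S0) : Filter F ->
  f @ F --> f s -> F --> (s : initial_topology f).
Proof.
move=> FF h A [_ [[B Bop <-] Bfs sBfA]]; apply: filterS sBfA _.
by apply: h; apply: open_nbhs_nbhs.
Qed.

Lemma ptws_cvg (U : Type) (V : topologicalType) (F : set_system (U -> V))
    (f : U -> V) : Filter F ->
  (forall u, (fun g : U -> V => g u) @ F --> f u) -> F --> (f : {ptws U -> V}).
Proof.
move=> FF h; pose Tc i := Topological.class
  (initial_topology (fun g : prod_topology (fun _ : U => V) => g i)).
apply: (cvg_sup Tc f FF).2 => i.
exact: initial_cvg (h i).
Qed.

Lemma wot_continuous (x y : H) :
  continuous ((fun T : H -> H => inner (T x) y) : wot H -> C^o).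
Proof.
pose F : (H -> H) -> {ptws H * H -> C^o} := fun T p => inner (T p.1) p.2.
have c1 : continuous (F : wot H -> {ptws H * H -> C^o}).
  exact: initial_continuous.
have c2 := @proj_continuous (H * H)%type (fun _ => C^o) (x, y).
by move=> T; exact: (cvg_comp _ _ (c1 T) (c2 (F T))).
Qed.

(** The maps which define the ultraweak topology. *)
Definition ultraweak (p : l2_family * l2_family) T : C :=
  l2inner (amp T (sval p.1)) (sval p.2).

Lemma l2_family_sqsum (x : @l2_family R H) : sqsum (sval x).
Proof.
case: x => x /= /cabs_cvg/(_ 1 ltr01)[N hN].
set l := limn _ in hN; exists (1 + cabs l) => n.
have sE m : series (fun k => `|x k| ^+ 2 : C^o) m
    = (\sum_(0 <= k < m) hnorm (x k) ^+ 2)%:C%C.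
  rewrite /series/= rmorph_sum/=; apply: eq_bigr => k _.
  by rewrite normE rmorphXn.
have := hN _ (leq_maxl N n); rewrite sE => h.
have h2 := cabsD ((\sum_(0 <= k < maxn N n) hnorm (x k) ^+ 2)%:C%C - l) l.
rewrite subrK cabs_real in h2; have h3 := le_trans (ler_norm _) (le_trans h2 (lerD h (lexx (cabs l)))).
rewrite (big_cat_nat _ (n := n)) ?leq_maxr//= in h3.
by apply: le_trans h3; rewrite lerDl sum_sqr_ge0.
Qed.

Let seminbhs : set_system (H -> H) := fun A =>
  exists (s : seq (@l2_family R H * @l2_family R H)) (e : R), 0 < e /\
    forall T, \sum_(p <- s) cabs (ultraweak p T) <= e -> A T.

Let seminbhs_filter : Filter seminbhs.
Proof.
split; first by exists [::], 1.
- move=> A B [s [e [e0 hA]]] [t [d [d0 hB]]].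
  exists (s ++ t), (Num.min e d); rewrite lt_min e0 d0; split=> // T.
  rewrite big_cat/= le_min => /andP[h1 h2].
  have s0 r : 0 <= \sum_(p <- r) cabs (ultraweak p T).
    by apply: sumr_ge0 => p _; exact: cabs_ge0.
  split; [apply: hA|apply: hB].
    by apply: le_trans h1; rewrite lerDl.
  by apply: le_trans h2; rewrite lerDr.
- by move=> A B AB [s [e [e0 hA]]]; exists s, e; split=> // T /hA/AB.
Qed.

Lemma ultraweak0 p : ultraweak p (0 : H -> H) = 0.
Proof. exact: (psd_0l l2P (l2_family_sqsum p.2)). Qed.

(** The right hand side defines a filter, and convergence of a filter for an
    initial topology is tested on the defining maps. *)
Lemma uwt_nbhs0 (A : set (H -> H)) : nbhs ((0 : H -> H) : uwt H) A ->
  exists (s : seq (@l2_family R H * @l2_family R H)) (e : R), 0 < e /\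
    forall T, \sum_(p <- s) cabs (ultraweak p T) <= e -> A T.
Proof.
move=> nA; suff : seminbhs --> ((0 : H -> H) : uwt H) by move=> /(_ A nA).
apply: (initial_cvg seminbhs_filter).
apply: (@ptws_cvg _ C^o _ _ (fmap_filter _ seminbhs_filter)) => p.
apply/(@cvgrPdist_le _ C^o _ seminbhs seminbhs_filter (ultraweak p)) => e e0.
have eE := ge0_Re (ltW e0).
have e0' : 0 < complex.Re e by rewrite -ltcR -eE.
exists [:: p], (complex.Re e); split=> // T; rewrite big_seq1 => h.
have -> : limn (series (fun k => inner ((0 : H -> H) (sval p.1 k)) (sval p.2 k) : C^o)) = 0.
  exact: ultraweak0.
by rewrite sub0r normrN eE cabsE lecR.
Qed.

End SpatialContinuity.

Section Merging.
Variables (R : realType) (H : hilbertType R).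
Local Notation C := R[i]%C.
Implicit Types (T S : H -> H) (x y : nat -> H).
Local Notation l2P := (@l2_psd R H).

(** Interleaving turns the finitely many families of an ultraweak neighborhood
    into a single one. *)
Definition merge x y : nat -> H := fun k => if odd k then y k./2 else x k./2.

Lemma sum_merge x y n : \sum_(0 <= k < n.*2) hnorm (merge x y k) ^+ 2 =
  \sum_(0 <= k < n) hnorm (x k) ^+ 2 + \sum_(0 <= k < n) hnorm (y k) ^+ 2.
Proof.
elim: n => [|n ih]; first by rewrite !big_geq// addr0.
rewrite doubleS !big_nat_recr//= ih /merge /= odd_double/= uphalf_double doubleK.
by rewrite addrA -!addrA; congr (_ + _); rewrite addrCA addrA.
Qed.

Lemma merge_sqsum x y : sqsum x -> sqsum y -> sqsum (merge x y).
Proof.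
move=> [K hK] [L hL]; exists (K + L) => n.
apply: (@le_trans _ _ (\sum_(0 <= k < n.*2) hnorm (merge x y k) ^+ 2)).
  by rewrite [leRHS](big_cat_nat _ (n := n)) -?addnn ?leq_addr//= lerDl sum_sqr_ge0.
by rewrite sum_merge lerD.
Qed.

Lemma le_merge x y : sqsum x -> sqsum y ->
  l2norm x <= l2norm (merge x y) /\ l2norm y <= l2norm (merge x y).
Proof.
move=> sx sy; have sm := merge_sqsum sx sy.
have h n := sum_le_l2norm n.*2 sm.
have hx n := sum_sqr_ge0 0 n x; have hy n := sum_sqr_ge0 0 n y.
split; apply: l2norm_le => //; try exact: nrm_ge0.
  by move=> n; apply: le_trans (h n); rewrite sum_merge lerDl.
by move=> n; apply: le_trans (h n); rewrite sum_merge lerDr.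
Qed.

Lemma amp_merge T x y : amp T (merge x y) = merge (amp T x) (amp T y).
Proof. by apply: funext => k; rewrite /amp /merge; case: ifP. Qed.

Lemma ultraweak_bound (s : seq (@l2_family R H * @l2_family R H)) :
  exists2 x : nat -> H, sqsum x & forall S S', bounded_operator S' ->
    is_adjoint S S' -> exists2 Y : R, 0 <= Y & forall T, bounded_operator T ->
      \sum_(p <- s) cabs (ultraweak p (S \o T)) <= Y * l2norm (amp T x).
Proof.
elim: s => [|p s [x sx ih]].
  exists 0; first exact: sqsum0.
  by move=> S S' _ _; exists 0 => // T _; rewrite big_nil mul0r.
have sp1 := l2_family_sqsum p.1; have sp2 := l2_family_sqsum p.2.
exists (merge (sval p.1) x); first exact: merge_sqsum.
move=> S S' bS' SS'; have [Y Y0 hY] := ih S S' bS' SS'.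
exists (l2norm (amp S' (sval p.2)) + Y); first by rewrite addr_ge0 ?nrm_ge0.
move=> T bT; rewrite big_cons mulrDl amp_merge.
have [h1 h2] := le_merge (amp_sqsum bT sp1) (amp_sqsum bT sx).
apply: lerD; last first.
  by apply: le_trans (hY T bT) _; exact: ler_wpM2l.
have -> : ultraweak p (S \o T) = l2inner (amp T (sval p.1)) (amp S' (sval p.2)).
  exact: (amp_adjoint (amp T (sval p.1)) _ SS').
apply: le_trans (cauchy_schwarz l2P (amp_sqsum bT sp1) (amp_sqsum bS' sp2)) _.
by rewrite mulrC; apply: ler_wpM2l => //; exact: nrm_ge0.
Qed.

Lemma ultraweakZ p a T : bounded_operator T ->
  ultraweak p (a *: T) = a * ultraweak p T.
Proof.
move=> bT; have sp1 := l2_family_sqsum p.1; have sp2 := l2_family_sqsum p.2.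
exact: (psdZl l2P a (amp_sqsum bT sp1) sp2).
Qed.

End Merging.

(** * Von Neumann algebras *)

Section VonNeumannAlgebra.
Variables (R : realType) (H : hilbertType R) (M : set (H -> H)).
Local Notation C := R[i]%C.
Implicit Types (T S : H -> H).
Hypothesis vnaM : von_neumann_algebra M.

Lemma vna_zero : M 0.
Proof.
have := vna_linear vnaM (-1) (vna_id vnaM) (vna_id vnaM).
by rewrite scaleN1r addNr.
Qed.

Lemma vnaZ (a : C) T : M T -> M (a *: T).
Proof. by move=> MT; rewrite -[_ *: _]addr0; apply: vna_linear => //; exact: vna_zero. Qed.

Lemma vnaB T S : M T -> M S -> M (T - S).
Proof. by move=> MT MS; rewrite -scaleN1r addrC; exact: vna_linear. Qed.

Lemma vna_adj T : M T -> is_adjoint T (adjoint T) /\ M (adjoint T).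
Proof. by move=> MT; have [S MS TS] := vna_adjoint vnaM MT; rewrite (adjointE TS). Qed.

Lemma adjointK T : M T -> adjoint (adjoint T) = T.
Proof. by move=> /vna_adj[h _]; apply: adjointE; exact: is_adjointC. Qed.

Lemma adjoint_lin a T S : M T -> M S ->
  adjoint (a *: T + S) = a^* *: adjoint T + adjoint S.
Proof.
by move=> /vna_adj[h _] /vna_adj[h' _]; apply: adjointE; exact: is_adjoint_lin.
Qed.

Lemma vna_op_linear T : M T -> linear T.
Proof. by move=> /(vna_bounded vnaM)[]. Qed.

Lemma comp_linr T S S' a : M T -> T \o (a *: S + S') = a *: (T \o S) + (T \o S').
Proof.
move=> MT; have lT := vna_op_linear MT; apply: funext => x.
exact: (lT a (S x) (S' x)). Qed.

(** Commutation with [c] and its adjoint is a self-adjoint condition, and a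
    closed one: T c = c T says that <T (c x), y> = <T x, d y> for all x and y. *)
Lemma commutant_closed (c d : H -> H) : bounded_operator c -> is_adjoint c d ->
  von_neumann_algebra [set T | [/\ M T, T \o c = c \o T & T \o d = d \o T]].
Proof.
move=> /bounded_operatorP[lc [k k0 hc]] cd.
have ld : linear d.
  move=> a x y; apply: eq_inner => z; rewrite innerPl !(is_adjointC cd).
  by rewrite innerPl.
have swap T S : is_adjoint T S -> T \o d = d \o T -> S \o c = c \o S.
  move=> TS Td; have h1 := is_adjoint_comp (is_adjointC cd) TS.
  have h2 := is_adjoint_comp TS (is_adjointC cd).
  by rewrite -Td in h1; rewrite (is_adjoint_uniq h1 h2).
have swap' T S : is_adjoint T S -> T \o c = c \o T -> S \o d = d \o S.
  move=> TS Tc; have h1 := is_adjoint_comp cd TS.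
  have h2 := is_adjoint_comp TS cd.
  by rewrite -Tc in h1; rewrite (is_adjoint_uniq h1 h2).
have lin e a S T : linear e -> S \o e = e \o S -> T \o e = e \o T ->
    (a *: S + T) \o e = e \o (a *: S + T).
  move=> le hS hT; apply: funext => x /=.
  have h1 := congr1 (@^~ x) hS; have h2 := congr1 (@^~ x) hT.
  transitivity (a *: S (e x) + T (e x)); first by [].
  transitivity (e (a *: S x + T x)); last by [].
  by rewrite le; congr (a *: _ + _); [exact: h1|exact: h2].
have cl e e' : is_adjoint e e' -> forall T,
    closure ([set T | [/\ M T, T \o c = c \o T & T \o d = d \o T]] : set (wot H)) T ->
    (forall T, T \o c = c \o T -> T \o d = d \o T -> T \o e = e \o T) ->
    T \o e = e \o T.
  move=> ee T hT he; apply: funext => x; apply: eq_inner => y /=.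
  apply/eqP; rewrite -subr_eq0 [inner (e _) y]ee; apply/eqP.
  pose f (S : wot H) : C^o := inner (S (e x)) y - inner (S x) (e' y).
  have fc : continuous f.
    move=> S; have c1 := @wot_continuous _ H (e x) y S.
    have c2 := @wot_continuous _ H x (e' y) S.
    exact: (cvgB c1 c2).
  have h0 : closed [set (0 : C^o)].
    by apply: accessible_closed_set1; apply: hausdorff_accessible; exact: norm_hausdorff.
  have cl0 : closed (f @^-1` [set (0 : C^o)]).
    by apply: preimage_closed; [move=> S' _; exact: fc|exact: h0].
  have sub : closure ([set T | [/\ M T, T \o c = c \o T & T \o d = d \o T]] : set (wot H))
      `<=` f @^-1` [set (0 : C^o)].
    rewrite [X in _ `<=` X]((closure_id _).1 cl0); apply: closureS => S [_ Sc Sd].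
    rewrite /f/= -ee.
    by have := congr1 (@^~ x) (he _ Sc Sd) => /= ->; rewrite subrr.
  exact: sub hT.
split.
- by move=> T [MT _ _]; exact: (vna_bounded vnaM).
- by split=> //; exact: vna_id.
- move=> a S T [MS Sc Sd] [MT Tc Td]; split; first exact: vna_linear.
    exact: lin.
  exact: lin.
- move=> S T [MS Sc Sd] [MT Tc Td]; split; first exact: vna_comp.
    by change (S \o (T \o c) = (c \o S) \o T); rewrite Tc -Sc.
  by change (S \o (T \o d) = (d \o S) \o T); rewrite Td -Sd.
- move=> T [MT Tc Td]; have [TS MS] := vna_adj MT.
  by exists (adjoint T) => //; split=> //; [exact: swap TS Td|exact: swap' TS Tc].
- move=> T [hT bT]; split.
  + apply: (vna_wot_closed vnaM); split=> //.
    by apply: closureS hT => S [].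
  + by apply: (cl _ _ cd) => //.
  + by apply: (cl _ _ (is_adjointC cd)) => //.
Qed.

End VonNeumannAlgebra.

Section GeneratedAlgebra.
Variables (R : realType) (H : hilbertType R) (n : nat).
Local Notation C := R[i]%C.
Local Notation word := (fmonom 'I_n).
Local Notation ncpoly := (malg word C).
Local Notation "''U' k" := (mkmalgU k 1) (at level 8, k at level 2).
Variables (M : set (H -> H)) (X : 'I_n -> H -> H).
Hypotheses (vnaM : von_neumann_algebra M) (XM : forall i, M (X i))
  (Xsa : forall i, is_adjoint (X i) (X i)).
Local Notation l2P := (@l2_psd R H).

Lemma WstarM : Wstar X `<=` M.
Proof. by move=> T; apply; split. Qed.

Lemma Wstar_gen i : Wstar X (X i).
Proof. by move=> N [_ ]. Qed.

Lemma Wstar_vna : von_neumann_algebra (Wstar X).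
Proof.
split.
- by move=> T /WstarM; exact: (vna_bounded vnaM).
- by move=> N [vN _]; exact: vna_id.
- move=> a S T WS WT N [vN XN].
  by apply: (vna_linear vN); [exact: WS|exact: WT].
- move=> S T WS WT N [vN XN].
  by apply: (vna_comp vN); [exact: WS|exact: WT].
- move=> T WT; have [TS _] := vna_adj vnaM (WstarM WT).
  exists (adjoint T) => // N [vN XN]; have NT : N T by apply: WT.
  by have [] := vna_adj vN NT.
- move=> T [hT bT] N [vN XN]; apply: (vna_wot_closed vN); split=> //.
  by apply: closureS hT => S; apply.
Qed.

(** The generators belong to the von Neumann algebra of [commutant_closed],
    which then contains the one they generate. *)
Lemma Wstar_commute z c d : Wstar X z -> bounded_operator c ->
    is_adjoint c d -> (forall i, X i \o c = c \o X i) ->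
  z \o c = c \o z.
Proof.
move=> Wz bc cd Xc.
have Xd i : X i \o d = d \o X i.
  have h1 := is_adjoint_comp cd (Xsa i); have h2 := is_adjoint_comp (Xsa i) cd.
  by rewrite -Xc in h1; rewrite (is_adjoint_uniq h1 h2).
have [] // : [set T | [/\ M T, T \o c = c \o T & T \o d = d \o T]] z.
by apply: Wz; split=> //; exact: commutant_closed.
Qed.

Lemma op_wordM u v : op_word X (fmmul u v) = op_word X u \o op_word X v.
Proof.
rewrite fmmulE /op_word; case: u => u; case: v => v /=.
by elim: u => //= i u ->.
Qed.

Lemma op_word_letter i : op_word X (fmu i) = X i.
Proof. by rewrite /op_word fmuE. Qed.

Lemma op_word_adjoint w : is_adjoint (op_word X w) (op_word X (wrev w)).
Proof.
elim/(@word_ind n): w => [|i w ih].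
  by rewrite wrev1 /op_word fmoneE.
rewrite wrevM wrev_letter !op_wordM op_word_letter.
exact: is_adjoint_comp.
Qed.

Lemma op_word_mem w : M (op_word X w).
Proof.
rewrite /op_word; elim: (w : seq _) => [|i s ih]; first exact: vna_id.
exact: vna_comp.
Qed.

Lemma op_eval_linear : linear (op_eval X).
Proof. exact: lin_ext_is_linear. Qed.

Lemma op_evalU w : op_eval X 'U w = op_word X w.
Proof. exact: lin_extU. Qed.

Lemma op_eval_mem P : M (op_eval X P).
Proof.
rewrite /op_eval (lin_extE _ (fsubset_refl _)).
elim/big_rec: _ => [|w T _ MT]; first exact: vna_zero.
by apply: vna_linear => //; exact: op_word_mem.
Qed.

Lemma op_eval_lmul i P :
  op_eval X (basis_map (fmmul (fmu i)) P) = X i \o op_eval X P.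
Proof.
have lin : linear (fun P => X i \o op_eval X P).
  by move=> a P1 P2; rewrite op_eval_linear (comp_linr vnaM).
apply: (linear_ext (F := fun P => op_eval X (basis_map (fmmul (fmu i)) P)) _ lin).
  by move=> a P1 P2; rewrite basis_map_linear op_eval_linear.
by move=> w; rewrite basis_mapU !op_evalU op_wordM op_word_letter.
Qed.

Lemma op_eval_rmul i P :
  op_eval X (basis_map (fun v => fmmul v (fmu i)) P) = op_eval X P \o X i.
Proof.
have lin : linear (fun P => op_eval X P \o X i).
  by move=> a P1 P2; rewrite op_eval_linear.
apply: (linear_ext (F := fun P =>
  op_eval X (basis_map (fun v => fmmul v (fmu i)) P)) _ lin).
  by move=> a P1 P2; rewrite basis_map_linear op_eval_linear.
by move=> w; rewrite basis_mapU !op_evalU op_wordM op_word_letter.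
Qed.

Lemma op_eval_ad i P :
  op_eval X (ad i P) = (X i \o op_eval X P) - (op_eval X P \o X i).
Proof.
rewrite /ad (linear_opB _ _ op_eval_linear); congr (_ - _).
  exact: op_eval_lmul.
exact: op_eval_rmul.
Qed.

(** The orbit of the family [x] under the polynomials is invariant by the [X i],
    so that the entries of the projection onto its closure commute with them,
    and with [z] by [Wstar_commute]. *)
Lemma polynomials_dense z (x : nat -> H) : Wstar X z -> sqsum x ->
  forall e : R, 0 < e -> exists P, l2norm (amp (z - op_eval X P) x) <= e.
Proof.
move=> Wz sx e e0.
pose E : set (nat -> H) := [set amp (op_eval X P) x | P in setT].
have bM T : M T -> bounded_operator T by exact: (vna_bounded vnaM).
have El2 : E `<=` sqsum (H := H).
  by move=> _ [P _ <-]; apply: amp_sqsum => //; apply: bM; exact: op_eval_mem.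
have E0 : E 0.
  exists 0 => //; have <- := scale0r (0 : ncpoly).
  by rewrite (linear_opZ _ _ op_eval_linear) scale0r.
have Elin a y y' : E y -> E y' -> E (a *: y + y').
  by move=> [P _ <-] [Q _ <-]; exists (a *: P + Q) => //; rewrite op_eval_linear.
have EX i y : E y -> E (amp (X i) y).
  move=> [P _ <-]; exists (basis_map (fmmul (fmu i)) P) => //.
  by rewrite op_eval_lmul.
have [zS WS] := vna_adj Wstar_vna Wz.
have comz i j : proj_entry E i j \o z = z \o proj_entry E i j.
  apply/esym/(Wstar_commute Wz (proj_entry_bounded El2 E0 Elin i j)
    (proj_entry_adjoint El2 E0 Elin i j)) => k.
  apply/esym/(proj_entry_comm El2 E0 Elin i j (bM _ (XM k)) (bM _ (XM k)) (Xsa k));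
    exact: EX.
have Ex : E x by exists 'U (fmone _) => //; rewrite op_evalU /op_word fmoneE.
have [_ [P _ <-] hP] := bicommutant_adherent El2 E0 Elin (bM _ (WstarM Wz))
  (bM _ (WstarM WS)) zS comz Ex e0.
by exists P.
Qed.

End GeneratedAlgebra.

(** * Factoriality *)

Section TracialSpace.
Variables (R : realType) (H : hilbertType R).
Local Notation C := R[i]%C.
Variables (M : set (H -> H)) (tau : (H -> H) -> C).
Hypothesis tws : tracial_Wstar_space M tau.
Implicit Types (S T : H -> H).
Let vnaM : von_neumann_algebra M := tws_vna tws.

Definition tau_form S T : C := tau (adjoint T \o S).

Lemma tau_psd : psd M tau_form.
Proof.
have vM := vnaM; apply: psd_intro.
- exact: vna_zero.
- by move=> a S T; exact: vna_linear.
- move=> a S T U MS MT MU; have [_ MU'] := vna_adj vM MU.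
  rewrite /tau_form (comp_linr vM)//.
  by apply: (tws_linear tws); exact: vna_comp.
- move=> a S T U MS MT MU; have [_ MS'] := vna_adj vM MS.
  have [_ MT'] := vna_adj vM MT.
  rewrite /tau_form (adjoint_lin vM)//.
  exact: (tws_linear tws _ (vna_comp vM MS' MU) (vna_comp vM MT' MU)).
- by move=> T MT; exact: (tws_positive tws).
Qed.

Lemma tauB S T : M S -> M T -> tau (S - T) = tau S - tau T.
Proof.
move=> MS MT; rewrite -scaleN1r addrC (tws_linear tws)//.
by rewrite mulN1r addrC.
Qed.

Lemma tauZ a T : M T -> tau (a *: T) = a * tau T.
Proof.
have M0 := vna_zero vnaM; have tau0 : tau 0 = 0.
  by have := tauB M0 M0; rewrite !subrr.
by move=> MT; rewrite -[a *: T]addr0 (tws_linear tws)// tau0 addr0.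
Qed.

Lemma norm2_adjoint T : M T -> norm2 tau (adjoint T) = norm2 tau T.
Proof.
move=> MT; have [_ MT'] := vna_adj vnaM MT.
by rewrite /norm2 (adjointK vnaM)// (tws_tracial tws).
Qed.

Lemma tau_cs S T : M S -> M T ->
  cabs (tau (S \o T)) <= norm2 tau S * norm2 tau T.
Proof.
move=> MS MT; have [_ MS'] := vna_adj vnaM MS.
have := cauchy_schwarz tau_psd MT MS'.
rewrite {1}/tau_form (adjointK vnaM)// mulrC.
by rewrite -/(norm2 tau T) -[nrm _ (adjoint S)]/(norm2 tau (adjoint S)) norm2_adjoint.
Qed.

(** Normality at 0, made homogeneous by scaling. *)
Lemma tau_ultraweak_bound :
  exists s : seq (@l2_family R H * @l2_family R H),
  exists2 K : R, 0 <= K & forall T, M T ->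
    cabs (tau T) <= K * \sum_(p <- s) cabs (ultraweak p T).
Proof.
have M0 := vna_zero vnaM.
have tau0 : tau 0 = 0 by have := tauB M0 M0; rewrite !subrr.
have /subspace_continuousP/(_ _ M0) := tws_normal tws.
move=> /(@cvgrPdist_le _ C^o)/(_ 1 ltr01) h.
have [s [e [e0 he]]] := uwt_nbhs0 h.
have e1 : 0 <= e^-1 by rewrite invr_ge0 ltW.
exists s, e^-1 => // T MT.
set S := \sum_(p <- s) _; have S0 : 0 <= S.
  by apply: sumr_ge0 => p _; exact: cabs_ge0.
rewrite mulrC ler_pdivlMr//; apply/ler_addgt0Pr => d d0.
have Sd : 0 < S + d by rewrite ltr_wpDl.
pose t := e / (S + d); have t0 : 0 < t by rewrite divr_gt0.
have : cabs (tau (t%:C%C *: T)) <= 1.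
  have le_e : \sum_(p <- s) cabs (ultraweak p (t%:C%C *: T)) <= e.
    rewrite (eq_bigr (fun p => t * cabs (ultraweak p T))) => [|p _]; last first.
      rewrite ultraweakZ; last exact: (vna_bounded vnaM).
      by rewrite cabsM cabs_real gtr0_norm.
    rewrite -mulr_sumr -/S /t -mulrA -[leRHS]mulr1 ler_wpM2l ?(ltW e0)//.
    by rewrite mulrC ler_pdivrMr// mul1r lerDl ltW.
  have near1 : `|tau (0 : H -> H) - tau (t%:C%C *: T)| <= 1.
    exact: he _ le_e (vnaZ vnaM _ MT).
  by rewrite tau0 sub0r normrN cabsE lecR in near1.
rewrite tauZ// cabsM cabs_real (gtr0_norm t0) mulrC /t mulrA ler_pdivrMr//.
by rewrite mul1r.
Qed.

(** One square-summable family controls the trace of S T for all S and T, by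
    Cauchy-Schwarz after moving S to the other side of the inner products. *)
Lemma tau_spatial_bound : exists2 x : nat -> H, sqsum x & forall S, M S ->
  exists2 K : R, 0 <= K & forall T, M T ->
    cabs (tau (S \o T)) <= K * l2norm (amp T x).
Proof.
have [s [K K0 hK]] := tau_ultraweak_bound.
have [x sx hx] := ultraweak_bound s; exists x => // S MS.
have [SS' MS'] := vna_adj vnaM MS.
have [Y Y0 hY] := hx S _ (vna_bounded vnaM MS') SS'.
exists (K * Y) => [|T MT]; first exact: mulr_ge0.
apply: le_trans (hK _ (vna_comp vnaM MS MT)) _.
by rewrite -mulrA ler_wpM2l// hY//; exact: (vna_bounded vnaM).
Qed.

Section Law.
Variables (n : nat) (X : 'I_n -> H -> H).
Hypotheses (XM : forall i, M (X i)) (Xsa : forall i, is_adjoint (X i) (X i)).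
Local Notation word := (fmonom 'I_n).
Local Notation ncpoly := (malg word C).
Local Notation "''U' k" := (mkmalgU k 1) (at level 8, k at level 2).
Let phi (w : word) : C := tau (op_word X w).

Let evalM P : M (op_eval X P) := op_eval_mem vnaM XM P.

(** The form built from the moments is the one of L^2(M, tau). *)
Lemma kform_law P Q :
  kform (law_kernel phi) P Q = tau_form (op_eval X P) (op_eval X Q).
Proof.
have wM := op_word_mem vnaM XM.
have evalE Z : op_eval X Z = \sum_(w <- msupp Z) mcoeff w Z *: op_word X w.
  by rewrite /op_eval (lin_extE _ (fsubset_refl _)).
rewrite kformE [op_eval X P]evalE (psd_suml tau_psd)//; apply: eq_bigr => u _.
rewrite evalE (psd_sumr tau_psd)// mulr_sumr; apply: eq_bigr => v _.
rewrite -mulrA /law_kernel /phi (op_wordM X) /tau_form.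
by rewrite (adjointE (op_word_adjoint Xsa v)).
Qed.

Lemma nrm_law P : nrm (kform (law_kernel phi)) P = norm2 tau (op_eval X P).
Proof. by rewrite /nrm kform_law. Qed.

Lemma law_growth : exists c K0 : R, 0 < c /\
  forall w, cabs (phi w) <= K0 * c ^+ size w.
Proof.
have [x sx /(_ _ (vna_id vnaM))[K K0 hK]] := tau_spatial_bound.
have /choice[a ha] i : exists c : R, 0 < c /\ forall h, hnorm (X i h) <= c * hnorm h.
  have /bounded_operatorP[_ [c c0 hc]] := vna_bounded vnaM (XM i).
  by exists c.
pose c := 1 + \sum_i a i.
have a0 i : 0 <= a i by exact: ltW (ha i).1.
have c0 : 0 < c by rewrite ltr_wpDr// sumr_ge0.
have ac i : a i <= c.
  by rewrite /c (bigD1 i)//= addrCA lerDl addr_ge0// sumr_ge0.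
have wbound (w : word) h : hnorm (op_word X w h) <= c ^+ size w * hnorm h.
  rewrite /op_word; elim: (w : seq _) h => [|i s ih] h; first by rewrite mul1r.
  apply: le_trans ((ha i).2 _) _; rewrite exprS -mulrA.
  by apply: ler_pM => //; exact: hnorm_ge0.
exists c, (K * l2norm x); split=> // w.
have wM := op_word_mem vnaM XM w.
apply: le_trans (hK _ wM) _; rewrite -mulrA ler_wpM2l// mulrC.
apply: amp_bound => //; first exact: (vna_bounded vnaM).
by rewrite exprn_ge0// ltW.
Qed.

(** The Cauchy-Schwarz inequality for tau, with the bound of the 2-norms of a
    Cauchy sequence. *)
Lemma L2_pair_bound (xi : L2 (Wstar X) tau) : exists2 K : R, 0 <= K &
  forall T, M T -> cabs (L2_pair xi T) <= K * norm2 tau T.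
Proof.
have xM k : M (xi k) := WstarM vnaM XM (L2_mem xi k).
have nrm0 T : 0 <= norm2 tau T by exact: sqrtr_ge0.
have [N hN] := L2_cauchy xi ltr01.
exists (1 + norm2 tau (xi N)); first by rewrite addr_ge0.
move=> T MT; pose v k := tau (xi k \o T).
have bnd k : (N <= k)%N -> cabs (v k) <= (1 + norm2 tau (xi N)) * norm2 tau T.
  move=> Nk; apply: le_trans (tau_cs (xM k) MT) _; apply: ler_wpM2r => //.
  have := nrmD tau_psd (vnaB vnaM (xM k) (xM N)) (xM N).
  rewrite subrK => h; apply: le_trans h _.
  by rewrite lerD2r; exact: ltW (hN _ _ Nk (leqnn N)).
have [a hal] : exists a, forall e : R, 0 < e ->
    exists N, forall k, (N <= k)%N -> cabs (v k - a) <= e.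
  apply: complex_cauchy => e e0.
  have d0 : 0 < e / (norm2 tau T + 1) by rewrite divr_gt0// ltr_wpDl.
  have [N' hN'] := L2_cauchy xi d0; exists N' => k l Nk Nl.
  rewrite /v -(tauB (vna_comp vnaM (xM k) MT) (vna_comp vnaM (xM l) MT)).
  have := tau_cs (vnaB vnaM (xM k) (xM l)) MT; move=> /le_trans; apply.
  rewrite -[leRHS](divfK (x := norm2 tau T + 1)); last first.
    by rewrite gt_eqF// ltr_wpDl.
  by apply: ler_pM; rewrite ?nrm0 ?lerDl// ltW// hN'.
have -> : L2_pair xi T = a by apply: (cvg_lim (T := C^o)) => //; exact: cvg_cabs hal.
apply/ler_addgt0Pr => e /hal[N' hN'].
have h1 := hN' _ (leq_maxr N N'); have h2 := bnd _ (leq_maxl N N').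
have := cabsD (a - v (maxn N N')) (v (maxn N N')).
by rewrite subrK cabsB => /le_trans; apply; rewrite addrC lerD.
Qed.

Lemma fisher_bound i : (free_fisher tau X < +oo)%E -> exists2 K : R, 0 <= K &
  forall P, cabs (pairing phi (free_diff i P)) <=
            K * nrm (kform (law_kernel phi)) P.
Proof.
rewrite /free_fisher; case: pselect => // /(_ i)[xi hxi] _.
have [K K0 hK] := L2_pair_bound xi; exists K => // P.
by have := hK _ (evalM P); rewrite hxi nrm_law.
Qed.

(** [l] is bounded and kills the commutators as z^* commutes with the [X i], so
    that [central_functional] applies; z^* minus its trace is then orthogonal
    to the polynomials, and to its adjoint, which they approximate. *)
Lemma center_scalar z : (2 <= n)%N -> (free_fisher tau X < +oo)%E ->
  vn_center (Wstar X) z -> exists c : C, z = c *: idfun.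
Proof.
move=> n2 fish [Wz comz].
have Mz := WstarM vnaM XM Wz; have [zz' Mz'] := vna_adj vnaM Mz.
set z' := adjoint z in zz' Mz'.
have comz' i : z' \o X i = X i \o z'.
  have h1 := is_adjoint_comp zz' (Xsa i); have h2 := is_adjoint_comp (Xsa i) zz'.
  by rewrite comz in h1; [rewrite (is_adjoint_uniq h1 h2)|exact: Wstar_gen].
pose i0 : 'I_n := Ordinal (ltnW n2); pose i1 : 'I_n := Ordinal n2.
have i01 : i0 != i1 by [].
pose l P : C := tau (z' \o op_eval X P).
have zP P : M (z' \o op_eval X P) by exact: vna_comp.
have l_lin : linear (l : ncpoly -> C^o).
  move=> a P Q; rewrite /l op_eval_linear (comp_linr vnaM)//.
  exact: (tws_linear tws).
have l_ad i P : l (ad i P) = 0.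
  have MXP : M (X i \o op_eval X P) by exact: vna_comp.
  have MPX : M (op_eval X P \o X i) by exact: vna_comp.
  have -> : l (ad i P) = tau ((z' \o (X i \o op_eval X P)) - (z' \o (op_eval X P \o X i))).
    rewrite /l (op_eval_ad vnaM XM); congr tau; apply: funext => h.
    exact: (linear_opB _ _ (vna_op_linear vnaM Mz')).
  rewrite tauB; [|exact: vna_comp|exact: vna_comp].
  have -> : z' \o (X i \o op_eval X P) = X i \o (z' \o op_eval X P).
    by rewrite -[LHS]/((z' \o X i) \o op_eval X P) comz'.
  rewrite (tws_tracial tws)//.
  by apply/eqP; rewrite subr_eq0.
have l_bound P : cabs (l P) <= norm2 tau z' * nrm (kform (law_kernel phi)) P.
  by rewrite nrm_law; exact: tau_cs.
have [c [K0 [c0 growth]]] := law_growth.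
have phi1 : phi (fmone _) = 1 by rewrite /phi /op_word fmoneE; exact: (tws_unit tws).
have phiC u v : phi (fmmul u v) = phi (fmmul v u).
  by rewrite /phi !(op_wordM X) (tws_tracial tws)//; exact: op_word_mem.
have phi_pos P : 0 <= kform (law_kernel phi) P P.
  by rewrite kform_law; exact: (psd_ge0 tau_psd).
have key v := central_functional phi1 phiC phi_pos c0 growth i01
  (fisher_bound i0 fish) (fisher_bound i1 fish) (sqrtr_ge0 _) l_lin l_bound
  (l_ad i0) (l_ad i1) v.
pose t := tau z'.
have l1 : l 'U (fmone _) = t.
  by rewrite /l op_evalU /op_word fmoneE.
pose y := z' - t *: idfun.
have My : M y by apply: vnaB => //; apply: vnaZ => //; exact: vna_id.
have y_orth P : tau (y \o op_eval X P) = 0.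
  have -> : tau (y \o op_eval X P) = l P - t * tau (op_eval X P).
    by rewrite -tauZ// -tauB//; apply: vnaZ.
  apply/eqP; rewrite subr_eq0; apply/eqP.
  apply: (@linear_ext C _ C^o (l : ncpoly -> C^o) (fun P => t * tau (op_eval X P))) => //.
    move=> a P1 P2; rewrite op_eval_linear (tws_linear tws)// mulrDr.
    by rewrite mulrCA.
  by move=> w; rewrite [LHS]key l1 op_evalU.
pose z0 := z - t^* *: idfun.
have yz : adjoint z0 = y.
  have -> : z0 = (- t^*) *: idfun + z by rewrite scaleNr addrC.
  rewrite (adjoint_lin vnaM _ (vna_id vnaM) Mz) (adjointE (@is_adjoint_id _ H)).
  by rewrite rmorphN/= conjCK scaleNr addrC.
have WV := Wstar_vna vnaM XM.
have Wz0 : Wstar X z0.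
  by apply: (vnaB WV) => //; apply: (vnaZ WV); exact: (vna_id WV).
have Mz0 := WstarM vnaM XM Wz0.
have [x sx /(_ _ My)[K K0' hK]] := tau_spatial_bound.
have tau0 : tau (adjoint z0 \o z0) = 0.
  rewrite yz; apply: cabs_le_eps => e e0.
  have d0 : 0 < e / (K + 1) by rewrite divr_gt0// ltr_wpDl.
  have [P hP] := polynomials_dense vnaM XM Xsa Wz0 sx d0.
  have MzP : M (z0 - op_eval X P) by exact: vnaB.
  have -> : tau (y \o z0) = tau (y \o (z0 - op_eval X P)).
    have -> : y \o (z0 - op_eval X P) = (y \o z0) - (y \o op_eval X P).
      by apply: funext => h; exact: (linear_opB _ _ (vna_op_linear vnaM My)).
    rewrite tauB; [|exact: vna_comp|exact: vna_comp].
    by rewrite y_orth subr0.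
  apply: le_trans (hK _ MzP) _.
  rewrite -[leRHS](divfK (x := K + 1)); last by rewrite gt_eqF// ltr_wpDl.
  rewrite mulrC; apply: ler_pM; rewrite ?nrm_ge0// lerDl//.
exists t^*; have /eqP := tws_faithful tws Mz0 tau0.
by rewrite subr_eq0 => /eqP.
Qed.

End Law.
End TracialSpace.

Theorem theorem1 (R : realType) (H : hilbertType R)
  (M : set (H -> H)) (tau : (H -> H) -> R[i]%C)
  (n : nat) (X : 'I_n -> H -> H) :
  tracial_Wstar_space M tau ->
  (2 <= n)%N ->
  (forall i, M (X i)) ->
  (forall i, is_adjoint (X i) (X i)) ->
  (free_fisher tau X < +oo)%E ->
  is_factor (Wstar X).
Proof.
move=> tws n2 XM Xsa fish; have vnaM := tws_vna tws.
have WV := Wstar_vna vnaM XM; split=> //; apply/seteqP; split=> [z cz|_ [c _ <-]].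
  by have [c ->] := center_scalar tws XM Xsa n2 fish cz; exists c.
split=> [|T WT]; first by apply: (vnaZ WV); exact: (vna_id WV).
have lT := vna_op_linear WV WT; apply: funext => h.
exact/esym/(linear_opZ _ _ lT).
Qed.
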